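(* Let $f:M^n\to N^{n+m}(c)$ be an isometric immersion of an $n$-dimensional Riemannian manifold ($n\ge 2$) into an $(n+m)$-dimensional real space form of constant sectional curvature $c$. Then at every point of $M$ $$\rho+\rho^{\perp}\leq |H|^2+c .$$ Moreover (for $m\ge 2$), equality holds at a point $p\in M$ if and only if there exist an orthonormal basis $\{e_1,\dots,e_n\}$ of $T_pM$, an orthonormal basis $\{\xi_1,\dots,\xi_m\}$ of the normal space $T_p^{\perp}M$, and real numbers $\mu,\lambda_1,\dots,\lambda_m$, such that with respect to $\{e_1,\dots,e_n\}$ the shape operators are $$A_{\xi_1}=\begin{pmatrix}\lambda_1&\mu&0&\cdots&0\\ \mu&\lambda_1&0&\cdots&0\\ 0&0&\lambda_1&\cdots&0\\ \vdots&\vdots&\vdots&\ddots&\vdots\\ 0&0&0&\cdots&\lambda_1\end{pmatrix},\qquad A_{\xi_2}=\begin{pmatrix}\lambda_2+\mu&0&0&\cdots&0\\ 0&\lambda_2-\mu&0&\cdots&0\\ 0&0&\lambda_2&\cdots&0\\ \vdots&\vdots&\vdots&\ddots&\vdots\\ 0&0&0&\cdots&\lambda_2\end{pmatrix},$$ and $A_{\xi_r}=\lambda_r I_n$ for $r>2$, where $I_n$ is the $n\times n$ identity matrix.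
   Context: The normalized scalar curvature $\rho$ and the normal scalar curvature $\rho^{\perp}$ at a point are $$\rho=\frac{2}{n(n-1)}\sum_{1\le i<j\le n}R(e_i,e_j,e_j,e_i),\qquad \rho^{\perp}=\frac{2}{n(n-1)}\Big(\sum_{1\le i<j\le n}\ \sum_{1\le r<s\le m}\langle R^{\perp}(e_i,e_j)\xi_r,\xi_s\rangle^2\Big)^{1/2},$$ where $\{e_1,\dots,e_n\}$ is an orthonormal basis of the tangent space, $\{\xi_1,\dots,\xi_m\}$ is an orthonormal basis of the normal space, $R$ is the curvature tensor of the tangent bundle (with sign convention such that $R(e_i,e_j,e_j,e_i)$ is the sectional curvature of the plane spanned by $e_i,e_j$), and $R^{\perp}$ is the curvature tensor of the normal bundle. $h$ denotes the second fundamental form, $H=\frac1n\operatorname{Tr} h$ is the mean curvature vector field, and for a normal vector $\xi$ the shape operator $A_\xi$ is defined by $\langle A_\xi X,Y\rangle=\langle h(X,Y),\xi\rangle$. *)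

(* Defs.v *)
From HB Require Import structures.
From mathcomp Require Import all_boot all_order all_algebra.
From mathcomp Require Import all_classical all_reals all_analysis.

Set Implicit Arguments.
Unset Strict Implicit.
Unset Printing Implicit Defensive.

Import Order.TTheory GRing.Theory Num.Theory.
Import numFieldNormedType.Exports.

Local Open Scope classical_set_scope.
Local Open Scope ring_scope.

(* Vectors are rows and linear maps act on the right, as in MathComp: the
   Jacobian 'J F x of F : R^n -> R^k is the n x k matrix whose i-th row is the
   i-th partial derivative of F, and 'D_v F x = v *m 'J F x. *)

Section Smooth.
Context {R : realType} {n : nat} {W : normedModType R}.

(* Class C^k on U; U is always open below, so that 'D_v f x depends only on
   the values of f in U. *)
Fixpoint Ck (k : nat) (U : set 'rV[R]_n) (f : 'rV[R]_n -> W) : Prop :=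
  match k with
  | 0 => forall x, U x -> {for x, continuous f}
  | k'.+1 => (forall x, U x -> differentiable f x) /\
             forall v : 'rV[R]_n, Ck k' U (fun x => 'D_v f x)
  end.

Definition smooth_on (U : set 'rV[R]_n) (f : 'rV[R]_n -> W) : Prop :=
  forall k, Ck k U f.

End Smooth.

Section InnerProduct.
Context {R : realType} {n : nat}.
Implicit Types (g : 'M[R]_n) (u v : 'rV[R]_n).

Definition ip g u v : R := (u *m g *m v^T) 0 0.

Definition vnorm g v : R := Num.sqrt (ip g v v).

Definition pos_def g : Prop := forall v, v != 0 -> 0 < ip g v v.

Definition orthonormal_frame g k (e : 'I_k -> 'rV[R]_n) : Prop :=
  forall i j, ip g (e i) (e j) = (i == j)%:R.

End InnerProduct.

Record chart (R : realType) (n : nat) (T : topologicalType) := Chart {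
  chart_dom : set T;
  chart_map : T -> 'rV[R]_n;
  chart_inv : 'rV[R]_n -> T;
  chart_dom_open : open chart_dom;
  chart_codom_open : open (chart_map @` chart_dom);
  chart_mapK : {in chart_dom, cancel chart_map chart_inv};
  chart_map_continuous : {in chart_dom, continuous chart_map};
  chart_inv_continuous : {in chart_map @` chart_dom, continuous chart_inv}
}.

Definition overlap (R : realType) n (T : topologicalType)
  (phi psi : chart R n T) : set 'rV[R]_n :=
  chart_map phi @` (chart_dom phi `&` chart_dom psi).

Definition transition (R : realType) n (T : topologicalType)
  (phi psi : chart R n T) : 'rV[R]_n -> 'rV[R]_n :=
  chart_map psi \o chart_inv phi.

(* The metric is given by its Gram matrices in the coordinate frames of the
   charts of the atlas, which obey the tensorial transformation rule. *)
Record riemannian (R : realType) (n : nat) := Riemannian {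
  carrier :> topologicalType;
  carrier_hausdorff : hausdorff_space carrier;
  carrier_second_countable : @second_countable carrier;
  atlas : set (chart R n carrier);
  atlas_cover : forall p : carrier, exists2 phi, atlas phi & chart_dom phi p;
  atlas_smooth : forall phi psi, atlas phi -> atlas psi ->
    smooth_on (overlap phi psi) (transition phi psi);
  metric : chart R n carrier -> 'rV[R]_n -> 'M[R]_n;
  metric_smooth : forall phi, atlas phi ->
    smooth_on (chart_map phi @` chart_dom phi) (metric phi);
  metric_sym : forall phi x, atlas phi -> (chart_map phi @` chart_dom phi) x ->
    (metric phi x)^T = metric phi x;
  metric_pos_def : forall phi x, atlas phi ->
    (chart_map phi @` chart_dom phi) x ->
    pos_def (metric phi x);
  metric_transition : forall phi psi x, atlas phi -> atlas psi ->
    overlap phi psi x ->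
    metric phi x = 'J (transition phi psi) x
                   *m metric psi (transition phi psi x)
                   *m ('J (transition phi psi) x)^T
}.

Section Intrinsic.
Context {R : realType} {n : nat}.
Variable g : 'rV[R]_n -> 'M[R]_n.
Implicit Types (x u v X Y Z W : 'rV[R]_n) (V : 'rV[R]_n -> 'rV[R]_n).

(* Gamma_x(u, v), from Koszul's formula on fields with constant coordinates:
   2 <Gamma(u,v), w> = D_u <v,w> + D_v <u,w> - D_w <u,v>. *)
Definition christoffel x u v : 'rV[R]_n :=
  (\row_k (2^-1 * ('D_u (fun y => ip (g y) v (delta_mx 0 k)) x
                   + 'D_v (fun y => ip (g y) u (delta_mx 0 k)) x
                   - 'D_(delta_mx 0 k) (fun y => ip (g y) u v) x)))
  *m invmx (g x).

Definition nabla X V x : 'rV[R]_n := 'D_X V x + christoffel x X (V x).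

(* R(X,Y)Z = nabla_X nabla_Y Z - nabla_Y nabla_X Z - nabla_[X,Y] Z, computed on
   the extensions of X, Y, Z with constant coordinates, for which [X,Y] = 0. *)
Definition curv x X Y Z : 'rV[R]_n :=
  nabla X (nabla Y (cst Z)) x - nabla Y (nabla X (cst Z)) x.

Definition Riem x X Y Z W : R := ip (g x) (curv x X Y Z) W.

Definition sectional_curvature x X Y : R :=
  Riem x X Y Y X /
  (ip (g x) X X * ip (g x) Y Y - ip (g x) X Y ^+ 2).

Definition rho x (e : 'I_n -> 'rV[R]_n) : R :=
  2 / (n%:R * (n%:R - 1)) *
  \sum_(i < n) \sum_(j < n | (i < j)%N) Riem x (e i) (e j) (e j) (e i).

End Intrinsic.

Definition constant_curvature (R : realType) n (N : riemannian R n) (c : R)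
  : Prop :=
  forall psi y, atlas psi -> (chart_map psi @` chart_dom psi) y ->
  forall u v : 'rV[R]_n, row_free (col_mx u v) ->
  sectional_curvature (@metric R n N psi) y u v = c.

Section Immersion.
Context {R : realType} {n k : nat} {M : riemannian R n} {N : riemannian R k}.
Implicit Types (f : M -> N) (phi : chart R n M) (psi : chart R k N).

Definition in_charts f phi psi : 'rV[R]_n -> 'rV[R]_k :=
  chart_map psi \o f \o chart_inv phi.

Definition in_charts_dom f phi psi : set 'rV[R]_n :=
  chart_map phi @` (chart_dom phi `&` f @^-1` chart_dom psi).

Definition smooth_map f : Prop :=
  continuous f /\
  forall phi psi, atlas phi -> atlas psi ->
  smooth_on (in_charts_dom f phi psi) (in_charts f phi psi).

Definition isometric_immersion f : Prop :=
  smooth_map f /\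
  forall phi psi x, atlas phi -> atlas psi -> in_charts_dom f phi psi x ->
  let J := 'J (in_charts f phi psi) x in
  row_free J /\
  metric phi x = J *m metric psi (in_charts f phi psi x) *m J^T.

End Immersion.

(* Below, g is the metric of the immersed manifold, G the metric of the ambient
   manifold and F the immersion, all read in charts.  A normal vector at the
   point with coordinates x is a vector of coordinates xi in the ambient chart,
   orthogonal for G (F x) to the image of the differential of F at x. *)

Section Extrinsic.
Context {R : realType} {n k : nat}.
Variables (g : 'rV[R]_n -> 'M[R]_n) (G : 'rV[R]_k -> 'M[R]_k).
Variable F : 'rV[R]_n -> 'rV[R]_k.
Implicit Types (x X Y : 'rV[R]_n) (w xi : 'rV[R]_k) (V : 'rV[R]_n -> 'rV[R]_k).

Definition normal_vector x xi : Prop :=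
  forall X, ip (G (F x)) ('D_X F x) xi = 0.

(* The tangential part of w is sum_(i,j) g^(ij) <w, d_i F> d_j F. *)
Definition normal_part x w : 'rV[R]_k :=
  w - w *m G (F x) *m ('J F x)^T *m invmx (g x) *m 'J F x.

(* Ambient Levi-Civita connection on vector fields along F. *)
Definition nabla_along X V x : 'rV[R]_k :=
  'D_X V x + christoffel G (F x) ('D_X F x) (V x).

Definition sff x X Y : 'rV[R]_k :=
  normal_part x (nabla_along X (fun y => 'D_Y F y) x).

(* A_xi X, as the vector representing Y |-> <h(X,Y), xi>. *)
Definition shape_operator x xi X : 'rV[R]_n :=
  (\row_j ip (G (F x)) (sff x X (delta_mx 0 j)) xi) *m invmx (g x).

Definition mean_curvature x (e : 'I_n -> 'rV[R]_n) : 'rV[R]_k :=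
  n%:R^-1 *: \sum_(i < n) sff x (e i) (e i).

Definition nabla_perp X V x : 'rV[R]_k := normal_part x (nabla_along X V x).

(* R^perp(X,Y)xi, computed on the extensions of X, Y with constant coordinates
   and on the normal section y |-> normal_part y xi, whose value at x is xi
   when xi is normal at x. *)
Definition normal_curv x X Y xi : 'rV[R]_k :=
  let S y := normal_part y xi in
  nabla_perp X (nabla_perp Y S) x - nabla_perp Y (nabla_perp X S) x.

Definition rho_perp m x (e : 'I_n -> 'rV[R]_n) (xi : 'I_m -> 'rV[R]_k) : R :=
  2 / (n%:R * (n%:R - 1)) *
  Num.sqrt (\sum_(i < n) \sum_(j < n | (i < j)%N)
            \sum_(r < m) \sum_(s < m | (r < s)%N)
              ip (G (F x)) (normal_curv x (e i) (e j) (xi r)) (xi s) ^+ 2).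

(* When k = n + m the normal space has dimension m, so that m orthonormal
   normal vectors are a basis of it. *)
Definition normal_orthonormal_frame m x (xi : 'I_m -> 'rV[R]_k) : Prop :=
  orthonormal_frame (G (F x)) xi /\ forall r, normal_vector x (xi r).

End Extrinsic.

Definition matrix_in_frame (R : realType) n (e : 'I_n -> 'rV[R]_n)
  (A : 'rV[R]_n -> 'rV[R]_n) (B : 'M[R]_n) : Prop :=
  forall j, A (e j) = \sum_(i < n) B i j *: e i.

(* The matrix prescribed for A_(xi_(r+1)): the indices of 'I_m and 'I_n start
   at 0. *)
Definition extremal_mx (R : realType) n (r : nat) (mu lambda : R) : 'M[R]_n :=
  \matrix_(i, j)
    (lambda * (i == j)%:R +
     match r, nat_of_ord i, nat_of_ord j with
     | 0, 0, 1 | 0, 1, 0 => mu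
     | 1, 0, 0 => mu
     | 1, 1, 1 => - mu
     | _, _, _ => 0
     end).

Lemma pos_def_unit (R : realType) n (g : 'M[R]_n) : pos_def g -> g \in unitmx.
Proof.
move=> gpos; rewrite -row_free_unit -kermx_eq0; apply/eqP/row_matrixP => i.
rewrite row0; apply/eqP; apply: contraT => /gpos.
have /sub_kermxP e : (row i (kermx g) <= kermx g)%MS by exact: row_sub.
by rewrite /ip e mul0mx mxE ltxx.
Qed.

Lemma shape_operatorE (R : realType) n k (g : 'rV[R]_n -> 'M[R]_n)
  (G : 'rV[R]_k -> 'M[R]_k) (F : 'rV[R]_n -> 'rV[R]_k) x xi X j :
  pos_def (g x) ->
  ip (g x) (shape_operator g G F x xi X) (delta_mx 0 j)
  = ip (G (F x)) (sff g G F x X (delta_mx 0 j)) xi.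
Proof.
move=> /pos_def_unit gU.
by rewrite {1}/ip /shape_operator mulmxKV// trmx_delta -colE !mxE.
Qed.

Lemma normal_part_normal (R : realType) n k (g : 'rV[R]_n -> 'M[R]_n)
  (G : 'rV[R]_k -> 'M[R]_k) (F : 'rV[R]_n -> 'rV[R]_k) x w :
  pos_def (g x) -> g x = 'J F x *m G (F x) *m ('J F x)^T ->
  normal_part g G F x w *m G (F x) *m ('J F x)^T = 0.
Proof.
move=> /pos_def_unit gU gE; rewrite /normal_part !mulmxBl.
set J := 'J F x in gE *.
by rewrite -[_ *m J *m _]mulmxA -[_ *m (J *m _) *m _]mulmxA -gE mulmxKV ?subrr.
Qed.

(* Main.v *)
Require Import Defs.
From mathcomp Require Import all_boot all_order all_algebra all_fingroup.
From mathcomp Require Import complex ring lra.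
Set Implicit Arguments.
Unset Strict Implicit.
Unset Printing Implicit Defensive.
Import Order.TTheory GRing.Theory Num.Theory.
Local Open Scope ring_scope.

(** Why the theorem is true.

    Fix a point, an orthonormal tangent frame e_1, ..., e_n and an orthonormal
    normal frame xi_1, ..., xi_m, and let B_r be the symmetric matrix of the
    shape operator of xi_r.  The equations of Gauss and Ricci express the two
    curvatures through these matrices, because the curvature tensor of a space
    form is c (<Y,Z> X - <X,Z> Y): the sectional curvature of the plane of e_i
    and e_j is c + sum_r (B_r(i,i) B_r(j,j) - B_r(i,j)^2), and
    <R^perp(e_i,e_j) xi_r, xi_s> is the entry (i,j) of [B_s, B_r].  Writing B'_r
    for the traceless part of B_r, the gap |H|^2 + c - rho - rho^perp is
    therefore
      (sum_r |B'_r|^2 - (sum_(r,s) |[B'_r, B'_s]|^2)^(1/2)) / (n (n - 1))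
    (curvature_defect, rho_defect), and the theorem becomes the inequality
    sum_(r,s) |[B_r, B_s]|^2 <= (sum_r |B_r|^2)^2 for symmetric matrices together
    with its equality case, which was the conjecture of De Smet, Dillen,
    Verstraelen and Vrancken.

    The matrix inequality (ddvv_inequality).  Both sides are invariant under
    B_r |-> sum_s Q(r,s) B_s with Q orthogonal, so that B_r = sqrt(x_r) Q_r may
    be assumed, where the Q_r are mutually orthogonal unit matrices.  The key
    estimate (sum_nsq_bracket_le) is that, for every member A of an orthonormal
    family L of symmetric matrices, sum_(b in L) |[A, Q_b]|^2 <= #|L|.  When A
    is diagonal with eigenvalues l_i, Bessel's inequality reduces it to
    sum_(i < j) max((l_i - l_j)^2 - 1, 0) <= 1 whenever sum_i l_i^2 <= 1; this
    holds because the pairs at distance greater than 1 form a star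
    (far_star, star_identity).  The weights x_r are then introduced by peeling
    off the least one: x = t + y with y vanishing somewhere, where t is the
    minimum of x (qform_le).

    Equality (ddvv_equality) forces equality in the key estimate for every
    member of the support L of x.  Diagonalising one member then confines all
    the others to a star, hence makes their mutual brackets small, whereas
    diagonalising any of these others shows that the same brackets are large:
    so L has only two members (extremal_card), which are the two matrices of
    the statement (extremal_pair).

    The geometry is done in charts.  The curvature of the Levi-Civita
    connection pulled back by F is the ambient curvature (curvature_along); the
    pairing of the second covariant derivative of F with the differential of F
    is the Christoffel symbol of the induced metric (hess_christoffel); Gauss
    and Ricci follow by differentiating the orthogonality relations between
    tangential and normal fields (gauss_equation, ricci_equation).  Constancy
    of the sectional curvature determines the whole curvature tensor by
    polarisation (Riem_constant_curvature). *)

(** * Diagonalisation of real symmetric matrices *)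
Section Spectral.
Variable R : rcfType.

Lemma dotrv_ge0 n (v : 'rV[R]_n) : 0 <= (v *m v^T) 0 0.
Proof. by rewrite mxE sumr_ge0 // => i _; rewrite mxE -expr2 sqr_ge0. Qed.

Lemma dotrv_eq0 n (v : 'rV[R]_n) : (v *m v^T) 0 0 = 0 -> v = 0.
Proof.
rewrite mxE => /eqP; rewrite psumr_eq0 => [/allP h|i _]; last first.
  by rewrite mxE -expr2 sqr_ge0.
apply/rowP => i; rewrite mxE; apply/eqP.
by have := h i (mem_index_enum i); rewrite mxE mulf_eq0 orbb.
Qed.

(** A complex eigenvector a + i b for l = p + i q satisfies A a = p a - q b and
    A b = q a + p b; symmetry of A then gives q (|a|^2 + |b|^2) = 0, so that l is
    real and one of a, b is a real eigenvector. *)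
Lemma symmetric_eigenvector n (A : 'M[R]_n.+1) : A^T = A ->
  exists l : R, exists2 v : 'rV[R]_n.+1, v != 0 & v *m A = l *: v.
Proof.
move=> symA; pose A' : 'M[R[i]]_n.+1 := map_mx (real_complex R) A.
have [l /eigenvalueP[w wA w0]] := eigenvalue_closed A' (ltn0Sn n).
pose a := map_mx (@complex.Re R) w; pose b := map_mx (@complex.Im R) w.
have aE : a *m A = complex.Re l *: a - complex.Im l *: b.
  apply/rowP => j; have /rowP/(_ j)/(congr1 (@complex.Re R)) := wA.
  rewrite !mxE raddf_sum /= => e.
  under eq_bigr => i _ do rewrite mxE.
  transitivity (\sum_k complex.Re (w 0 k * A' k j)).
    by apply: eq_bigr => k _; rewrite mxE; case: (w 0 k) => x y; simpc.
  by rewrite e; case: (w 0 j) => x y; case: (l) => p q; simpc.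
have bE : b *m A = complex.Im l *: a + complex.Re l *: b.
  apply/rowP => j; have /rowP/(_ j)/(congr1 (@complex.Im R)) := wA.
  rewrite !mxE raddf_sum /= => e.
  under eq_bigr => i _ do rewrite mxE.
  transitivity (\sum_k complex.Im (w 0 k * A' k j)).
    by apply: eq_bigr => k _; rewrite mxE; case: (w 0 k) => x y; simpc.
  rewrite e; case: (w 0 j) => x y; case: (l) => p q; simpc => /=.
  by rewrite addrC.
have ab : (a *m A *m b^T) 0 0 = (b *m A *m a^T) 0 0.
  have tr1 (X : 'M[R]_1) : X^T 0 0 = X 0 0 by rewrite mxE.
  by rewrite -[LHS]tr1 !trmx_mul trmxK symA mulmxA.
have dC : (b *m a^T) 0 0 = (a *m b^T) 0 0.
  by rewrite !mxE; apply: eq_bigr => i _; rewrite !mxE mulrC.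
have := ab; rewrite aE bE mulmxBl mulmxDl -!scalemxAl.
rewrite [LHS]mxE [RHS]mxE [X in _ + X = _]mxE.
rewrite [X in X - _]mxE [X in _ - X]mxE [X in _ = X + _]mxE [X in _ = _ + X]mxE.
rewrite dC => e.
have a_ge := dotrv_ge0 a; have b_ge := dotrv_ge0 b.
have im0 : complex.Im l = 0.
  have /eqP : complex.Im l * ((a *m a^T) 0 0 + (b *m b^T) 0 0) = 0.
    by rewrite mulrDr; lra.
  rewrite mulf_eq0 => /orP[/eqP//|]; rewrite paddr_eq0// => /andP[/eqP + /eqP].
  move=> /dotrv_eq0 a0 /dotrv_eq0 b0; case/eqP: w0.
  apply/rowP => j; move/rowP/(_ j): a0; move/rowP/(_ j): b0; rewrite !mxE.
  by case: (w 0 j) => x y /= -> ->.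
exists (complex.Re l); have [a0|a0] := eqVneq a 0; last first.
  by exists a => //; rewrite aE im0 scale0r subr0.
exists b; last by rewrite bE im0 scale0r add0r.
apply: contraNneq w0 => b0; apply/eqP.
apply/rowP => j; move/rowP/(_ j): a0; move/rowP/(_ j): b0; rewrite !mxE.
by case: (w 0 j) => x y /= -> ->.
Qed.

(** The Householder reflection that exchanges v and the first basis vector. *)
Lemma orthogonal_with_row n (v : 'rV[R]_n.+1) : (v *m v^T) 0 0 = 1 ->
  exists2 P : 'M[R]_n.+1, P *m P^T = 1%:M & row 0 P = v.
Proof.
move=> v1; pose e : 'rV[R]_n.+1 := delta_mx 0 0; pose u := v - e.
have ee : (e *m e^T) 0 0 = 1.
  by rewrite trmx_delta mul_delta_mx mxE !eqxx.
have ev : (e *m v^T) 0 0 = (v *m e^T) 0 0.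
  by rewrite !mxE; apply: eq_bigr => i _; rewrite !mxE mulrC.
have [u0|u0] := eqVneq u 0.
  exists 1%:M; first by rewrite trmx1 mulmx1.
  by move/eqP: u0; rewrite subr_eq0 => /eqP ->; rewrite rowE mulmx1.
pose c := (u *m u^T) 0 0.
have c0 : c != 0 by apply: contra_neq u0 => /dotrv_eq0.
have cE : c = 2 - 2 * (e *m v^T) 0 0.
  rewrite /c /u linearB/= mulmxBl !mulmxBr.
  by rewrite [LHS]mxE [X in X + _]mxE [X in _ + X]mxE [X in _ + - X]mxE
     [X in _ + X - _]mxE [X in _ - (_ + X)]mxE v1 ee ev; lra.
have uu : u *m u^T = c%:M by apply/matrixP => i j; rewrite !ord1 [RHS]mxE.
pose H : 'M[R]_n.+1 := 1%:M - (2 / c) *: (u^T *m u).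
have HT : H^T = H.
  by rewrite /H linearB/= linearZ/= trmx_mul trmxK trmx1.
exists H; last first.
  rewrite rowE -/e /H mulmxBr mulmx1 -scalemxAr mulmxA.
  have -> : e *m u^T = ((e *m v^T) 0 0 - 1)%:M.
    apply/matrixP => i j; rewrite !ord1 /u linearB/= mulmxBr.
    by rewrite [LHS]mxE [X in _ + X]mxE ee [RHS]mxE eqxx.
  rewrite mul_scalar_mx scalerA -[RHS](subrK e) addrC; congr (_ + _).
  rewrite -scaleNr -/u -[RHS]scale1r; congr (_ *: _).
  have -> : (e *m v^T) 0 0 - 1 = - (c / 2) by rewrite cE; lra.
  by rewrite mulrN opprK; field.
rewrite HT /H mulmxBr mulmx1 mulmxBl mul1mx -scalemxAr -!scalemxAl.
rewrite mulmxA -[u^T *m u *m u^T]mulmxA uu mul_mx_scalar -scalemxAl !scalerA.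
have -> : 2 / c * (2 / c) * c = 2 / c + 2 / c by field.
by rewrite scalerDl opprB addrK subrK.
Qed.

Theorem real_symmetric_diagonalization n (A : 'M[R]_n) : A^T = A ->
  exists P : 'M[R]_n, exists d : 'rV[R]_n,
    P *m P^T = 1%:M /\ P *m A *m P^T = diag_mx d.
Proof.
elim: n A => [|n IHn] A symA.
  by exists 1%:M, 0; split; apply/matrixP; case.
have [l [v v0 vA]] := symmetric_eigenvector symA.
pose s := Num.sqrt ((v *m v^T) 0 0).
have vv0 : 0 < (v *m v^T) 0 0.
  by rewrite lt_def dotrv_ge0 andbT; apply: contra_neq v0 => /dotrv_eq0.
have s0 : s != 0 by rewrite gt_eqF// sqrtr_gt0.
have [|P PP Pv] := @orthogonal_with_row _ (s^-1 *: v).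
  rewrite linearZ/= -scalemxAl -scalemxAr 2!mxE.
  have -> : (v *m v^T) 0 0 = s * s by rewrite -expr2 sqr_sqrtr// ltW.
  by field.
pose B : 'M[R]_(1 + n) := P *m A *m P^T.
have BT : B^T = B by rewrite /B !trmx_mul trmxK symA mulmxA.
have B0 : row 0 B = l *: delta_mx 0 0.
  rewrite /B rowE !mulmxA -rowE Pv -scalemxAl vA !scalerA mulrC -scalerA.
  by rewrite -Pv -scalemxAl rowE -mulmxA PP mulmx1.
have Bur : ursubmx B = 0.
  apply/matrixP => i j; rewrite !ord1; have /rowP/(_ (rshift 1 j)) := B0.
  rewrite !mxE => e; rewrite (_ : lshift n 0 = 0) ?e ?mulr0//.
  exact: val_inj.
have Bul : ulsubmx B = l%:M.
  apply/matrixP => i j; rewrite !ord1; have /rowP/(_ 0) := B0.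
  rewrite [LHS]mxE [RHS]mxE [X in _ * X]mxE eqxx mulr1 => e.
  by rewrite mxE mxE (_ : lshift n 0 = 0) ?e ?mxE//; exact: val_inj.
have Bdl : dlsubmx B = 0 by rewrite -BT -trmx_ursub Bur trmx0.
have [|Q [d [QQ Qd]]] := IHn (drsubmx B); first by rewrite trmx_drsub BT.
pose K : 'M[R]_(1 + n) := block_mx 1%:M 0 0 Q.
have KT : K^T = block_mx 1%:M 0 0 Q^T.
  by rewrite /K (@tr_block_mx _ 1 n 1 n) !trmx0 trmx1.
have KK : K *m K^T = 1%:M.
  rewrite KT /K (@mulmx_block _ 1 n 1 n 1 n) !mulmx0 !mul0mx !mulmx1 QQ.
  by rewrite !addr0 !add0r -scalar_mx_block.
have KBK : K *m B *m K^T = diag_mx (row_mx l%:M d).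
  rewrite -(@submxK _ 1 n 1 n B) Bur Bul Bdl KT /K.
  rewrite !(@mulmx_block _ 1 n 1 n 1 n).
  rewrite !mulmx0 !mul0mx !mulmx1 !mul1mx !addr0 !add0r.
  rewrite !mul0mx Qd diag_mx_row; congr block_mx.
  by apply/matrixP => i j; rewrite !ord1 !mxE.
exists (K *m P : 'M_(1 + n)), (row_mx l%:M d); split.
  by rewrite trmx_mul mulmxA -(mulmxA K P) PP mulmx1 KK.
by rewrite trmx_mul -KBK /B !mulmxA.
Qed.

End Spectral.

(** * Pairs of real numbers at distance greater than one *)
Section Star.
Variables (R : realFieldType) (T : finType) (l : T -> R).
Hypothesis l_le1 : \sum_i l i ^+ 2 <= 1.

(** The edges of a graph on T whose structure controls the estimate below. *)
Definition far i j := 1 < (l i - l j) ^+ 2.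

Lemma far_sym i j : far i j = far j i.
Proof. by rewrite /far -opprB sqrrN. Qed.

Lemma far_neq i j : far i j -> i != j.
Proof. by rewrite /far; case: eqP => [->|//]; rewrite subrr expr0n ltr10. Qed.

Lemma sum_sqr_seq_le1 (s : seq T) : uniq s -> \sum_(i <- s) l i ^+ 2 <= 1.
Proof.
move=> us; apply: le_trans l_le1; rewrite big_uniq//= [leRHS](bigID (mem s))/=.
by rewrite lerDl sumr_ge0 // => i _; rewrite sqr_ge0.
Qed.

(** Two disjoint edges would give sum l_i^2 > 1, as
    (l_a - l_b)^2 <= 2 (l_a^2 + l_b^2). *)
Lemma far_meet a b c d : uniq [:: a; b; c; d] -> far a b -> far c d -> False.
Proof.
move=> /sum_sqr_seq_le1; rewrite !big_cons big_nil /far => h h1 h2.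
have := sqr_ge0 (l a + l b); have := sqr_ge0 (l c + l d); nra.
Qed.

(** The extreme two of the three values would differ by more than 2, while
    the square of their difference is at most 2. *)
Lemma far_no_triangle a b c : far a b -> far b c -> far a c -> False.
Proof.
move=> ab bc ac; have /sum_sqr_seq_le1 : uniq [:: a; b; c].
  by rewrite /= !inE negb_or !far_neq.
move: ab bc ac; rewrite !big_cons big_nil /far => ab bc ac h.
set x := l a in ab ac h *; set y := l b in ab bc h *; set z := l c in bc ac h *.
have sq (u v : R) : 1 < (u - v) ^+ 2 -> (1 < u - v) || (1 < v - u).
  move=> uv; apply/negPn; rewrite negb_or -!leNgt; apply/negP => /andP[h1 h2].
  nra.
have := sqr_ge0 (x + y); have := sqr_ge0 (y + z); have := sqr_ge0 (x + z).
by case/orP: (sq _ _ ab) => h1; case/orP: (sq _ _ bc) => h2;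
  case/orP: (sq _ _ ac) => h3; nra.
Qed.

(** A graph without two disjoint edges and without triangles is a star. *)
Lemma far_star (i0 : T) : exists c, forall i j, far i j -> i = c \/ j = c.
Proof.
have [[i j] /= eij|no] := pickP (fun p : T * T => far p.1 p.2); last first.
  by exists i0 => i j; have /= -> := no (i, j).
have avoid c : (forall i j, far i j -> i = c \/ j = c) \/
    exists k m, [/\ far k m, k != c & m != c].
  have [/forallP h|] := boolP [forall p : T * T,
     far p.1 p.2 ==> (p.1 == c) || (p.2 == c)].
    by left => k m km; have := h (k, m); rewrite /= km /= => /orP[] /eqP; auto.
  rewrite negb_forall => /existsP[[k m]]; rewrite negb_imply negb_or /=.
  by case/and3P; right; exists k, m.
have ij := far_neq eij.
have [h|[k [m [km ki mi]]]] := avoid i; first by exists i.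
have [h|[k' [m' [km' kj mj]]]] := avoid j; first by exists j.
have [x xi jx] : exists2 x, x != i & far j x.
  have [<-|jk] := eqVneq k j; first by exists m.
  have [<-|jm] := eqVneq m j; first by exists k; rewrite // far_sym.
  case: (far_meet _ eij km).
  rewrite /= !inE !negb_or ij (far_neq km) ![i == _]eq_sym ![j == _]eq_sym.
  by rewrite ki mi jk jm.
have [y yj iy] : exists2 y, y != j & far i y.
  have [<-|ik] := eqVneq k' i; first by exists m'.
  have [<-|im] := eqVneq m' i; first by exists k'; rewrite // far_sym.
  case: (far_meet _ eij km').
  rewrite /= !inE !negb_or ij (far_neq km') ![i == _]eq_sym ![j == _]eq_sym.
  by rewrite kj mj ik im.
have [xy|xy] := eqVneq x y; first by case: (far_no_triangle eij jx); rewrite xy.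
case: (far_meet _ jx iy).
rewrite /= !inE !negb_or (far_neq jx) (far_neq iy) xy xi /=.
by rewrite eq_sym ij eq_sym yj.
Qed.

Definition excess i j := Num.max 0 ((l i - l j) ^+ 2 - 1).

Lemma excess_far i j : far i j -> excess i j = (l i - l j) ^+ 2 - 1.
Proof. by rewrite /far /excess => h; rewrite max_r // subr_ge0 ltW. Qed.

Lemma excess_near i j : ~~ far i j -> excess i j = 0.
Proof. by rewrite /far -leNgt /excess => h; rewrite max_l // subr_le0. Qed.

Lemma excess_sym i j : excess i j = excess j i.
Proof. by rewrite /excess -(opprB (l j)) sqrrN. Qed.

Lemma sum_excess_star c : (forall i j, far i j -> i = c \/ j = c) ->
  \sum_i \sum_j excess i j =
  2 * \sum_(j in [set j | far c j]) ((l c - l j) ^+ 2 - 1).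
Proof.
move=> hc; have cc : excess c c = 0.
  by rewrite excess_near// /far subrr expr0n ltr10.
rewrite (bigD1 c)//=.
have -> : \sum_(i | i != c) \sum_j excess i j = \sum_(i | i != c) excess c i.
  apply: eq_bigr => i ic; rewrite (bigD1 c)//= excess_sym big1 ?addr0// => j jc.
  rewrite excess_near//; apply/negP => /hc[] e.
  - by rewrite e eqxx in ic.
  - by rewrite e eqxx in jc.
have -> : \sum_j excess c j = \sum_(j | j != c) excess c j.
  by rewrite [LHS](bigD1 c)//= cc add0r.
rewrite -mulr2n -[LHS]mulr_natl; congr (_ * _).
rewrite (bigID (far c))/= [X in _ + X]big1 ?addr0; last first.
  by move=> j /andP[_ /excess_near].
apply: congr_big => // [j|j /andP[_ /excess_far]//]; rewrite inE.
by apply/andP/idP => [[]//|cj]; split=> //; rewrite eq_sym far_neq.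
Qed.

(** A sum-of-squares certificate: with k = #|J|, the right-hand side is at most
    (k + 1) (a^2 + sum_J b_j^2), and the deficit displays the equality case
    a = - sum_J b_j with all the b_j equal. *)
Lemma star_identity (a : R) (b : T -> R) (J : {set T}) :
  \sum_(j in J) (a - b j) ^+ 2 =
  (#|J|%:R + 1) * (a ^+ 2 + \sum_(j in J) b j ^+ 2)
  - (a + \sum_(j in J) b j) ^+ 2
  - 2^-1 * \sum_(i in J) \sum_(j in J) (b i - b j) ^+ 2.
Proof.
have -> : \sum_(j in J) (a - b j) ^+ 2 = #|J|%:R * a ^+ 2
   - 2 * a * (\sum_(j in J) b j) + \sum_(j in J) b j ^+ 2.
  rewrite mulr_natl -sumr_const mulr_sumr -sumrB -big_split/=.
  by apply: eq_bigr => j _; ring.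
have -> : \sum_(i in J) \sum_(j in J) (b i - b j) ^+ 2 =
    2 * #|J|%:R * (\sum_(j in J) b j ^+ 2) - 2 * (\sum_(j in J) b j) ^+ 2.
  transitivity (\sum_(i in J) (#|J|%:R * b i ^+ 2 -
     2 * (\sum_(j in J) b j) * b i + \sum_(j in J) b j ^+ 2)).
    apply: eq_bigr => i _.
    rewrite mulr_natl -sumr_const [2 * _]mulrC -mulrA mulr_suml -sumrB -big_split/=.
    by apply: eq_bigr => j _; ring.
  rewrite big_split/= sumrB -!mulr_sumr sumr_const -mulr_natl.
  by ring.
by field.
Qed.

Lemma sum_star_le1 c (J : {set T}) : c \notin J ->
  l c ^+ 2 + \sum_(j in J) l j ^+ 2 <= 1.
Proof.
move=> cJ; apply: le_trans l_le1; rewrite -big_setU1//=.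
rewrite [leRHS](bigID (mem (c |: J)))/= lerDl sumr_ge0 // => i _.
exact: sqr_ge0.
Qed.

Lemma sum_excess_le2 : \sum_i \sum_j excess i j <= 2.
Proof.
have [i0 _|T0] := pickP T; last by rewrite big_pred0.
have [c hc] := far_star i0; rewrite (sum_excess_star hc).
set J := [set j | far c j]; rewrite sumrB sumr_const star_identity.
have cJ : c \notin J by rewrite inE; apply/negP => /far_neq; rewrite eqxx.
have h1 := sum_star_le1 cJ; have h2 := sqr_ge0 (l c + \sum_(j in J) l j).
have h3 : 0 <= \sum_(i in J) \sum_(j in J) (l i - l j) ^+ 2.
  by do 2!(apply: sumr_ge0 => ? _); rewrite sqr_ge0.
have : 0 <= (#|J|%:R : R) by []. nra.
Qed.

(** Equality in the previous bound determines l up to relabelling: a centre c,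
    k leaves where l takes the value - l_c / k, and zero elsewhere, with
    (k + 1) l_c^2 = k.  All other differences are then less than 1. *)
Lemma sum_excess_eq2 : \sum_i \sum_j excess i j = 2 ->
  exists c, exists J : {set T},
    [/\ forall i j, 1 <= (l i - l j) ^+ 2 ->
          (i = c /\ j \in J) \/ (j = c /\ i \in J),
        forall j, j \in J -> far c j,
        [/\ c \notin J, (0 < #|J|)%N & (#|J|%:R + 1) * l c ^+ 2 = #|J|%:R],
        forall j, j \in J -> #|J|%:R * l j = - l c &
        forall j, j \notin J -> j != c -> l j = 0].
Proof.
have [i0 _|T0] := pickP T; last by rewrite big_pred0// => h; lra.
have [c hc] := far_star i0; rewrite (sum_excess_star hc).
set J := [set j | far c j]; rewrite sumrB sumr_const star_identity => e.
exists c, J; set k : R := #|J|%:R in e *.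
have cJ : c \notin J by rewrite inE; apply/negP => /far_neq; rewrite eqxx.
have h1 := sum_star_le1 cJ; have h2 := sqr_ge0 (l c + \sum_(j in J) l j).
have h3 : 0 <= \sum_(i in J) \sum_(j in J) (l i - l j) ^+ 2.
  by do 2!(apply: sumr_ge0 => ? _); rewrite sqr_ge0.
have k0 : 0 <= k by [].
have e1 : l c ^+ 2 + \sum_(j in J) l j ^+ 2 = 1 by nra.
have e2 : l c + \sum_(j in J) l j = 0.
  by apply/eqP; rewrite -sqrf_eq0; apply/eqP; nra.
have e3 : \sum_(i in J) \sum_(j in J) (l i - l j) ^+ 2 = 0 by nra.
have J0 : (0 < #|J|)%N.
  rewrite lt0n; apply/eqP => /card0_eq J0.
  move: e; rewrite /k !big_pred0// (eq_card0 J0) => e.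
  move: e1 e2; rewrite !big_pred0// addr0 addr0 => + e2; rewrite e2; lra.
have kgt0 : 0 < k by rewrite ltr0n.
have eqJ i j : i \in J -> j \in J -> l i = l j.
  move=> iJ jJ; move: e3 => /eqP; rewrite psumr_eq0 => [/allP/(_ i)|u _]; last first.
    by apply: sumr_ge0 => ? _; rewrite sqr_ge0.
  rewrite mem_index_enum iJ => /(_ isT) /=.
  rewrite psumr_eq0 => [/allP/(_ j)|u _]; last by rewrite sqr_ge0.
  by rewrite mem_index_enum jJ => /(_ isT) /=; rewrite sqrf_eq0 subr_eq0 => /eqP.
have lJ j : j \in J -> k * l j = - l c.
  move=> jJ; apply/eqP; rewrite -addr_eq0 addrC; apply/eqP; rewrite -[RHS]e2.
  congr (_ + _); rewrite /k mulr_natl -sumr_const.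
  by apply: eq_bigr => i iJ; exact: eqJ.
have l0 j : j \notin J -> j != c -> l j = 0.
  move=> jJ jc; apply/eqP; rewrite -sqrf_eq0 eq_le sqr_ge0 andbT.
  have : c \notin j |: J by rewrite in_setU1 negb_or eq_sym jc.
  by move/sum_star_le1; rewrite big_setU1//=; lra.
have kc : (k + 1) * l c ^+ 2 = k.
  have [j jJ] : exists j, j \in J by exact/card_gt0P.
  have e4 : \sum_(j in J) l j ^+ 2 = k * l j ^+ 2.
    rewrite /k mulr_natl -sumr_const; apply: eq_bigr => i iJ.
    by rewrite (eqJ i j).
  have := lJ j jJ; move: e1; rewrite e4 => e1 e5.
  have : k * (l c ^+ 2 + k * l j ^+ 2) = k by rewrite e1 mulr1.
  have -> : k * (l c ^+ 2 + k * l j ^+ 2) = k * l c ^+ 2 + (k * l j) ^+ 2 by ring.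
  by rewrite e5 sqrrN mulrDl mul1r.
split => // [i j|j]; last by rewrite /J inE.
have c_lt1 : l c ^+ 2 < 1.
  by rewrite -(ltr_pM2l (_ : 0 < k + 1)) ?kc ?mulr1; lra.
have J_lt1 m : m \in J -> l m ^+ 2 < 1.
  move=> mJ; apply: le_lt_trans c_lt1; rewrite -[l c]opprK -(lJ m mJ) sqrrN.
  rewrite exprMn; apply: ler_peMl; first exact: sqr_ge0.
  by rewrite expr_ge1// ler1n.
rewrite leNgt; have [->|ic] := eqVneq i c.
  have [->|jc] := eqVneq j c; first by rewrite subrr expr0n ltr01.
  have [jJ|jJ] := boolP (j \in J); first by left.
  by rewrite (l0 j)// subr0 c_lt1.
have [->|jc] := eqVneq j c.
  have [iJ|iJ] := boolP (i \in J); first by right.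
  by rewrite (l0 i)// sub0r sqrrN c_lt1.
have [iJ|iJ] := boolP (i \in J); have [jJ|jJ] := boolP (j \in J).
- by rewrite (eqJ i j)// subrr expr0n ltr01.
- by rewrite (l0 j)// subr0 J_lt1.
- by rewrite (l0 i)// sub0r sqrrN J_lt1.
- by rewrite (l0 i)// (l0 j)// subrr expr0n ltr01.
Qed.

End Star.

(** * Brackets of symmetric matrices with an orthonormal family *)
Section Frobenius.
Variables (R : rcfType) (n : nat).
Implicit Types A B P : 'M[R]_n.

Definition frob A B : R := \sum_i \sum_j A i j * B i j.
Definition nsq A : R := \sum_i \sum_j A i j ^+ 2.
Definition bracket A B : 'M[R]_n := A *m B - B *m A.

Lemma frob_trace A B : frob A B = \tr (A *m B^T).
Proof.
by apply: eq_bigr => i _; rewrite mxE; apply: eq_bigr => j _; rewrite mxE.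
Qed.

Lemma nsq_frob A : nsq A = frob A A.
Proof. by do 2!(apply: eq_bigr => ? _); rewrite expr2. Qed.

Lemma nsq_ge0 A : 0 <= nsq A.
Proof. by do 2!(apply: sumr_ge0 => ? _); rewrite sqr_ge0. Qed.

Lemma nsq_eq0 A : nsq A = 0 -> A = 0.
Proof.
move=> /eqP; rewrite psumr_eq0 => [/allP h|i _]; last first.
  by apply: sumr_ge0 => ? _; rewrite sqr_ge0.
apply/matrixP => i j; rewrite mxE; move: (h i (mem_index_enum i)) => /=.
rewrite psumr_eq0 => [/allP/(_ j (mem_index_enum j))|k _]; last exact: sqr_ge0.
by rewrite /= sqrf_eq0 => /eqP.
Qed.

Lemma nsqZ k A : nsq (k *: A) = k ^+ 2 * nsq A.
Proof.
rewrite /nsq mulr_sumr; apply: eq_bigr => i _; rewrite mulr_sumr.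
by apply: eq_bigr => j _; rewrite mxE exprMn.
Qed.

Lemma frobC A B : frob A B = frob B A.
Proof. by do 2!(apply: eq_bigr => ? _); rewrite mulrC. Qed.

Lemma frobZr k A B : frob A (k *: B) = k * frob A B.
Proof.
rewrite /frob mulr_sumr; apply: eq_bigr => i _; rewrite mulr_sumr.
by apply: eq_bigr => j _; rewrite mxE mulrCA.
Qed.

Lemma frobZl k A B : frob (k *: A) B = k * frob A B.
Proof. by rewrite frobC frobZr frobC. Qed.

Lemma frob_sumr (I : finType) (L : {set I}) A (F : I -> 'M[R]_n) :
  frob A (\sum_(b in L) F b) = \sum_(b in L) frob A (F b).
Proof.
rewrite /frob [RHS]exchange_big/=; apply: eq_bigr => i _.
rewrite [RHS]exchange_big/=; apply: eq_bigr => j _.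
by rewrite summxE mulr_sumr.
Qed.

Lemma frobBr A B C : frob A (B - C) = frob A B - frob A C.
Proof.
rewrite /frob -sumrB; apply: eq_bigr => i _; rewrite -sumrB.
by apply: eq_bigr => j _; rewrite !mxE mulrBr.
Qed.

Lemma frob_conj P A B : P *m P^T = 1%:M ->
  frob (P *m A *m P^T) (P *m B *m P^T) = frob A B.
Proof.
move=> /mulmx1C PP; rewrite !frob_trace !trmx_mul trmxK !mulmxA.
rewrite -(mulmxA (P *m A)) PP mulmx1 mxtrace_mulC !mulmxA PP mul1mx.
by [].
Qed.

Lemma nsq_conj P A : P *m P^T = 1%:M -> nsq (P *m A *m P^T) = nsq A.
Proof. by move=> PP; rewrite !nsq_frob frob_conj. Qed.

Lemma bracket_conj P A B : P *m P^T = 1%:M ->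
  bracket (P *m A *m P^T) (P *m B *m P^T) = P *m bracket A B *m P^T.
Proof.
move=> /mulmx1C PP; rewrite /bracket mulmxBr mulmxBl !mulmxA.
by rewrite -(mulmxA (P *m A)) -(mulmxA (P *m B)) PP !mulmx1.
Qed.

Lemma nsq_bracket_conj P A B : P *m P^T = 1%:M ->
  nsq (bracket (P *m A *m P^T) (P *m B *m P^T)) = nsq (bracket A B).
Proof. by move=> PP; rewrite bracket_conj// nsq_conj. Qed.

Lemma nsq_bracketC A B : nsq (bracket A B) = nsq (bracket B A).
Proof. by rewrite /bracket -opprB -scaleN1r nsqZ sqrrN expr1n mul1r. Qed.

Lemma nsq_bracketZ k l A B :
  nsq (bracket (k *: A) (l *: B)) = k ^+ 2 * l ^+ 2 * nsq (bracket A B).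
Proof.
rewrite /bracket -!scalemxAl -!scalemxAr !scalerA [l * k]mulrC -scalerBr.
by rewrite nsqZ exprMn.
Qed.

Lemma bracketxx A : bracket A A = 0.
Proof. by rewrite /bracket subrr. Qed.

Lemma nsq0 : nsq 0 = 0.
Proof. by rewrite -(scale0r 0) nsqZ expr0n mul0r. Qed.

Lemma nsq_diag (d : 'rV[R]_n) : nsq (diag_mx d) = \sum_i d 0 i ^+ 2.
Proof.
apply: eq_bigr => i _; rewrite (bigD1 i)//= big1 ?addr0 => [|j ji].
  by rewrite mxE eqxx mulr1n.
by rewrite mxE eq_sym (negbTE ji) mulr0n expr0n.
Qed.

Lemma nsq_bracket_diag (d : 'rV[R]_n) A :
  nsq (bracket (diag_mx d) A) =
  \sum_i \sum_j (d 0 i - d 0 j) ^+ 2 * A i j ^+ 2.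
Proof.
do 2!(apply: eq_bigr => ? _).
by rewrite /bracket mul_diag_mx mul_mx_diag !mxE; ring.
Qed.

(** Members of norm less than 1 are allowed so that the directions of a family
    of orthogonal matrices, some of which may vanish, form such a family. *)
Definition ortho_family (I : finType) (L : {set I}) (Q : I -> 'M[R]_n) :=
  [/\ {in L, forall b, (Q b)^T = Q b},
      {in L, forall b, nsq (Q b) <= 1} &
      {in L &, forall b c, b != c -> frob (Q b) (Q c) = 0}].

Section Family.
Variables (I : finType).
Implicit Types (L : {set I}) (Q : I -> 'M[R]_n).

Lemma ortho_familyS L L' Q : L' \subset L -> ortho_family L Q ->
  ortho_family L' Q.
Proof.
move=> /subsetP sL [s u o]; split=> [b /sL|b /sL|b c /sL bL /sL cL].
- exact: s.
- exact: u.
- exact: o.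
Qed.

Lemma ortho_family_conj L Q P : P *m P^T = 1%:M -> ortho_family L Q ->
  ortho_family L (fun b => P *m Q b *m P^T).
Proof.
move=> PP [s u o]; split=> [b bL|b bL|b c bL cL bc].
- by rewrite !trmx_mul trmxK s// mulmxA.
- by rewrite nsq_conj// u.
- by rewrite frob_conj// o.
Qed.

Lemma bessel L Q A : ortho_family L Q ->
  \sum_(b in L) frob A (Q b) ^+ 2 <= nsq A.
Proof.
move=> [_ u o]; pose t b := frob A (Q b); pose S := \sum_(b in L) t b *: Q b.
have AS : frob A S = \sum_(b in L) t b ^+ 2.
  by rewrite frob_sumr; apply: eq_bigr => b _; rewrite frobZr expr2.
have SS : frob S S <= \sum_(b in L) t b ^+ 2.
  rewrite frob_sumr; apply: ler_sum => b bL; rewrite frobZr frobC frob_sumr.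
  rewrite (bigD1 b)//= big1 ?addr0 => [|c /andP[cL cb]].
    rewrite frobZr -nsq_frob mulrA -expr2 ler_piMr ?sqr_ge0//; exact: u.
  by rewrite frobZr o// ?mulr0// eq_sym.
have := nsq_ge0 (A - S); rewrite nsq_frob frobBr ![frob (A - S) _]frobC !frobBr.
rewrite -nsq_frob [frob S A]frobC -/(t _) AS.
have : \sum_(b in L) frob A (Q b) ^+ 2 = \sum_(b in L) t b ^+ 2 by [].
by move=> ->; lra.
Qed.

(** Bessel's inequality for E_ij + E_ji, whose squared norm is 2 and whose
    pairing with a symmetric matrix is twice its entry (i,j). *)
Lemma sum_entry_sqr_le L Q i j : ortho_family L Q -> i != j ->
  \sum_(b in L) Q b i j ^+ 2 <= 2^-1.
Proof.
move=> oQ ij; pose E : 'M[R]_n := delta_mx i j + delta_mx j i.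
have frobE A : frob E A = A i j + A j i.
  rewrite /frob; under eq_bigr => k _.
    under eq_bigr => h _ do rewrite !mxE mulrDl.
    over.
  under eq_bigr do rewrite big_split/=.
  rewrite big_split/=; congr (_ + _).
    rewrite (bigD1 i)//= (bigD1 j)//= !eqxx mul1r.
    rewrite big1 ?addr0 => [|k kj]; last by rewrite (negbTE kj) mul0r.
    rewrite big1 ?addr0// => k ki; rewrite big1// => h _.
    by rewrite (negbTE ki) mul0r.
  rewrite (bigD1 j)//= (bigD1 i)//= !eqxx mul1r.
  rewrite big1 ?addr0 => [|k kj]; last by rewrite (negbTE kj) mul0r.
  rewrite big1 ?addr0// => k ki; rewrite big1// => h _.
  by rewrite (negbTE ki) mul0r.
have nE : nsq E = 2.
  rewrite nsq_frob frobE !mxE !eqxx (eq_sym j) (negbTE ij) /= mulr0n; lra.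
have [s _ _] := oQ; have := bessel E oQ; rewrite nE.
have -> : \sum_(b in L) frob E (Q b) ^+ 2 = 4 * \sum_(b in L) Q b i j ^+ 2.
  rewrite mulr_sumr; apply: eq_bigr => b bL; rewrite frobE.
  by rewrite -{2}(s b bL) mxE; ring.
lra.
Qed.

(** Here the distinguished matrix is already diagonal, with entries d. *)
Section Defect.
Variables (L : {set I}) (Q : I -> 'M[R]_n) (d : 'rV[R]_n).
Hypothesis oQ : ortho_family L Q.
Hypothesis d_le1 : \sum_i d 0 i ^+ 2 <= 1.

Let s i j := \sum_(b in L) Q b i j ^+ 2.

Lemma bracket_defectE :
  \sum_(b in L) (nsq (bracket (diag_mx d) (Q b)) - nsq (Q b)) =
  \sum_i \sum_j ((d 0 i - d 0 j) ^+ 2 - 1) * s i j.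
Proof.
transitivity (\sum_(b in L) \sum_i \sum_j
   ((d 0 i - d 0 j) ^+ 2 - 1) * Q b i j ^+ 2).
  apply: eq_bigr => b _; rewrite nsq_bracket_diag -sumrB; apply: eq_bigr => i _.
  by rewrite -sumrB; apply: eq_bigr => j _; rewrite mulrBl mul1r.
rewrite exchange_big/=; apply: eq_bigr => i _.
by rewrite exchange_big/=; apply: eq_bigr => j _; rewrite mulr_sumr.
Qed.

Lemma bracket_defect_term i j :
  ((d 0 i - d 0 j) ^+ 2 - 1) * s i j <= 2^-1 * excess (d 0) i j.
Proof.
have s0 : 0 <= s i j by apply: sumr_ge0 => b _; rewrite sqr_ge0.
have [f|nf] := boolP (far (d 0) i j).
  rewrite excess_far// mulrC ler_wpM2r//.
    by rewrite subr_ge0 ltW.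
  by apply: sum_entry_sqr_le; rewrite ?(far_neq f).
rewrite excess_near// mulr0; apply: mulr_le0_ge0 => //.
by rewrite subr_le0 leNgt.
Qed.

Lemma bracket_defect_le1 :
  \sum_(b in L) (nsq (bracket (diag_mx d) (Q b)) - nsq (Q b)) <= 1.
Proof.
rewrite bracket_defectE; apply: (@le_trans _ _ (2^-1 * \sum_i \sum_j excess (d 0) i j)).
  rewrite mulr_sumr; apply: ler_sum => i _; rewrite mulr_sumr.
  by apply: ler_sum => j _; exact: bracket_defect_term.
have := sum_excess_le2 d_le1; lra.
Qed.

Lemma bracket_defect_eq1 :
  \sum_(b in L) (nsq (bracket (diag_mx d) (Q b)) - nsq (Q b)) = 1 ->
  \sum_i \sum_j excess (d 0) i j = 2 /\
  forall i j, ((d 0 i - d 0 j) ^+ 2 - 1) * s i j = 2^-1 * excess (d 0) i j.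
Proof.
rewrite bracket_defectE => e1; have e2 := sum_excess_le2 d_le1.
pose t i j := 2^-1 * excess (d 0) i j - ((d 0 i - d 0 j) ^+ 2 - 1) * s i j.
have t0 i j : 0 <= t i j by rewrite subr_ge0 bracket_defect_term.
have st : \sum_i \sum_j t i j = 2^-1 * (\sum_i \sum_j excess (d 0) i j) - 1.
  rewrite -[X in _ - X]e1 mulr_sumr -sumrB; apply: eq_bigr => i _.
  by rewrite mulr_sumr -sumrB.
have st0 : 0 <= \sum_i \sum_j t i j by do 2!(apply: sumr_ge0 => ? _).
have e3 : \sum_i \sum_j excess (d 0) i j = 2 by lra.
split=> // i j; apply/esym/eqP; rewrite -subr_eq0 -/(t i j).
have /eqP : \sum_i \sum_j t i j = 0 by rewrite st e3; lra.
rewrite psumr_eq0 => [/allP/(_ i (mem_index_enum i))/=|k _]; last exact: sumr_ge0.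
by rewrite psumr_eq0 => // /allP/(_ j (mem_index_enum j)).
Qed.

End Defect.

Lemma ortho_family_diagonalize L Q a : a \in L -> ortho_family L Q ->
  exists P d, [/\ P *m P^T = 1%:M, P *m Q a *m P^T = diag_mx d &
                  \sum_i d 0 i ^+ 2 <= 1].
Proof.
move=> aL [s u _]; have [P [d [PP Pd]]] := real_symmetric_diagonalization (s a aL).
by exists P, d; split=> //; rewrite -nsq_diag -Pd nsq_conj// u.
Qed.

Lemma bracket_split L Q a : a \in L ->
  \sum_(b in L) nsq (bracket (Q a) (Q b)) =
  \sum_(b in L :\ a) (nsq (bracket (Q a) (Q b)) - nsq (Q b))
  + \sum_(b in L :\ a) nsq (Q b).
Proof.
by move=> aL; rewrite sumrB subrK (big_setD1 a)//= bracketxx nsq0 add0r.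
Qed.

Lemma sum_nsq_le L Q a : a \in L -> ortho_family L Q ->
  \sum_(b in L :\ a) nsq (Q b) <= #|L|%:R - 1.
Proof.
move=> aL [_ u _]; rewrite (cardsD1 a) aL natrD [1 + _]addrC addrK -sumr_const.
by apply: ler_sum => b /setD1P[_ bL]; exact: u.
Qed.

(** The key estimate: a contributes nothing, and each of the other members
    contributes its squared norm plus a share of a total excess of at most 1. *)
Theorem sum_nsq_bracket_le L Q a : a \in L -> ortho_family L Q ->
  \sum_(b in L) nsq (bracket (Q a) (Q b)) <= #|L|%:R.
Proof.
move=> aL oQ; have [P [d [PP Pd d1]]] := ortho_family_diagonalize aL oQ.
rewrite bracket_split//.
have h1 := sum_nsq_le aL oQ.
have oQ' := ortho_family_conj PP (ortho_familyS (subD1set L a) oQ).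
have := bracket_defect_le1 oQ' d1; rewrite -Pd.
under eq_bigr do rewrite nsq_bracket_conj// nsq_conj//.
lra.
Qed.

(** Equality in the key estimate forces equality in each inequality used for
    it, once a is diagonalised. *)
Lemma extremal_view L Q a : a \in L -> ortho_family L Q ->
  \sum_(b in L) nsq (bracket (Q a) (Q b)) = #|L|%:R ->
  exists P d, let s i j := \sum_(b in L :\ a) (P *m Q b *m P^T) i j ^+ 2 in
   [/\ P *m P^T = 1%:M, P *m Q a *m P^T = diag_mx d,
       {in L :\ a, forall b, nsq (Q b) = 1},
       \sum_i d 0 i ^+ 2 <= 1 &
       \sum_i \sum_j excess (d 0) i j = 2 /\
       forall i j, ((d 0 i - d 0 j) ^+ 2 - 1) * s i j = 2^-1 * excess (d 0) i j].
Proof.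
move=> aL oQ; have [P [d [PP Pd d1]]] := ortho_family_diagonalize aL oQ.
rewrite bracket_split// => e.
have h1 := sum_nsq_le aL oQ.
have oQ' := ortho_family_conj PP (ortho_familyS (subD1set L a) oQ).
have h2 := bracket_defect_le1 oQ' d1; have := bracket_defect_eq1 oQ' d1.
rewrite -Pd in h2 *; move: h2.
under eq_bigr do rewrite nsq_bracket_conj// nsq_conj//.
move=> h2 h3; exists P, d; split=> //; last by apply: h3; lra.
have e2 : \sum_(b in L :\ a) (1 - nsq (Q b)) = 0.
  have cL : #|L|%:R = 1 + #|L :\ a|%:R :> R by rewrite (cardsD1 a) aL natrD.
  rewrite sumrB sumr_const; lra.
move=> b bL; have [_ u _] := oQ; move/eqP: e2; rewrite psumr_eq0.
  by move=> /allP/(_ b (mem_index_enum b)); rewrite bL /= subr_eq0 => /eqP.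
by move=> c /setD1P[_ cL]; rewrite subr_ge0 u.
Qed.

End Family.
End Frobenius.

(** * Families for which the key estimate is an equality *)
Section Extremal.
Variables (R : rcfType) (n : nat) (I : finType).
Variables (L : {set I}) (Q : I -> 'M[R]_n).
Hypothesis oQ : ortho_family L Q.
Hypothesis extQ :
  {in L, forall a, \sum_(b in L) nsq (bracket (Q a) (Q b)) = #|L|%:R}.

(** What equality for a yields in an orthonormal basis that diagonalises it:
    the eigenvalues are those of the extremal star with centre c and leaves J,
    and the other members of the family have no entries outside the star. *)
Definition star_frame (a : I) (P : 'M[R]_n) (d : 'rV[R]_n) c (J : {set 'I_n}) :=
  let M b := P *m Q b *m P^T in
  [/\ P *m P^T = 1%:M /\ M a = diag_mx d,
      {in L :\ a, forall b i j, M b i j != 0 ->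
         (i = c /\ j \in J) \/ (j = c /\ i \in J)},
      {in J, forall j, far (d 0) c j /\ \sum_(b in L :\ a) M b c j ^+ 2 = 2^-1},
      [/\ c \notin J, (0 < #|J|)%N & (#|J|%:R + 1) * d 0 c ^+ 2 = #|J|%:R] &
      {in J, forall j, #|J|%:R * d 0 j = - d 0 c} /\
      forall j, j \notin J -> j != c -> d 0 j = 0].

Lemma extremal_nsq : {in L &, forall a b, b != a -> nsq (Q b) = 1}.
Proof.
move=> a b aL bL ba; have [P [d []]] := extremal_view aL oQ (extQ aL).
by move=> _ _ h _ _; apply: h; rewrite !inE ba.
Qed.

Lemma extremal_star a : a \in L -> exists P d c J, star_frame a P d c J.
Proof.
move=> aL; have [P [d [PP Pd _ d1 [e2 st]]]] := extremal_view aL oQ (extQ aL).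
have [c [J [hJ fJ cJ kJ lJ]]] := sum_excess_eq2 d1 e2.
exists P, d, c, J; split=> //.
  move=> b bL i j Mij; apply: hJ; rewrite leNgt; apply/negP => lt1.
  have := st i j; rewrite excess_near ?mulr0; last by rewrite -leNgt ltW.
  move=> /eqP; rewrite mulf_eq0 subr_eq0 lt_eqF //=.
  rewrite psumr_eq0 => [/allP/(_ b (mem_index_enum b))|? _]; last exact: sqr_ge0.
  by rewrite bL /= sqrf_eq0 (negbTE Mij).
move=> j jJ; have f := fJ j jJ; split=> //.
have := st c j; rewrite excess_far// mulrC => /mulIf; apply.
by rewrite gt_eqF// subr_gt0.
Qed.

(** In a basis that diagonalises a, the entries of b sit where
    (d_i - d_j)^2 > 1, so that bracketing with a increases the norm of b. *)
Lemma extremal_bracket_gt1 : {in L &, forall a b, b != a ->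
  1 < nsq (bracket (Q a) (Q b))}.
Proof.
move=> a b aL bL ba; have [P [d [c [J [[PP Pd] sup fJ _ _]]]]] := extremal_star aL.
have bLa : b \in L :\ a by rewrite !inE ba.
have nb := extremal_nsq aL bL ba.
rewrite -nb -(nsq_bracket_conj _ _ PP) -(nsq_conj _ PP) Pd nsq_bracket_diag.
set M := P *m Q b *m P^T; rewrite -subr_gt0 lt_def.
have tE : \sum_i \sum_j (d 0 i - d 0 j) ^+ 2 * M i j ^+ 2 - nsq M =
   \sum_i \sum_j ((d 0 i - d 0 j) ^+ 2 - 1) * M i j ^+ 2.
  rewrite -sumrB; apply: eq_bigr => i _; rewrite -sumrB; apply: eq_bigr => j _.
  by rewrite mulrBl mul1r.
have fM i j : M i j != 0 -> far (d 0) i j.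
  by move=> /(sup b bLa)[[-> /fJ[]]|[-> /fJ[]]] //; rewrite far_sym.
have t0 i j : 0 <= ((d 0 i - d 0 j) ^+ 2 - 1) * M i j ^+ 2.
  have [->|/fM f] := eqVneq (M i j) 0; first by rewrite expr0n mulr0.
  by rewrite mulr_ge0 ?sqr_ge0// subr_ge0 ltW.
rewrite tE; apply/andP; split; last by do 2!(apply: sumr_ge0 => ? _).
apply/eqP => /eqP; rewrite psumr_eq0 => [/allP h|? _]; last first.
  by apply: sumr_ge0.
have M0 : M = 0.
  apply/matrixP => i j; rewrite [RHS]mxE; have := h i (mem_index_enum i).
  rewrite /= psumr_eq0// => /allP/(_ j (mem_index_enum j)) /=.
  have [//|/fM f] := eqVneq (M i j) 0.
  rewrite mulf_eq0 sqrf_eq0 => /orP[|/eqP//].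
  by rewrite gt_eqF// subr_gt0.
have : nsq M = 1 by rewrite nsq_conj.
by rewrite M0 nsq0 => /eqP; rewrite eq_sym oner_eq0.
Qed.

End Extremal.

(** With x and y the rows c of X and Y, the bracket is x^T y - y^T x. *)
Lemma nsq_bracket_star (R : rcfType) n (c : 'I_n) (X Y : 'M[R]_n) :
  X^T = X -> Y^T = Y ->
  (forall i j, X i j != 0 -> (i == c) (+) (j == c)) ->
  (forall i j, Y i j != 0 -> (i == c) (+) (j == c)) ->
  nsq (bracket X Y) <= nsq X * nsq Y.
Proof.
move=> sX sY hX hY.
pose x j := X c j; pose y j := Y c j.
have out (Z : 'M[R]_n) (hZ : forall i j, Z i j != 0 -> (i == c) (+) (j == c)) i j :
   ~~ ((i == c) (+) (j == c)) -> Z i j = 0.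
  by move=> h; apply/eqP; apply: contraNT h => /hZ.
have symE (Z : 'M[R]_n) : Z^T = Z -> forall i j, Z i j = Z j i.
  by move=> sZ i j; rewrite -{1}sZ mxE.
have x_c : x c = 0 by rewrite /x out// !eqxx.
have y_c : y c = 0 by rewrite /y out// !eqxx.
have prod (Z W : 'M[R]_n) (hZ : forall i j, Z i j != 0 -> (i == c) (+) (j == c))
   (hW : forall i j, W i j != 0 -> (i == c) (+) (j == c)) i j :
   i != c -> (Z *m W) i j = Z i c * W c j.
  move=> ic; rewrite mxE (bigD1 c)//= big1 ?addr0// => k kc.
  by rewrite (out _ hZ) ?mul0r// (negbTE ic) (negbTE kc).
have XY i j : bracket X Y i j = x i * y j - y i * x j.
  rewrite /bracket [LHS]mxE [X in _ + X]mxE.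
  have [->|ic] := eqVneq i c; last first.
    by rewrite !prod// (symE X sX i) (symE Y sY i).
  rewrite x_c y_c !mul0r subrr !mxE -sumrB.
  have [->|jc] := eqVneq j c.
    by apply: big1 => k _; rewrite (symE X sX k) (symE Y sY k) mulrC subrr.
  apply: big1 => k _; have [->|kc] := eqVneq k c.
    by rewrite -/(x c) -/(y c) x_c y_c !mul0r subrr.
  by rewrite (out Y hY k j) ?(out X hX k j) ?mulr0 ?subrr// (negbTE kc) (negbTE jc).
have nE (Z : 'M[R]_n) (sZ : Z^T = Z)
   (hZ : forall i j, Z i j != 0 -> (i == c) (+) (j == c)) :
   nsq Z = 2 * \sum_j Z c j ^+ 2.
  rewrite /nsq (bigD1 c)//=.
  have -> : \sum_(i | i != c) \sum_j Z i j ^+ 2 = \sum_(i | i != c) Z c i ^+ 2.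
    apply: eq_bigr => i ic; rewrite (bigD1 c)//= (symE Z sZ i) big1 ?addr0//.
    by move=> j jc; rewrite (out Z hZ) ?expr0n// (negbTE ic) (negbTE jc).
  have cc : Z c c = 0 by rewrite (out Z hZ)// eqxx.
  rewrite [X in _ + X = _](_ : _ = \sum_j Z c j ^+ 2); last first.
    by rewrite [RHS](bigD1 c)//= cc expr0n add0r.
  by rewrite mulr_natl mulr2n.
rewrite (nE X)// (nE Y)//.
apply: (@le_trans _ _ (\sum_i \sum_j (2 * (x i ^+ 2 * y j ^+ 2)
   + 2 * (y i ^+ 2 * x j ^+ 2)))).
  apply: ler_sum => i _; apply: ler_sum => j _; rewrite XY.
  by have := sqr_ge0 (x i * y j + y i * x j); lra.
rewrite le_eqVlt; apply/orP; left; apply/eqP.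
under eq_bigr do rewrite big_split/= -!mulr_sumr.
rewrite big_split/= -!mulr_sumr -!mulr_suml -/(x _) -/(y _).
ring.
Qed.

Section ExtremalPair.
Variables (R : rcfType) (n : nat) (I : finType).
Variables (L : {set I}) (Q : I -> 'M[R]_n).
Hypothesis oQ : ortho_family L Q.
Hypothesis extQ :
  {in L, forall a, \sum_(b in L) nsq (bracket (Q a) (Q b)) = #|L|%:R}.
Hypothesis L0 : L != set0.

(** Two members other than a are supported in the star of a, so that their
    bracket has norm at most 1 by nsq_bracket_star; from the point of view of
    one of them it has norm greater than 1. *)
Lemma extremal_card : #|L| = 2%N.
Proof.
have [a aL] := set0Pn _ L0.
have [P [d [c [J [[PP Pd] sup fJ [cJ J0 _] _]]]]] := extremal_star oQ extQ aL.
have [b bL ba] : exists2 b, b \in L & b != a.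
  have [j jJ] : exists j, j \in J by exact/card_gt0P.
  have [_ e] := fJ j jJ.
  have /set0Pn[b /setD1P[ba bL]] : L :\ a != set0.
    by apply: contra_eq_neq e => ->; rewrite big_set0 eq_sym invr_eq0 pnatr_eq0.
  by exists b.
apply/eqP; rewrite (cardsD1 a) aL (cardsD1 b) !inE ba bL /= !add1n !eqSS.
apply/eqP/eqP; rewrite cards_eq0; apply/negPn/negP => /set0Pn[g].
rewrite !inE => /and3P[gb ga gL].
have := extremal_bracket_gt1 oQ extQ bL gL gb; apply/negP; rewrite -leNgt.
have [s _ _] := oQ.
have hM x : x \in L -> x != a ->
    forall i j, (P *m Q x *m P^T) i j != 0 -> (i == c) (+) (j == c).
  move=> xL xa i j; have xLa : x \in L :\ a by rewrite !inE xa.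
  move=> /(sup x xLa)[[-> jJ]|[-> iJ]]; rewrite eqxx.
    by rewrite /=; apply: contraNN cJ => /eqP <-.
  by rewrite addbT; apply: contraNN cJ => /eqP <-.
have sM x : x \in L -> (P *m Q x *m P^T)^T = P *m Q x *m P^T.
  by move=> xL; rewrite !trmx_mul trmxK s// mulmxA.
rewrite -(nsq_bracket_conj _ _ PP).
apply: le_trans (nsq_bracket_star (sM b bL) (sM g gL) (hM b bL ba) (hM g gL ga)) _.
by rewrite !nsq_conj// !(extremal_nsq oQ extQ aL)// mulr1.
Qed.

Lemma extremal_pair a b : L = [set a; b] -> a != b ->
  exists (P : 'M[R]_n) (i j : 'I_n) (s t : R), [/\ P *m P^T = 1%:M, i != j, s ^+ 2 = 2^-1 /\ t ^+ 2 = s ^+ 2,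
    P *m Q a *m P^T = s *: (delta_mx i i - delta_mx j j) &
    P *m Q b *m P^T = t *: (delta_mx i j + delta_mx j i)].
Proof.
move=> LE ab; have aL : a \in L by rewrite LE !inE eqxx.
have bL : b \in L by rewrite LE !inE eqxx orbT.
have ba : b != a by rewrite eq_sym.
have [P [d [c [J [[PP Pd] sup fJ [cJ J0 kc] [lJ l0]]]]]] := extremal_star oQ extQ aL.
have La : L :\ a = [set b].
  apply/setP => x; rewrite LE !inE.
  by have [->|] //= := eqVneq x a; rewrite (negbTE ab).
have bLa : b \in L :\ a by rewrite La inE.
set M := P *m Q b *m P^T.
have sM : M^T = M by have [s _ _] := oQ; rewrite !trmx_mul trmxK s// mulmxA.
have symE i j : M i j = M j i by rewrite -{1}sM mxE.
have MJ j : j \in J -> M c j ^+ 2 = 2^-1.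
  by move=> /fJ[_]; rewrite La big_set1.
have M0 i j : ~ ((i = c /\ j \in J) \/ (j = c /\ i \in J)) -> M i j = 0.
  by move=> h; apply/eqP; apply/negPn/negP => /(sup b bLa).
(* b has squared norm 1, and each leaf contributes 1/2 + 1/2 to it. *)
have J1 : #|J| = 1%N.
  have : nsq M = 1 by rewrite nsq_conj// (extremal_nsq oQ extQ aL).
  rewrite /nsq (bigD1 c)//=.
  have row_c : \sum_j M c j ^+ 2 = #|J|%:R / 2.
    rewrite (bigID (mem J))/= [X in _ + X]big1 ?addr0 => [|j jJ]; last first.
      by rewrite M0 ?expr0n// => -[[_ jJ']|[_ cJ']]; [rewrite jJ' in jJ|rewrite cJ' in cJ].
    by rewrite (eq_bigr (fun=> 2^-1)) ?sumr_const ?mulr_natl// => j /MJ.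
  have -> : \sum_(i | i != c) \sum_j M i j ^+ 2 = \sum_j M c j ^+ 2.
    rewrite [RHS](bigD1 c)//= [M c c]M0 ?expr0n ?add0r; last first.
      by move=> [[_ cJ']|[_ cJ']]; rewrite cJ' in cJ.
    apply: eq_bigr => i ic; rewrite (bigD1 c)//= symE big1 ?addr0// => j jc.
    rewrite M0 ?expr0n// => -[[ic' _]|[jc' _]].
      by rewrite ic' eqxx in ic.
    by rewrite jc' eqxx in jc.
  rewrite row_c => e; apply/eqP; rewrite -(eqr_nat R); apply/eqP; lra.
have [j JE] : exists j, J = [set j] by apply/cards1P; rewrite J1.
have jJ : j \in J by rewrite JE inE.
have cj : c != j by apply: contraNneq cJ => ->.
exists P, c, j, (d 0 c), (M c j); split=> //.
- by rewrite MJ//; move: kc; rewrite J1; split; lra.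
- have dE x : d 0 x = d 0 c * ((x == c)%:R - (x == j)%:R).
    have [->|xc] := eqVneq x c; first by rewrite (negbTE cj) subr0 mulr1.
    have [->|xj] := eqVneq x j; last by rewrite subrr mulr0 l0// JE inE.
    by have := lJ j jJ; rewrite J1 mul1r sub0r mulrN1.
  rewrite Pd; apply/matrixP => x y; rewrite [LHS]mxE [RHS]mxE [in LHS]dE.
  rewrite -(mulrnAr (d 0 c)); congr (_ * _); rewrite !mxE.
  have [<-|xy] := eqVneq x y; first by rewrite mulr1n !andbb.
  rewrite mulr0n; suff neq z : (x == z) && (y == z) = false by rewrite !neq subrr.
  by apply/negP => /andP[/eqP xz /eqP yz]; rewrite xz yz eqxx in xy.
- apply/matrixP => x y; rewrite -/M [RHS]mxE; have [xc|xc] := eqVneq x c.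
    subst x; have [yj|yj] := eqVneq y j.
      by rewrite yj !mxE !eqxx (negbTE cj) addr0 mulr1.
    rewrite M0 ?mxE ?eqxx ?(negbTE yj) ?(negbTE cj) ?andbF ?addr0 ?mulr0//.
    rewrite JE => -[[_]|[_]]; rewrite inE => /eqP e; first by rewrite e eqxx in yj.
    by rewrite e eqxx in cj.
  have [xj|xj] := eqVneq x j; last first.
    rewrite M0 ?mxE ?(negbTE xc) ?(negbTE xj) ?addr0 ?mulr0//.
    rewrite JE => -[[e _]|[_]]; first by rewrite e eqxx in xc.
    by rewrite inE => /eqP e; rewrite e eqxx in xj.
  subst x; have [yc|yc] := eqVneq y c.
    by rewrite yc symE !mxE !eqxx (negbTE xc) add0r mulr1.
  rewrite M0 ?mxE ?(negbTE yc) ?(negbTE xc) ?andbF ?addr0 ?mulr0//.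
  by move=> -[[e _]|[e _]]; [rewrite e eqxx in xc|rewrite e eqxx in yc].
Qed.

End ExtremalPair.

(** * From orthonormal families to arbitrary weights *)
Section Layers.
Variables (R : realFieldType) (I : finType) (c : I -> I -> R).
Hypothesis cC : forall a b, c a b = c b a.
Hypothesis c_le : forall (L : {set I}) a, a \in L ->
  \sum_(b in L) c a b <= #|L|%:R.
Implicit Types (L : {set I}) (x y : I -> R).

Definition qform L x := \sum_(a in L) \sum_(b in L) x a * x b * c a b.

Lemma qform_shift L x t :
  qform L x = t ^+ 2 * (\sum_(a in L) \sum_(b in L) c a b)
    + 2 * t * (\sum_(a in L) (x a - t) * \sum_(b in L) c a b)
    + qform L (fun a => x a - t).
Proof.
have sw : \sum_(a in L) \sum_(b in L) (x b - t) * c a b =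
   \sum_(a in L) (x a - t) * \sum_(b in L) c a b.
  rewrite exchange_big/=; apply: eq_bigr => a _; rewrite mulr_sumr.
  by apply: eq_bigr => b _; rewrite cC.
have -> : 2 * t * (\sum_(a in L) (x a - t) * \sum_(b in L) c a b) =
  t * (\sum_(a in L) (x a - t) * \sum_(b in L) c a b)
  + t * (\sum_(a in L) \sum_(b in L) (x b - t) * c a b) by rewrite sw; ring.
rewrite /qform !mulr_sumr -!big_split/=; apply: eq_bigr => a _.
rewrite !mulr_sumr -!big_split/=; apply: eq_bigr => b _.
ring.
Qed.

Lemma qform_setD1 L x a : a \in L -> x a = 0 -> qform L x = qform (L :\ a) x.
Proof.
move=> aL xa; rewrite /qform (big_setD1 a)//= big1 ?add0r => [|b _]; last first.
  by rewrite xa !mul0r.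
by apply: eq_bigr => d _; rewrite (big_setD1 a)//= xa mulr0 mul0r add0r.
Qed.

Lemma sum_shift L x t :
  \sum_(a in L) x a = t * #|L|%:R + \sum_(a in L) (x a - t).
Proof. by rewrite sumrB sumr_const mulr_natr addrC subrK. Qed.

Lemma double_sum_le L : \sum_(a in L) \sum_(b in L) c a b <= #|L|%:R ^+ 2.
Proof.
rewrite expr2 mulr_natr -sumr_const; apply: ler_sum => a aL; exact: c_le.
Qed.

Lemma weighted_sum_le L y : {in L, forall a, 0 <= y a} ->
  \sum_(a in L) y a * \sum_(b in L) c a b <= #|L|%:R * \sum_(a in L) y a.
Proof.
move=> y0; rewrite mulr_sumr; apply: ler_sum => a aL.
by rewrite mulrC ler_wpM2r ?y0// c_le.
Qed.

Lemma layer_min L x : L != set0 ->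
  exists2 a, a \in L & {in L, forall b, x a <= x b}.
Proof.
move=> /set0Pn[a0 aL]; case: (arg_minP x aL) => a ? h.
by exists a => // b /h.
Qed.

(** Let t be the least weight and x = t + y.  The terms in t^2 and t are
    controlled by the hypothesis on L itself, and y lives on a smaller set. *)
Theorem qform_le L x : {in L, forall a, 0 <= x a} ->
  qform L x <= (\sum_(a in L) x a) ^+ 2.
Proof.
have [k] := ubnP #|L|; elim: k L x => // k IHk L x Lk x0.
have [->|Ln] := eqVneq L set0; first by rewrite /qform !big_set0 expr0n.
have [a aL xa] := layer_min x Ln; pose y b := x b - x a.
have y0 : {in L, forall b, 0 <= y b} by move=> b bL; rewrite subr_ge0 xa.
have ya : y a = 0 by rewrite /y subrr.
have qy : qform L y <= (\sum_(b in L) y b) ^+ 2.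
  rewrite (qform_setD1 aL ya) (big_setD1 a)//= ya add0r; apply: IHk.
    by move: Lk; rewrite (cardsD1 a) aL.
  by move=> b /setD1P[_ /y0].
rewrite (qform_shift L x (x a)) (sum_shift L x (x a)) -/y.
have h1 := double_sum_le L; have h2 := weighted_sum_le y0; have t0 := x0 a aL.
have h3 := ler_wpM2l (sqr_ge0 (x a)) h1; have h4 := ler_wpM2l t0 h2.
by rewrite -/(y _) in h4 *; lra.
Qed.

(** The weights being positive on L, so is t: the term in t^2 of the preceding
    decomposition must be an equality. *)
Theorem qform_eq L x : L != set0 -> {in L, forall a, 0 < x a} ->
  qform L x = (\sum_(a in L) x a) ^+ 2 ->
  {in L, forall a, \sum_(b in L) c a b = #|L|%:R}.
Proof.
move=> Ln x0; have [a aL xa] := layer_min x Ln; pose y b := x b - x a.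
have y0 : {in L, forall b, 0 <= y b} by move=> b bL; rewrite subr_ge0 xa.
have qy := qform_le y0.
rewrite (qform_shift L x (x a)) (sum_shift L x (x a)) -/y.
have h1 := double_sum_le L; have h2 := weighted_sum_le y0; have t0 := x0 a aL.
have h4 := ler_wpM2l (ltW t0) h2.
rewrite -/(y _) in h4 * => e.
have t2 : 0 < x a ^+ 2 by rewrite exprn_gt0.
have h3 := ler_wpM2l (ltW t2) h1.
have h5 : x a ^+ 2 * (\sum_(a in L) \sum_(b in L) c a b) =
   x a ^+ 2 * #|L|%:R ^+ 2 by lra.
have h6 := mulfI (lt0r_neq0 t2) h5.
have : \sum_(a in L) (#|L|%:R - \sum_(b in L) c a b) = 0.
  by rewrite sumrB h6 sumr_const -[_ *+ _]mulr_natr expr2 subrr.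
move=> /eqP; rewrite psumr_eq0 => [/allP h b bL|b bL]; last first.
  by rewrite subr_ge0 c_le.
have := h b (mem_index_enum b); rewrite bL /= subr_eq0 => /eqP <-.
by [].
Qed.

End Layers.

Lemma sum_setT (V : nmodType) (I : finType) (F : I -> V) :
  \sum_(i in [set: I]) F i = \sum_i F i.
Proof. by apply: eq_bigl => i; rewrite inE. Qed.

Lemma perm_pair (T : finType) (x0 y0 x y : T) : x0 != y0 -> x != y ->
  exists2 s : {perm T}, s x0 = x & s y0 = y.
Proof.
move=> xy0 xy; (* The first factor sends x0 to x, which the second one leaves fixed. *)
exists (tperm x0 x * tperm (tperm x0 x y0) y)%g.
  rewrite permM tpermL tpermD//; last by rewrite eq_sym.
  by rewrite -{2}(tpermL x0 x) (inj_eq perm_inj) eq_sym.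
by rewrite permM tpermL.
Qed.

Lemma perm_mx_orthogonal (R : comPzRingType) n (s : 'S_n) :
  perm_mx s *m (perm_mx s)^T = 1%:M :> 'M[R]_n.
Proof. by rewrite tr_perm_mx -perm_mxM mulgV perm_mx1. Qed.

Lemma conj_perm_mx (R : comPzRingType) n (s : 'S_n) (A : 'M[R]_n) i j :
  (perm_mx s *m A *m (perm_mx s)^T) i j = A (s i) (s j).
Proof.
rewrite -row_permE; set M := row_perm s A.
have -> : M *m (perm_mx s)^T = (perm_mx s *m M^T)^T by rewrite trmx_mul trmxK.
by rewrite -row_permE !mxE.
Qed.

(** * The inequality for commutators of symmetric matrices *)
Section DDVV.
Variables (R : rcfType) (n m : nat).
Implicit Types (B : 'I_m -> 'M[R]_n) (Q : 'M[R]_m).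

Definition mix Q B r := \sum_s Q r s *: B s.

Definition energy B := \sum_r nsq (B r).
Definition brackets B := \sum_r \sum_s nsq (bracket (B r) (B s)).

Lemma mixE Q B r i j : mix Q B r i j = \sum_s Q r s * B s i j.
Proof. by rewrite summxE; apply: eq_bigr => s _; rewrite mxE. Qed.

Lemma mix_sym Q B : (forall r, (B r)^T = B r) -> forall r, (mix Q B r)^T = mix Q B r.
Proof.
move=> sB r; apply/matrixP => i j; rewrite mxE !mixE; apply: eq_bigr => s _.
by rewrite -{1}sB mxE.
Qed.

Lemma frob_mix Q B r s : frob (mix Q B r) (mix Q B s) =
  (Q *m (\matrix_(a, b) frob (B a) (B b)) *m Q^T) r s.
Proof.
rewrite !mxE /frob.
under [RHS]eq_bigr => b _ do rewrite mxE mulr_suml.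
rewrite [RHS]exchange_big/=.
under [RHS]eq_bigr => a _.
  under eq_bigr => b _.
    rewrite !mxE mulr_sumr mulr_suml.
    under eq_bigr => i _ do rewrite mulr_sumr mulr_suml.
    over.
  rewrite exchange_big/=.
  under eq_bigr => i _ do rewrite exchange_big/=.
  over.
rewrite [RHS]exchange_big/=; apply: eq_bigr => i _.
rewrite [RHS]exchange_big/=; apply: eq_bigr => j _.
rewrite !mixE mulr_suml; apply: eq_bigr => a _.
by rewrite mulr_sumr; apply: eq_bigr => b _; ring.
Qed.

Lemma energy_mix Q B : Q *m Q^T = 1%:M -> energy (mix Q B) = energy B.
Proof.
move=> QQ; pose K := \matrix_(a, b) frob (B a) (B b).
transitivity (\tr (Q *m K *m Q^T)).
  by apply: eq_bigr => r _; rewrite nsq_frob frob_mix.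
rewrite mxtrace_mulC mulmxA (mulmx1C QQ) mul1mx.
by apply: eq_bigr => r _; rewrite mxE nsq_frob.
Qed.

Lemma brackets_mix Q B : Q *m Q^T = 1%:M -> brackets (mix Q B) = brackets B.
Proof.
move=> QQ; pose K i j : 'M[R]_m := \matrix_(r, s) bracket (B r) (B s) i j.
have bE (C : 'I_m -> 'M[R]_n) : brackets C =
    \sum_i \sum_j nsq (\matrix_(r, s) bracket (C r) (C s) i j).
  rewrite /brackets /nsq.
  under eq_bigr => r _ do rewrite exchange_big/=.
  rewrite exchange_big/=; apply: eq_bigr => i _.
  under eq_bigr => r _ do rewrite exchange_big/=.
  rewrite exchange_big/=; apply: eq_bigr => j _.
  by do 2!(apply: eq_bigr => ? _); rewrite mxE.
rewrite !bE; apply: eq_bigr => i _; apply: eq_bigr => j _.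
rewrite -[RHS](nsq_conj _ QQ); congr nsq; apply/matrixP => r s.
rewrite [LHS]mxE /bracket [LHS]mxE [X in _ + X]mxE [RHS]mxE.
have -> : (mix Q B r *m mix Q B s) i j =
   \sum_a \sum_b Q r a * Q s b * (B a *m B b) i j.
  rewrite mulmx_suml summxE; apply: eq_bigr => a _.
  rewrite mulmx_sumr summxE; apply: eq_bigr => b _.
  by rewrite -scalemxAl -scalemxAr scalerA mxE.
have -> : (mix Q B s *m mix Q B r) i j =
   \sum_a \sum_b Q r a * Q s b * (B b *m B a) i j.
  rewrite mulmx_suml summxE exchange_big/=; apply: eq_bigr => a _.
  rewrite mulmx_sumr summxE; apply: eq_bigr => b _.
  by rewrite -scalemxAl -scalemxAr scalerA mxE [Q s _ * _]mulrC.
under [RHS]eq_bigr => b _ do rewrite mxE mulr_suml.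
rewrite [RHS]exchange_big/= -sumrB; apply: eq_bigr => a _.
rewrite -sumrB; apply: eq_bigr => b _.
rewrite [(\matrix_(_, _) _) _ _]mxE [Q^T _ _]mxE.
have -> : (B a *m B b - B b *m B a) i j = (B a *m B b) i j - (B b *m B a) i j.
  by rewrite [LHS]mxE [X in _ + X]mxE.
ring.
Qed.

Lemma energy_conj P B : P *m P^T = 1%:M ->
  energy (fun r => P *m B r *m P^T) = energy B.
Proof. by move=> PP; apply: eq_bigr => r _; rewrite nsq_conj. Qed.

Lemma brackets_conj P B : P *m P^T = 1%:M ->
  brackets (fun r => P *m B r *m P^T) = brackets B.
Proof. by move=> PP; do 2!(apply: eq_bigr => ? _); rewrite nsq_bracket_conj. Qed.

(** Diagonalise the Gram matrix of the family. *)
Lemma exists_orthogonal_mix B : exists2 Q, Q *m Q^T = 1%:M &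
  forall r s, r != s -> frob (mix Q B r) (mix Q B s) = 0.
Proof.
have [|Q [d [QQ Qd]]] :=
    @real_symmetric_diagonalization R m (\matrix_(a, b) frob (B a) (B b)).
  by apply/matrixP => a b; rewrite !mxE frobC.
by exists Q => // r s rs; rewrite frob_mix Qd mxE (negbTE rs).
Qed.

(** A family of mutually orthogonal matrices, split into lengths and
    directions; the direction of a zero matrix is zero. *)
Section Normalized.
Variable C : 'I_m -> 'M[R]_n.
Hypothesis sC : forall r, (C r)^T = C r.
Hypothesis oC : forall r s, r != s -> frob (C r) (C s) = 0.

Let len r := Num.sqrt (nsq (C r)).
Let dir r := (len r)^-1 *: C r.
Let w r s := nsq (bracket (dir r) (dir s)).

Let len_sqr r : len r ^+ 2 = nsq (C r).
Proof. by rewrite sqr_sqrtr// nsq_ge0. Qed.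

Let len_dir r : C r = len r *: dir r.
Proof.
rewrite scalerA; have [l0|l0] := eqVneq (len r) 0; last by rewrite divff// scale1r.
by rewrite l0 mul0r scale0r; apply: nsq_eq0; rewrite -len_sqr l0 expr0n.
Qed.

Let dir_ortho L : ortho_family L dir.
Proof.
split=> [r _|r _|r s _ _ rs]; first by rewrite linearZ/= sC.
  rewrite nsqZ -len_sqr -exprMn; have [->|l0] := eqVneq (len r) 0.
    by rewrite mulr0 expr0n.
  by rewrite mulVf// expr1n.
by rewrite frobZl frobZr oC// !mulr0.
Qed.

Let brackets_qform : brackets C = qform w setT (fun r => nsq (C r)).
Proof.
rewrite /qform sum_setT; apply: eq_bigr => r _; rewrite sum_setT.
by apply: eq_bigr => s _; rewrite {1}(len_dir r) {1}(len_dir s) nsq_bracketZ !len_sqr.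
Qed.

Let w_le (L : {set 'I_m}) a : a \in L -> \sum_(b in L) w a b <= #|L|%:R.
Proof. by move=> aL; exact: sum_nsq_bracket_le. Qed.

Let wC a b : w a b = w b a. Proof. exact: nsq_bracketC. Qed.

Lemma brackets_le_orthogonal : brackets C <= energy C ^+ 2.
Proof.
rewrite brackets_qform (le_trans (qform_le wC w_le _))//.
  by move=> a _; exact: nsq_ge0.
by rewrite sum_setT.
Qed.

Lemma brackets_eq_orthogonal : energy C != 0 -> brackets C = energy C ^+ 2 ->
  exists (P : 'M[R]_n) (a b : 'I_m) (i j : 'I_n) (mu : R),
   [/\ P *m P^T = 1%:M, a != b /\ i != j,
       P *m C a *m P^T = mu *: (delta_mx i i - delta_mx j j),
       P *m C b *m P^T = mu *: (delta_mx i j + delta_mx j i) &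
       forall r, r != a -> r != b -> C r = 0].
Proof.
move=> E0; rewrite brackets_qform => e.
pose L := [set r | nsq (C r) != 0].
have notL r : r \notin L -> nsq (C r) = 0 by rewrite inE negbK => /eqP.
have sumL (F : 'I_m -> R) : (forall r, nsq (C r) = 0 -> F r = 0) ->
    \sum_r F r = \sum_(r in L) F r.
  move=> F0; rewrite (bigID (mem L))/= [X in _ + X]big1 ?addr0//.
  by move=> r /notL; exact: F0.
have EL : energy C = \sum_(r in L) nsq (C r) by exact: sumL.
have qL : qform w L (fun r => nsq (C r)) = (\sum_(r in L) nsq (C r)) ^+ 2.
  rewrite -EL -e /qform sum_setT sumL.
    apply: eq_bigr => r _; rewrite sum_setT sumL// => s ->.
    by rewrite mulr0 mul0r.
  by move=> r ->; rewrite big1// => s _; rewrite !mul0r.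
have L0 : L != set0.
  by apply: contra_neq E0 => L0; rewrite EL L0 big_set0.
have posL r : r \in L -> 0 < nsq (C r).
  by rewrite inE => h; rewrite lt_def h nsq_ge0.
have ext := qform_eq wC w_le L0 posL qL.
have L2 := extremal_card (dir_ortho L) ext L0.
have /cards2P[a [b [ab LE]]] : #|L| == 2%N by rewrite L2.
have [P [i [j [s [t [PP ij [s2 ts] Pa Pb]]]]]] :=
  extremal_pair (dir_ortho L) ext LE ab.
have aL : a \in L by rewrite LE !inE eqxx.
have bL : b \in L by rewrite LE !inE eqxx orbT.
have wab : w a b = 2.
  have := ext a aL; rewrite L2 LE big_setU1 ?inE//= big_set1 => <-.
  by rewrite {2}/w bracketxx nsq0 add0r.
have lab : len a = len b.
  have xab : nsq (C a) = nsq (C b).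
    move: qL; rewrite /qform LE !big_setU1 ?inE//= !big_set1.
    rewrite !big_setU1 ?inE//= !big_set1 (wC b a) wab.
    rewrite {1 2}/w !bracketxx !nsq0 !mulr0 addr0 add0r => h.
    apply/eqP; rewrite -subr_eq0 -sqrf_eq0; apply/eqP; lra.
  by rewrite /len xab.
have rest r : r != a -> r != b -> C r = 0.
  move=> ra rb; apply: nsq_eq0; apply: notL.
  by rewrite LE !inE negb_or ra.
have conjC r : P *m C r *m P^T = len r *: (P *m dir r *m P^T).
  by rewrite {1}(len_dir r) -scalemxAr -scalemxAl.
(* If t = - s, exchanging i and j restores a common factor mu. *)
have /eqP := ts; rewrite eqf_sqr => /orP[/eqP tE|/eqP tE].
  exists P, a, b, i, j, (len b * s); split=> //.
    by rewrite conjC Pa scalerA lab.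
  by rewrite conjC Pb scalerA tE.
exists P, a, b, j, i, (len b * t); split=> //.
- by rewrite [j == i]eq_sym.
- by rewrite conjC Pa scalerA lab tE mulrN scaleNr -scalerN opprB.
- by rewrite conjC Pb scalerA addrC.
Qed.

End Normalized.

Theorem ddvv_inequality B : (forall r, (B r)^T = B r) ->
  brackets B <= energy B ^+ 2.
Proof.
move=> sB; have [Q QQ oQ] := exists_orthogonal_mix B.
rewrite -(energy_mix _ QQ) -(brackets_mix _ QQ).
exact: brackets_le_orthogonal (mix_sym _ sB) oQ.
Qed.

Theorem ddvv_equality B (a0 b0 : 'I_m) (i0 j0 : 'I_n) :
  a0 != b0 -> i0 != j0 -> (forall r, (B r)^T = B r) ->
  brackets B = energy B ^+ 2 ->
  exists (P : 'M[R]_n) (Q : 'M[R]_m) (mu : R),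
   [/\ P *m P^T = 1%:M, Q *m Q^T = 1%:M,
       P *m mix Q B a0 *m P^T = mu *: (delta_mx i0 i0 - delta_mx j0 j0),
       P *m mix Q B b0 *m P^T = mu *: (delta_mx i0 j0 + delta_mx j0 i0) &
       forall r, r != a0 -> r != b0 -> P *m mix Q B r *m P^T = 0].
Proof.
move=> ab0 ij0 sB; have [Q QQ oQ] := exists_orthogonal_mix B.
rewrite -(energy_mix _ QQ) -(brackets_mix _ QQ) => e.
have [E0|E0] := eqVneq (energy (mix Q B)) 0.
  have B0 r : mix Q B r = 0.
    apply: nsq_eq0; move/eqP: E0; rewrite psumr_eq0 => [/allP|? _].
      by move=> /(_ r (mem_index_enum r)) /eqP.
    exact: nsq_ge0.
  exists 1%:M, Q, 0; split; rewrite ?trmx1 ?mulmx1 ?B0 ?mulmx0 ?scale0r// => r _ _.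
  by rewrite B0 mulmx0 mul0mx.
have [P [a [b [i [j [mu [PP [ab ij] Pa Pb rest]]]]]]] :=
  brackets_eq_orthogonal (mix_sym _ sB) oQ E0 e.
have [s sa sb] := perm_pair ab0 ab; have [t ti tj] := perm_pair ij0 ij.
have mix_perm r : mix (perm_mx s *m Q) B r = mix Q B (s r).
  by apply: eq_bigr => u _; rewrite -row_permE mxE.
have conj_perm r : perm_mx t *m P *m mix (perm_mx s *m Q) B r *m (perm_mx t *m P)^T
    = perm_mx t *m (P *m mix Q B (s r) *m P^T) *m (perm_mx t)^T.
  by rewrite mix_perm trmx_mul !mulmxA.
have orth k (U V : 'M[R]_k) : U *m U^T = 1%:M -> V *m V^T = 1%:M ->
    U *m V *m (U *m V)^T = 1%:M.
  by move=> UU VV; rewrite trmx_mul mulmxA -(mulmxA U) VV mulmx1.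
exists (perm_mx t *m P), (perm_mx s *m Q), mu; split.
- by apply: orth => //; exact: perm_mx_orthogonal.
- by apply: orth => //; exact: perm_mx_orthogonal.
- apply/matrixP => x y; rewrite conj_perm conj_perm_mx sa Pa -ti -tj.
  by rewrite !mxE !(inj_eq perm_inj).
- apply/matrixP => x y; rewrite conj_perm conj_perm_mx sb Pb -ti -tj.
  by rewrite !mxE !(inj_eq perm_inj).
- move=> r ra rb; have sra : s r != a by rewrite -sa (inj_eq perm_inj).
  have srb : s r != b by rewrite -sb (inj_eq perm_inj).
  by rewrite conj_perm (rest _ sra srb) mulmx0 mul0mx mulmx0 mul0mx.
Qed.

End DDVV.

(** * The defect of the curvature inequality in terms of matrices *)
Lemma sum_upper_triangle (R : comPzRingType) n (f : 'I_n -> 'I_n -> R) :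
  (forall i j, f i j = f j i) ->
  \sum_i \sum_j f i j =
  2 * (\sum_(i < n) \sum_(j < n | (i < j)%N) f i j) + \sum_i f i i.
Proof.
move=> fC; have -> : \sum_i \sum_j f i j = \sum_(i < n) \sum_(j < n | (i < j)%N) f i j
   + \sum_(i < n) \sum_(j < n | (j < i)%N) f i j + \sum_i f i i.
  rewrite -!big_split/=; apply: eq_bigr => i _.
  rewrite (bigID (fun j : 'I_n => (i < j)%N))/= -addrA; congr (_ + _).
  rewrite (bigD1 i)/= ?ltnn// addrC; congr (_ + _).
  by apply: eq_bigl => j; rewrite -leqNgt ltn_neqAle andbC.
have -> : \sum_(i < n) \sum_(j < n | (j < i)%N) f i j =
    \sum_(i < n) \sum_(j < n | (i < j)%N) f i j.
  rewrite (exchange_big_dep xpredT)//=; apply: eq_bigr => i _.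
  by apply: eq_bigr => j _.
by rewrite mulr_natl mulr2n.
Qed.

Section TraceFree.
Variables (R : rcfType) (n m : nat).
Hypothesis n_ge2 : (2 <= n)%N.
Implicit Types (A : 'M[R]_n) (B : 'I_m -> 'M[R]_n).

Let n_neq0 : n%:R != 0 :> R. Proof. by rewrite pnatr_eq0 -lt0n ltnW. Qed.
Let n1_neq0 : n%:R - 1 != 0 :> R.
Proof. by rewrite subr_eq0 (eqr_nat R n 1) gtn_eqF. Qed.

Definition tracefree A := A - (\tr A / n%:R)%:M.

Lemma nsq_tracefree A : nsq (tracefree A) = nsq A - (\tr A) ^+ 2 / n%:R.
Proof.
have trE : \sum_i \sum_j A i j * (i == j)%:R = \tr A.
  apply: eq_bigr => i _; rewrite (bigD1 i)//= eqxx mulr1 big1 ?addr0// => j ji.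
  by rewrite eq_sym (negbTE ji) mulr0.
have oneE : \sum_(i < n) \sum_(j < n) (i == j)%:R = n%:R :> R.
  rewrite -[in RHS](card_ord n) -sumr_const; apply: eq_bigr => i _.
  rewrite (bigD1 i)//= eqxx big1 ?addr0// => j ji.
  by rewrite eq_sym (negbTE ji).
set t := \tr A / n%:R.
have -> : nsq (tracefree A) = nsq A - 2 * t * (\sum_i \sum_j A i j * (i == j)%:R)
    + t ^+ 2 * \sum_(i < n) \sum_(j < n) (i == j)%:R.
  rewrite /nsq !mulr_sumr -sumrB -big_split/=; apply: eq_bigr => i _.
  rewrite !mulr_sumr -sumrB -big_split/=; apply: eq_bigr => j _.
  by rewrite !mxE -/t; case: (i == j); rewrite ?mulr1n ?mulr0n; ring.
by rewrite trE oneE /t; field.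
Qed.

Lemma bracket_tracefree A C : bracket (tracefree A) (tracefree C) = bracket A C.
Proof.
rewrite /tracefree /bracket; set a := _ / _; set b := \tr C / _.
rewrite !mulmxBl !mulmxBr !mul_scalar_mx !mul_mx_scalar scale_scalar_mx.
rewrite scale_scalar_mx [b * a]mulrC; set AC := A *m C; set CA := C *m A.
by apply/matrixP => i j; clearbody AC CA; rewrite !mxE; ring.
Qed.

Lemma brackets_tracefree B : brackets (fun r => tracefree (B r)) = brackets B.
Proof. by do 2!(apply: eq_bigr => ? _); rewrite bracket_tracefree. Qed.

Lemma tracefree_sym B : (forall r, (B r)^T = B r) ->
  forall r, (tracefree (B r))^T = tracefree (B r).
Proof. by move=> sB r; rewrite /tracefree linearB/= sB tr_scalar_mx. Qed.

Lemma mix_tracefree (Q : 'M[R]_m) B r :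
  mix Q (fun r => tracefree (B r)) r = tracefree (mix Q B r).
Proof.
rewrite /mix /tracefree raddf_sum/= mulr_suml raddf_sum/= -sumrB.
by apply: eq_bigr => s _; rewrite scalerBr scale_scalar_mx mxtraceZ mulrA.
Qed.

Lemma tracefree_conj (P : 'M[R]_n) A : P *m P^T = 1%:M ->
  tracefree (P *m A *m P^T) = P *m tracefree A *m P^T.
Proof.
move=> PP; rewrite /tracefree mxtrace_mulC mulmxA (mulmx1C PP) mul1mx.
rewrite mulmxBr mulmxBl; congr (_ - _).
by rewrite mul_mx_scalar -scalemxAl PP scalemx1.
Qed.

Lemma brackets_upper B : (forall r, (B r)^T = B r) ->
   \sum_(i < n) \sum_(j < n | (i < j)%N)
    \sum_(r < m) \sum_(s < m | (r < s)%N) bracket (B s) (B r) i j ^+ 2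
   = brackets B / 4.
Proof.
move=> sB; have bT r s i j : bracket (B s) (B r) j i = - bracket (B s) (B r) i j.
  have : (bracket (B s) (B r))^T = - bracket (B s) (B r).
    by rewrite /bracket linearB/= !trmx_mul !sB opprB.
  by move=> /matrixP/(_ i j); rewrite [LHS]mxE [RHS]mxE.
have b0 s i j : bracket (B s) (B s) i j = 0 by rewrite bracketxx mxE.
have bC r s i j : bracket (B s) (B r) i j = - bracket (B r) (B s) i j.
  by rewrite /bracket -opprB [LHS]mxE.
pose f i j := \sum_(r < m) \sum_(s < m) bracket (B s) (B r) i j ^+ 2.
have fE i j : \sum_(r < m) \sum_(s < m | (r < s)%N) bracket (B s) (B r) i j ^+ 2
    = f i j / 2.
  rewrite /f (sum_upper_triangle (f := fun r s => bracket (B s) (B r) i j ^+ 2)).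
    by rewrite [X in _ + X]big1 => [|s _]; rewrite ?b0 ?expr0n// addr0; field.
  by move=> r s; rewrite bC sqrrN.
under eq_bigr do under eq_bigr do rewrite fE.
have -> : brackets B = \sum_i \sum_j f i j.
  rewrite /brackets exchange_big/= /nsq /f.
  under eq_bigr => r _ do rewrite exchange_big/=.
  rewrite exchange_big/=; apply: eq_bigr => i _.
  under eq_bigr => r _ do rewrite exchange_big/=.
  by rewrite exchange_big/=.
rewrite (sum_upper_triangle (f := f)); last first.
  by move=> i j; do 2!(apply: eq_bigr => ? _); rewrite bT sqrrN.
rewrite [X in _ + X]big1 => [|i _]; last first.
  apply: big1 => r _; apply: big1 => s _.
  by have := bT r s i i => /eqP; rewrite -addr_eq0 -mulr2n mulrn_eq0 /= => /eqP ->; rewrite expr0n.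
under eq_bigr do rewrite -mulr_suml.
by rewrite -mulr_suml addr0; field.
Qed.

Lemma scalar_upper B : (forall r, (B r)^T = B r) ->
   \sum_(i < n) \sum_(j < n | (i < j)%N)
     \sum_r (B r j j * B r i i - B r i j * B r j i) =
   2^-1 * \sum_r ((\tr (B r)) ^+ 2 - nsq (B r)).
Proof.
move=> sB.
have H (A : 'M[R]_n) : A^T = A ->
    \sum_(i < n) \sum_(j < n | (i < j)%N) (A j j * A i i - A i j * A j i)
    = 2^-1 * ((\tr A) ^+ 2 - nsq A).
  move=> sA; have sE i j : A j i = A i j by rewrite -{1}sA mxE.
  have := sum_upper_triangle (f := fun i j => A j j * A i i - A i j * A j i).
  move=> /(_ _) e; have {}e := e (fun i j => f_equal2 (fun a b => a - b)
    (mulrC _ _) (mulrC _ _)).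
  have e2 : \sum_(i < n) \sum_(j < n) (A j j * A i i - A i j * A j i)
      = (\tr A) ^+ 2 - nsq A.
    rewrite /nsq expr2 /mxtrace mulr_suml -sumrB; apply: eq_bigr => i _.
    rewrite mulr_sumr -sumrB; apply: eq_bigr => j _; rewrite (sE i j); ring.
  have d0 : \sum_(i < n) (A i i * A i i - A i i * A i i) = 0.
    by rewrite big1// => i _; rewrite subrr.
  by move: e; rewrite e2 d0 addr0 => ->; field.
transitivity (\sum_r \sum_(i < n) \sum_(j < n | (i < j)%N)
     (B r j j * B r i i - B r i j * B r j i)).
  rewrite [RHS]exchange_big/=; apply: eq_bigr => i _.
  by rewrite [RHS]exchange_big/=.
by rewrite mulr_sumr; apply: eq_bigr => r _; exact: H.
Qed.

Lemma card_upper : \sum_(i < n) \sum_(j < n | (i < j)%N) 1 =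
  n%:R * (n%:R - 1) / 2 :> R.
Proof.
have := sum_upper_triangle (f := fun _ _ : 'I_n => 1 : R) (fun _ _ => erefl).
rewrite !sumr_const !card_ord -mulrnA -!/(n%:R) natrM => e.
have -> : n%:R * (n%:R - 1) = n%:R * n%:R - n%:R :> R by ring.
by rewrite e; field.
Qed.

(** The traces contribute only to the mean curvature and to the scalar
    curvature, and exactly cancel: what remains is the defect of the matrix
    inequality for the traceless parts.  In the application B is the second
    fundamental form in orthonormal frames. *)
Lemma curvature_defect B (c : R) : (forall r, (B r)^T = B r) ->
  let K := 2 / (n%:R * (n%:R - 1)) in
  (\sum_r (\tr (B r) / n%:R) ^+ 2 + c)
  - (K * (\sum_(i < n) \sum_(j < n | (i < j)%N)
       (c + \sum_r (B r j j * B r i i - B r i j * B r j i)))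
     + K * Num.sqrt (\sum_(i < n) \sum_(j < n | (i < j)%N)
         \sum_(r < m) \sum_(s < m | (r < s)%N) bracket (B s) (B r) i j ^+ 2))
  = (n%:R * (n%:R - 1))^-1 *
    (energy (fun r => tracefree (B r))
     - Num.sqrt (brackets (fun r => tracefree (B r)))).
Proof.
move=> sB K; rewrite brackets_upper// brackets_tracefree.
have -> : Num.sqrt (brackets B / 4) = Num.sqrt (brackets B) / 2.
  rewrite sqrtrM; last by do 2!(apply: sumr_ge0 => ? _); exact: nsq_ge0.
  congr (_ * _); rewrite (_ : 4^-1 = 2^-1 ^+ 2); last by field.
  by rewrite sqrtr_sqr ger0_norm// invr_ge0.
under [X in K * X + _]eq_bigr do rewrite big_split/=.
rewrite big_split/= scalar_upper//.
have -> : \sum_(i < n) \sum_(j < n | (i < j)%N) c = c * (n%:R * (n%:R - 1) / 2).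
  rewrite -card_upper mulr_sumr; apply: eq_bigr => i _; rewrite mulr_sumr.
  by apply: eq_bigr => j _; rewrite mulr1.
have -> : energy (fun r => tracefree (B r)) =
    \sum_r nsq (B r) - (\sum_r (\tr (B r)) ^+ 2) / n%:R.
  by rewrite /energy mulr_suml -sumrB; apply: eq_bigr => r _; rewrite nsq_tracefree.
have -> : \sum_r (\tr (B r) / n%:R) ^+ 2 = (\sum_r (\tr (B r)) ^+ 2) / n%:R ^+ 2.
  by rewrite mulr_suml; apply: eq_bigr => r _; rewrite expr_div_n.
rewrite sumrB /K; set s := Num.sqrt _; set t := \sum_r (\tr _) ^+ 2.
set q := \sum_r nsq _; clearbody s t q.
by field; rewrite n_neq0 n1_neq0.
Qed.

Lemma defect_ge0 B : (forall r, (B r)^T = B r) ->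
  0 <= energy B - Num.sqrt (brackets B).
Proof.
move=> sB; have E0 : 0 <= energy B by apply: sumr_ge0 => r _; exact: nsq_ge0.
by rewrite subr_ge0 -[leRHS]ger0_norm// -sqrtr_sqr ler_wsqrtr// ddvv_inequality.
Qed.

Lemma defect_eq0 B : energy B - Num.sqrt (brackets B) = 0 <->
  brackets B = energy B ^+ 2.
Proof.
have E0 : 0 <= energy B by apply: sumr_ge0 => r _; exact: nsq_ge0.
have b0 : 0 <= brackets B by do 2!(apply: sumr_ge0 => ? _); exact: nsq_ge0.
split=> [/eqP|->]; last by rewrite sqrtr_sqr ger0_norm// subrr.
by rewrite subr_eq0 => /eqP ->; rewrite sqr_sqrtr.
Qed.

(** Up to the factor mu, and extended by zero, the two matrices are reflections
    of a plane in lines at an angle of pi / 4, whose bracket is twice a rotation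
    by a right angle. *)
Lemma model_equality B (a b : 'I_m) (i j : 'I_n) (mu : R) : a != b -> i != j ->
  B a = mu *: (delta_mx i i - delta_mx j j) ->
  B b = mu *: (delta_mx i j + delta_mx j i) ->
  (forall r, r != a -> r != b -> B r = 0) ->
  brackets B = energy B ^+ 2.
Proof.
move=> ab ij Ba Bb B0; have ba : b != a by rewrite eq_sym.
have ji : j != i by rewrite eq_sym.
have sum_ab (f : 'I_m -> R) : (forall r, r != a -> r != b -> f r = 0) ->
    \sum_r f r = f a + f b.
  move=> f0; rewrite (bigD1 a)//= (bigD1 b)//= big1 ?addr0// => r /andP[].
  exact: f0.
pose d : 'rV[R]_n := mu *: (delta_mx 0 i - delta_mx 0 j).
have Bd : B a = diag_mx d.
  rewrite Ba; apply/matrixP => x y; rewrite !mxE eqxx /=.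
  have [<-|xy] := eqVneq x y; first by rewrite !andbb mulr1n.
  have neq z : (x == z) && (y == z) = false.
    by apply/negP => /andP[/eqP xz /eqP yz]; rewrite xz yz eqxx in xy.
  by rewrite !neq subrr mulr0 mulr0n.
have sum_ij (f : 'I_n -> R) : (forall x, x != i -> x != j -> f x = 0) ->
    \sum_x f x = f i + f j.
  move=> f0; rewrite (bigD1 i)//= (bigD1 j)//= big1 ?addr0// => r /andP[].
  exact: f0.
have di : d 0 i = mu by rewrite !mxE !eqxx (negbTE ij) subr0 mulr1.
have dj : d 0 j = - mu by rewrite !mxE !eqxx (negbTE ji) sub0r mulrN1.
have Bii : B b i i = 0 by rewrite Bb !mxE eqxx (negbTE ij) addr0 mulr0.
have Bjj : B b j j = 0 by rewrite Bb !mxE eqxx (negbTE ji) addr0 mulr0.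
have Bij : B b i j = mu by rewrite Bb !mxE !eqxx (negbTE ij) addr0 mulr1.
have Bji : B b j i = mu by rewrite Bb !mxE !eqxx (negbTE ji) add0r mulr1.
have Bx x y : x != i -> x != j -> B b x y = 0.
  by move=> xi xj; rewrite Bb !mxE (negbTE xi) (negbTE xj) addr0 mulr0.
have By x y : y != i -> y != j -> B b x y = 0.
  by move=> yi yj; rewrite Bb !mxE (negbTE yi) (negbTE yj) !andbF addr0 mulr0.
have nb : nsq (bracket (B a) (B b)) = 8 * mu ^+ 4.
  rewrite Bd nsq_bracket_diag (sum_ij (fun x => \sum_y _)); last first.
    by move=> x xi xj; rewrite big1// => y _; rewrite Bx// expr0n mulr0.
  rewrite !sum_ij; try by move=> x xi xj; rewrite By// expr0n mulr0.
  by rewrite di dj Bii Bjj Bij Bji; ring.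
have na : nsq (B a) = 2 * mu ^+ 2.
  rewrite Bd nsq_diag sum_ij ?di ?dj; first by ring.
  by move=> x xi xj; rewrite !mxE eqxx (negbTE xi) (negbTE xj) subrr mulr0 expr0n.
have nbb : nsq (B b) = 2 * mu ^+ 2.
  rewrite /nsq (sum_ij (fun x => \sum_y _)); last first.
    by move=> x xi xj; rewrite big1// => y _; rewrite Bx// expr0n.
  rewrite !sum_ij; try by move=> x xi xj; rewrite By// expr0n.
  by rewrite Bii Bjj Bij Bji; ring.
have br0 (A : 'M[R]_n) : nsq (bracket A 0) = 0.
  by rewrite /bracket mulmx0 mul0mx subrr nsq0.
rewrite /energy sum_ab ?na ?nbb => [|r ra rb]; last by rewrite B0// nsq0.
rewrite /brackets (sum_ab (fun r => \sum_s _)) => [|r ra rb]; last first.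
  by rewrite big1// => s _; rewrite nsq_bracketC (B0 r ra rb) br0.
rewrite !sum_ab; try by move=> r ra rb; rewrite (B0 r ra rb) br0.
by rewrite !bracketxx nsq0 (nsq_bracketC (B b)) nb; ring.
Qed.

End TraceFree.

(** * Smooth functions in several variables *)
From mathcomp Require Import all_classical all_reals all_analysis.
Import numFieldNormedType.Exports.
Local Open Scope classical_set_scope.
Local Open Scope ring_scope.

Section Calculus.
Variable R : realType.

(** The difference of f and g vanishes near x, hence has zero differential. *)
Lemma near_eq_differentiable (V W : normedModType R) (f g : V -> W) x :
  {near x, f =1 g} -> differentiable f x -> differentiable g x.
Proof.
move=> fg df; have -> : g = f + (g - f) by apply/funext => y /=; rewrite !fctE addrC subrK.
apply: differentiableD => //.
have gfx : (g - f) x = 0 by rewrite !fctE (nbhs_singleton fg) subrr.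
have c0 : continuous (\0 : V -> W) by move=> ?; exact: cvg_cst.
have e0 : (g - f) \o shift x = cst ((g - f) x) + (\0 : V -> W) +o_ (0 : V) id.
  apply/eqaddoP => _/posnumP[e]; rewrite gfx.
  have fg0 : \forall y \near (0 : V), f (y + x) = g (y + x).
    have cx : (y + x) @[y --> (0 : V)] --> x.
      by rewrite -[X in _ --> X]add0r; exact: (cvgD cvg_id (cvg_cst _)).
    exact: cx _ fg.
  near=> y; rewrite /= !fctE /= -(near fg0 y)// subrr !addr0 subrr normr0.
  by rewrite mulr_ge0.
apply/diff_locallyP; rewrite (diff_unique c0 e0); split=> //.
Unshelve. all: by end_near. Qed.

Lemma eq_close (a b : R) :
  (forall e, 0 < e -> exists2 c, `|a - c| < e / 2 & `|b - c| < e / 2) -> a = b.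
Proof.
move=> h; apply/eqP; rewrite -subr_eq0 -normr_eq0 eq_le normr_ge0 andbT.
apply/ler_addgt0Pr => e /h[c ac bc]; rewrite add0r -(subrKA c).
apply: le_trans (ler_normD _ _) _; rewrite [X in _ + X]distrC.
by rewrite [e]splitr lerD// ltW.
Qed.

Section Smoothness.
Variable n : nat.
Implicit Types (U : set 'rV[R]_n) (f g : 'rV[R]_n -> R).

(** Differentiability of all iterated directional derivatives up to order k.
    Unlike for class C^k no continuity is asked at order 0: it follows from
    differentiability at the next order. *)
Fixpoint iter_diff k U f : Prop :=
  if k is k'.+1 then (forall x, U x -> differentiable f x) /\
    forall v, iter_diff k' U (fun x => 'D_v f x)
  else True.

Definition smooth U f := forall k, iter_diff k U f.

Lemma smooth_differentiable U f x : smooth U f -> U x -> differentiable f x.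
Proof. by move=> /(_ 1%N)[+ _]; apply. Qed.

Lemma smooth_derivable U f x v : smooth U f -> U x -> derivable f x v.
Proof. by move=> sf Ux; apply/diff_derivable/(smooth_differentiable sf). Qed.

Lemma smooth_derive U f v : smooth U f -> smooth U (fun x => 'D_v f x).
Proof. by move=> sf k; have [_] := sf k.+1; apply. Qed.

Lemma open_near_eq U (W : Type) (f g : 'rV[R]_n -> W) x : open U -> U x ->
  (forall y, U y -> f y = g y) -> {near x, f =1 g}.
Proof.
move=> oU Ux fg; rewrite /prop_near1; apply: (@filterS _ _ _ U) => //.
exact: open_nbhs_nbhs.
Qed.

Lemma iter_diff_ext k U f g : open U -> (forall x, U x -> f x = g x) ->
  iter_diff k U f -> iter_diff k U g.
Proof.
move=> oU; elim: k f g => //= k IHk f g fg [df Df]; split=> [x Ux|v].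
  exact: (near_eq_differentiable (open_near_eq oU Ux fg) (df x Ux)).
apply: IHk (Df v) => x Ux; apply: near_eq_derive.
exact: (open_near_eq oU Ux fg).
Qed.

Lemma smooth_ext U f g : open U -> (forall x, U x -> f x = g x) ->
  smooth U f -> smooth U g.
Proof. by move=> oU fg sf k; apply: iter_diff_ext (sf k). Qed.

Lemma iter_diff_pred k U f : iter_diff k.+1 U f -> iter_diff k U f.
Proof.
elim: k f => [//|k IHk] f [df Df]; split=> // v; exact/IHk/Df.
Qed.

Lemma smooth_cst U (a : R) : smooth U (fun=> a).
Proof.
move=> k; elim: k a => //= k IHk a; split=> [x _|v]; first exact: differentiable_cst.
have -> : (fun x => 'D_v (fun=> a) x) = fun=> 0; last exact: IHk.
by apply/funext => x; exact: derive_cst.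
Qed.

Lemma iter_diff_add k U f g : open U -> iter_diff k U f -> iter_diff k U g ->
  iter_diff k U (fun x => f x + g x).
Proof.
move=> oU; elim: k f g => //= k IHk f g [df Df] [dg Dg]; split=> [x Ux|v].
  exact: differentiableD (df x Ux) (dg x Ux).
apply: iter_diff_ext (IHk _ _ (Df v) (Dg v)) => // x Ux.
by rewrite deriveD//; apply: diff_derivable; [exact: df|exact: dg].
Qed.

Lemma iter_diff_mul k U f g : open U -> iter_diff k U f -> iter_diff k U g ->
  iter_diff k U (fun x => f x * g x).
Proof.
move=> oU; elim: k f g => //= k IHk f g [df Df] [dg Dg]; split=> [x Ux|v].
  exact: differentiableM (df x Ux) (dg x Ux).
have kf : iter_diff k U f by exact: iter_diff_pred.
have kg : iter_diff k U g by exact: iter_diff_pred.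
apply: iter_diff_ext (iter_diff_add oU (IHk _ _ kf (Dg v)) (IHk _ _ kg (Df v))) => // x Ux.
by rewrite deriveM//; apply: diff_derivable; [exact: df|exact: dg].
Qed.

Lemma iter_diff_inv k U f : open U -> (forall x, U x -> f x != 0) -> iter_diff k U f ->
  iter_diff k U (fun x => (f x)^-1).
Proof.
move=> oU f0; elim: k f f0 => //= k IHk f f0 [df Df]; split=> [x Ux|v].
  by apply: differentiableV; [exact: df|exact: f0].
have ki : iter_diff k U (fun x => (f x)^-1) by apply: IHk => //; exact: iter_diff_pred.
have kii := iter_diff_mul oU ki ki.
have km := iter_diff_mul oU (iter_diff_mul oU (smooth_cst U (-1) k) kii) (Df v).
apply: iter_diff_ext km => // x Ux.
rewrite deriveV; [|exact: f0|exact/diff_derivable/df].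
by rewrite mulN1r -expr2 exprVn.
Qed.

Lemma smooth_add U f g : open U -> smooth U f -> smooth U g ->
  smooth U (fun x => f x + g x).
Proof. by move=> oU sf sg k; apply: iter_diff_add. Qed.

Lemma smooth_mul U f g : open U -> smooth U f -> smooth U g ->
  smooth U (fun x => f x * g x).
Proof. by move=> oU sf sg k; apply: iter_diff_mul. Qed.

Lemma smooth_inv U f : open U -> (forall x, U x -> f x != 0) -> smooth U f ->
  smooth U (fun x => (f x)^-1).
Proof. by move=> oU f0 sf k; apply: iter_diff_inv. Qed.

Lemma smooth_opp U f : open U -> smooth U f -> smooth U (fun x => - f x).
Proof.
move=> oU sf; have -> : (fun x => - f x) = (fun x => -1 * f x).
  by apply/funext => x; rewrite mulN1r.
by apply: smooth_mul => //; exact: smooth_cst.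
Qed.

Lemma smooth_sub U f g : open U -> smooth U f -> smooth U g ->
  smooth U (fun x => f x - g x).
Proof. by move=> oU sf sg; apply: smooth_add => //; apply: smooth_opp. Qed.

Lemma iter_diff_sum k U (I : Type) (r : seq I) (F : I -> 'rV[R]_n -> R) : open U ->
  (forall i, iter_diff k U (F i)) -> iter_diff k U (fun x => \sum_(i <- r) F i x).
Proof.
move=> oU sF; elim: r => [|i r IHr].
  by under eq_fun do rewrite big_nil; exact: smooth_cst.
by under eq_fun do rewrite big_cons; apply: iter_diff_add.
Qed.

Lemma smooth_sum U (I : Type) (r : seq I) (F : I -> 'rV[R]_n -> R) : open U ->
  (forall i, smooth U (F i)) -> smooth U (fun x => \sum_(i <- r) F i x).
Proof. by move=> oU sF k; apply: iter_diff_sum => // i; exact: sF. Qed.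

Lemma smooth_prod U (I : Type) (r : seq I) (F : I -> 'rV[R]_n -> R) : open U ->
  (forall i, smooth U (F i)) -> smooth U (fun x => \prod_(i <- r) F i x).
Proof.
move=> oU sF; elim: r => [|i r IHr].
  by under eq_fun do rewrite big_nil; exact: smooth_cst.
by under eq_fun do rewrite big_cons; apply: smooth_mul.
Qed.

Definition smooth_mx U p q (A : 'rV[R]_n -> 'M[R]_(p, q)) :=
  forall i j, smooth U (fun x => A x i j).

Lemma Ck_entry k U p q (A : 'rV[R]_n -> 'M[R]_(p, q)) i j : open U ->
  Ck k U A -> iter_diff k U (fun x => A x i j).
Proof.
move=> oU; elim: k A => //= k IHk A [dA DA].
have dAij x : U x -> differentiable (fun x => A x i j) x.
  move=> Ux; apply: (@differentiable_comp _ _ _ _ A (fun M : 'M[R]_(p, q) => M i j : R)).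
    exact: dA.
  exact: differentiable_coord.
split=> // v; apply: iter_diff_ext (IHk _ (DA v)) => // x Ux.
by rewrite derive_mx ?mxE//; apply: diff_derivable; exact: dA.
Qed.

Lemma smooth_on_mx U p q (A : 'rV[R]_n -> 'M[R]_(p, q)) : open U ->
  smooth_on U A -> smooth_mx U A.
Proof. by move=> oU sA i j k; apply: Ck_entry. Qed.

Lemma smooth_on_differentiable U (W : normedModType R) (A : 'rV[R]_n -> W) x :
  smooth_on U A -> U x -> differentiable A x.
Proof. by move=> /(_ 1%N)[+ _]; apply. Qed.

Lemma derive_entry p q (A : 'rV[R]_n -> 'M[R]_(p, q)) x v i j : derivable A x v ->
  ('D_v A x) i j = 'D_v (fun x => A x i j) x.
Proof. by move=> dA; rewrite derive_mx// mxE. Qed.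

Lemma smooth_mx_derivable U p q (A : 'rV[R]_n -> 'M[R]_(p, q)) x v :
  smooth_mx U A -> U x -> derivable A x v.
Proof. by move=> sA Ux; apply/derivable_mxP => i j; apply: smooth_derivable Ux. Qed.

Lemma smooth_mx_derive U p q (A : 'rV[R]_n -> 'M[R]_(p, q)) v : open U ->
  smooth_mx U A -> smooth_mx U (fun x => 'D_v A x).
Proof.
move=> oU sA i j; apply: smooth_ext (smooth_derive v (sA i j)) => // x Ux.
by rewrite derive_entry//; exact: smooth_mx_derivable sA Ux.
Qed.

Lemma smooth_mx_ext U p q (A B : 'rV[R]_n -> 'M[R]_(p, q)) : open U ->
  (forall x, U x -> A x = B x) -> smooth_mx U A -> smooth_mx U B.
Proof. by move=> oU AB sA i j; apply: smooth_ext (sA i j) => // x /AB ->. Qed.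

Lemma smooth_mx_cst U p q (A : 'M[R]_(p, q)) : smooth_mx U (fun=> A).
Proof. by move=> i j; exact: smooth_cst. Qed.

Lemma smooth_mx_add U p q (A B : 'rV[R]_n -> 'M[R]_(p, q)) : open U ->
  smooth_mx U A -> smooth_mx U B -> smooth_mx U (fun x => A x + B x).
Proof.
move=> oU sA sB i j; under eq_fun do rewrite mxE; exact: smooth_add.
Qed.

Lemma smooth_mx_sub U p q (A B : 'rV[R]_n -> 'M[R]_(p, q)) : open U ->
  smooth_mx U A -> smooth_mx U B -> smooth_mx U (fun x => A x - B x).
Proof.
move=> oU sA sB i j; under eq_fun do rewrite !mxE; exact: smooth_sub.
Qed.

Lemma smooth_mx_mul U p q r (A : 'rV[R]_n -> 'M[R]_(p, q))
  (B : 'rV[R]_n -> 'M[R]_(q, r)) : open U ->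
  smooth_mx U A -> smooth_mx U B -> smooth_mx U (fun x => A x *m B x).
Proof.
move=> oU sA sB i j; under eq_fun do rewrite !mxE.
by apply: smooth_sum => // k; apply: smooth_mul.
Qed.

Lemma smooth_mx_tr U p q (A : 'rV[R]_n -> 'M[R]_(p, q)) :
  smooth_mx U A -> smooth_mx U (fun x => (A x)^T).
Proof. by move=> sA i j; under eq_fun do rewrite mxE; exact: sA. Qed.

Lemma smooth_det U p (A : 'rV[R]_n -> 'M[R]_p) : open U ->
  smooth_mx U A -> smooth U (fun x => \det (A x)).
Proof.
move=> oU sA; apply: smooth_sum => // s; apply: smooth_mul => //.
  exact: smooth_cst.
by apply: smooth_prod => // i; exact: sA.
Qed.

Lemma smooth_mx_inv U p (A : 'rV[R]_n -> 'M[R]_p) : open U ->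
  (forall x, U x -> A x \in unitmx) -> smooth_mx U A ->
  smooth_mx U (fun x => invmx (A x)).
Proof.
move=> oU uA sA i j.
apply: (@smooth_ext _ (fun x => (\det (A x))^-1 * cofactor (A x) j i)) => //.
  by move=> x Ux; rewrite /invmx uA// !mxE.
apply: smooth_mul => //.
  apply: smooth_inv => //; last exact: smooth_det.
  by move=> x /uA; rewrite unitmxE unitfE.
apply: smooth_mul => //; first exact: smooth_cst.
apply: smooth_det => // a b; under eq_fun do rewrite !mxE; exact: sA.
Qed.

Lemma is_derive_line f (c u : 'rV[R]_n) (s : R) : differentiable f (c + s *: u) ->
  is_derive s 1 (fun t : R => f (c + t *: u)) ('D_u f (c + s *: u)).
Proof.
move=> df; pose l (t : R) : 'rV[R]_n := c + t *: u.
have dl : is_diff s l (fun t => t *: u).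
  rewrite /l; apply: is_diff_eq.
  by apply/funext => t /=; rewrite !fctE /= add0r.
have dl' : differentiable l s by [].
have dfl : differentiable (f \o l) s by exact: differentiable_comp.
apply: DeriveDef; first exact: diff_derivable.
rewrite (deriveE _ (df)) -[X in derive X]/(f \o l) deriveE// diff_comp//=.
by rewrite (@diff_val _ _ _ _ _ _ _ dl) scale1r.
Qed.

Lemma mean_value_line f (c u : 'rV[R]_n) (h : R) : 0 < h ->
  (forall s, 0 <= s <= h -> differentiable f (c + s *: u)) ->
  exists2 t, 0 <= t <= h & f (c + h *: u) - f c = h * 'D_u f (c + t *: u).
Proof.
move=> h0 df.
have [|t| |t] := @MVT R (fun s => f (c + s *: u)) (fun s => 'D_u f (c + s *: u)) 0 h.
- exact: h0.
- by rewrite in_itv/= => /andP[t0 th]; apply: is_derive_line; apply: df; rewrite !ltW.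
- apply: derivable_within_continuous => t; rewrite in_itv/= => th.
  by apply: ex_derive; apply: is_derive_line; exact: df.
rewrite in_itv/= => /andP[t0 th]; rewrite scale0r addr0 subr0 mulrC => e.
by exists t => //; rewrite !ltW.
Qed.

Lemma derive_translate f (y w u : 'rV[R]_n) :
  'D_u (fun z => f (z + w)) y = 'D_u f (y + w).
Proof.
rewrite /derive; set q1 := (X in X @ _); set q2 := (X in _ = lim (X @ _)).
by have -> : q1 = q2 by apply/funext => h; rewrite /q1 /q2 /= addrA.
Qed.

(** The mean value theorem, first in the direction u for the difference of f
    at two points h v apart, then in the direction v for 'D_u f. *)
Lemma second_difference U f x (u v : 'rV[R]_n) (h : R) : 0 < h -> smooth U f ->
  (forall s t, 0 <= s <= h -> 0 <= t <= h -> U (x + s *: u + t *: v)) ->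
  exists s t, [/\ 0 <= s <= h, 0 <= t <= h &
    f (x + h *: u + h *: v) - f (x + h *: u) - f (x + h *: v) + f x =
    h ^+ 2 * 'D_v (fun y => 'D_u f y) (x + s *: u + t *: v)].
Proof.
move=> h0 sf hU.
have h00 : 0 <= (0 : R) <= h by rewrite (ltW h0) andbT.
have hhh : 0 <= h <= h by rewrite (ltW h0) lexx.
have U0 s : 0 <= s <= h -> U (x + s *: u).
  by move=> hs; have := hU s 0 hs h00; rewrite scale0r addr0.
pose F y := f (y + h *: v) - f y.
have dshift y : U (y + h *: v) -> differentiable (fun z => f (z + h *: v)) y.
  move=> Uy; apply: (@differentiable_comp _ _ _ _ (shift (h *: v)) f) => //.
  exact: smooth_differentiable sf Uy.
have dF s : 0 <= s <= h -> differentiable F (x + s *: u).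
  move=> hs; apply: differentiableB; first exact/dshift/hU.
  exact: smooth_differentiable sf (U0 s hs).
have [s hs es] := mean_value_line h0 dF.
have [|t ht et] := @mean_value_line (fun y => 'D_u f y) (x + s *: u) v h h0.
  by move=> t ht; apply: (smooth_differentiable (smooth_derive u sf)); exact: hU.
exists s, t; split=> //.
transitivity (F (x + h *: u) - F x); first by rewrite /F; ring.
rewrite es expr2 -mulrA -et; congr (_ * _).
rewrite deriveB; last 2 first.
- by apply: diff_derivable; exact/dshift/hU.
- exact: smooth_derivable sf (U0 s hs).
by rewrite derive_translate.
Qed.

(** Schwarz's theorem: the second difference is symmetric in u and v, so that
    the two mixed derivatives take a common value at points arbitrarily close
    to x; they are continuous. *)
Theorem derive_commute U f x u v : open U -> U x -> smooth U f ->
  'D_u (fun y => 'D_v f y) x = 'D_v (fun y => 'D_u f y) x.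
Proof.
move=> oU Ux sf; pose P y := 'D_v (fun y => 'D_u f y) y.
pose Q y := 'D_u (fun y => 'D_v f y) y.
have cP : {for x, continuous P}.
  apply/differentiable_continuous/(smooth_differentiable _ Ux).
  by do 2!apply: smooth_derive.
have cQ : {for x, continuous Q}.
  apply/differentiable_continuous/(smooth_differentiable _ Ux).
  by do 2!apply: smooth_derive.
have sdP h : 0 < h ->
    (forall s t, 0 <= s <= h -> 0 <= t <= h -> U (x + s *: u + t *: v)) ->
    exists s t, [/\ 0 <= s <= h, 0 <= t <= h &
      f (x + h *: u + h *: v) - f (x + h *: u) - f (x + h *: v) + f x =
      h ^+ 2 * P (x + s *: u + t *: v)].
  by move=> h0; exact: second_difference.
have sdQ h : 0 < h ->
    (forall s t, 0 <= s <= h -> 0 <= t <= h -> U (x + s *: v + t *: u)) ->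
    exists s t, [/\ 0 <= s <= h, 0 <= t <= h &
      f (x + h *: v + h *: u) - f (x + h *: v) - f (x + h *: u) + f x =
      h ^+ 2 * Q (x + s *: v + t *: u)].
  by move=> h0; exact: second_difference.
change (Q x = P x); clearbody P Q; apply: eq_close => e e0.
have e2 : 0 < e / 2 by rewrite divr_gt0.
have nU : \forall y \near x, U y by exact: open_nbhs_nbhs.
have nP : \forall y \near x, `|P x - P y| < e / 2.
  exact: (cvgrPdist_lt _ _).1 cP _ e2.
have nQ : \forall y \near x, `|Q x - Q y| < e / 2.
  exact: (cvgrPdist_lt _ _).1 cQ _ e2.
have [d d0 hd] : exists2 d : R, 0 < d & forall y, ball x d y ->
   [/\ U y, `|P x - P y| < e / 2 & `|Q x - Q y| < e / 2].
  have [d1 /= d10 h1] := (nbhs_ballP _ _).1 nU.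
  have [d2 /= d20 h2] := (nbhs_ballP _ _).1 nP.
  have [d3 /= d30 h3] := (nbhs_ballP _ _).1 nQ.
  exists (Num.min d1 (Num.min d2 d3)); first by rewrite !lt_min d10 d20.
  move=> y xy; split.
  - by apply: h1; apply: le_ball xy; rewrite ge_min lexx.
  - by apply: h2; apply: le_ball xy; rewrite !ge_min lexx orbT.
  - by apply: h3; apply: le_ball xy; rewrite !ge_min lexx !orbT.
pose K := `|u| + `|v| + 1.
have K0 : 0 < K by rewrite ltr_wpDl// addr_ge0.
(* The size of h keeps the whole parallelogram x + s u + t v in the ball. *)
pose h := d / (2 * K).
have h0 : 0 < h by rewrite divr_gt0// mulr_gt0.
have in_ball s t : 0 <= s <= h -> 0 <= t <= h -> ball x d (x + s *: u + t *: v).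
  move=> /andP[s0 sh] /andP[t0 th]; rewrite -ball_normE /= opprD addrA opprD addrA.
  rewrite subrr sub0r -opprD normrN (le_lt_trans (ler_normD _ _))// !normrZ.
  rewrite !ger0_norm//.
  have : s * `|u| + t * `|v| <= h * K.
    have su : s * `|u| <= h * `|u| by rewrite ler_wpM2r.
    have tv : t * `|v| <= h * `|v| by rewrite ler_wpM2r.
    by rewrite /K !mulrDr mulr1; lra.
  move=> /le_lt_trans; apply; rewrite /h.
  have -> : d / (2 * K) * K = d / 2 by field; rewrite gt_eqF.
  by rewrite ltr_pdivrMr// mulr_natr mulr2n ltrDr.
have [s [t [hs ht est]]] : exists s t, _ := sdP h h0
  (fun s t hs ht => let: And3 a _ _ := hd _ (in_ball s t hs ht) in a).
have in_ball' s' t' : 0 <= s' <= h -> 0 <= t' <= h -> ball x d (x + s' *: v + t' *: u).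
  by move=> hs' ht'; rewrite addrAC; exact: in_ball.
have [s' [t' [hs' ht' est']]] : exists s t, _ := sdQ h h0
  (fun s t hs ht => let: And3 a _ _ := hd _ (in_ball' s t hs ht) in a).
have [_ hP _] := hd _ (in_ball _ _ hs ht).
have [_ _ hQ] := hd _ (in_ball' _ _ hs' ht').
have PQ : P (x + s *: u + t *: v) = Q (x + s' *: v + t' *: u).
  apply: (@mulfI _ (h ^+ 2)); first by rewrite expf_neq0// gt_eqF.
  rewrite -est -est' (addrAC x (h *: v)); congr (_ + _); exact: addrAC.
by exists (P (x + s *: u + t *: v)); rewrite ?hP// PQ.
Qed.

End Smoothness.
End Calculus.

(** * Derivatives of matrix-valued functions *)
Section InnerProductTheory.
Variables (R : realType) (n : nat).
Implicit Types (g : 'M[R]_n) (u v w : 'rV[R]_n).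

Lemma ipDl g u v w : ip g (u + v) w = ip g u w + ip g v w.
Proof. by rewrite /ip !mulmxDl mxE. Qed.

Lemma ipZl g a u w : ip g (a *: u) w = a * ip g u w.
Proof. by rewrite /ip -!scalemxAl mxE. Qed.

Lemma ipDr g u v w : ip g w (u + v) = ip g w u + ip g w v.
Proof. by rewrite /ip linearD mulmxDr mxE. Qed.

Lemma ipZr g a u w : ip g w (a *: u) = a * ip g w u.
Proof. by rewrite /ip linearZ -scalemxAr mxE. Qed.

Lemma ip0l g w : ip g 0 w = 0.
Proof. by rewrite -(scale0r 0) ipZl mul0r. Qed.

Lemma ip0r g w : ip g w 0 = 0.
Proof. by rewrite -(scale0r 0) ipZr mul0r. Qed.

Lemma ipNl g u w : ip g (- u) w = - ip g u w.
Proof. by rewrite -scaleN1r ipZl mulN1r. Qed.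

Lemma ipNr g u w : ip g w (- u) = - ip g w u.
Proof. by rewrite -scaleN1r ipZr mulN1r. Qed.

Lemma ipBl g u v w : ip g (u - v) w = ip g u w - ip g v w.
Proof. by rewrite ipDl ipNl. Qed.

Lemma ipBr g u v w : ip g w (u - v) = ip g w u - ip g w v.
Proof. by rewrite ipDr ipNr. Qed.

Lemma ip_suml g (I : Type) (r : seq I) (u : I -> 'rV[R]_n) w :
  ip g (\sum_(i <- r) u i) w = \sum_(i <- r) ip g (u i) w.
Proof.
by elim/big_ind2 : _ => [|_ ? _ ? <- <-|//]; rewrite ?ip0l ?ipDl.
Qed.

Lemma ip_sumr g (I : Type) (r : seq I) (u : I -> 'rV[R]_n) w :
  ip g w (\sum_(i <- r) u i) = \sum_(i <- r) ip g w (u i).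
Proof.
by elim/big_ind2 : _ => [|_ ? _ ? <- <-|//]; rewrite ?ip0r ?ipDr.
Qed.

Lemma ipC g u v : g^T = g -> ip g u v = ip g v u.
Proof.
move=> sg; rewrite /ip -[LHS]mulr1.
have -> : u *m g *m v^T = (v *m g *m u^T)^T by rewrite !trmx_mul trmxK sg mulmxA.
by rewrite mxE mulr1.
Qed.

Lemma ip_delta g u j : ip g u (delta_mx 0 j) = (u *m g) 0 j.
Proof. by rewrite /ip trmx_delta -colE mxE. Qed.

Lemma ip_inj_delta g u v : g \in unitmx ->
  (forall j, ip g u (delta_mx 0 j) = ip g v (delta_mx 0 j)) -> u = v.
Proof.
move=> gU uv; apply: (can_inj (mulmxK gU)); apply/rowP => j.
by have := uv j; rewrite !ip_delta.
Qed.

Lemma ip_inj g u v : g \in unitmx -> (forall w, ip g u w = ip g v w) -> u = v.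
Proof.
by move=> gU uv; apply: ip_inj_delta gU _ => j.
Qed.

Lemma ipDm g h u v : ip (g + h) u v = ip g u v + ip h u v.
Proof. by rewrite /ip mulmxDr mulmxDl mxE. Qed.

Lemma ipZm g a u v : ip (a *: g) u v = a * ip g u v.
Proof. by rewrite /ip -scalemxAr -scalemxAl mxE. Qed.

End InnerProductTheory.

Section MatrixDerivative.
Variables (R : realType) (n : nat).
Implicit Types (x v : 'rV[R]_n).

Lemma is_derive_sum_fun (I : Type) (r : seq I) (h : I -> 'rV[R]_n -> R)
   (dh : I -> R) x v : (forall i, is_derive x v (h i) (dh i)) ->
  is_derive x v (fun y => \sum_(i <- r) h i y) (\sum_(i <- r) dh i).
Proof.
move=> H; elim: r => [|i r IHr].
  rewrite big_nil; under eq_fun do rewrite big_nil.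
  exact: is_derive_cst.
rewrite big_cons; under eq_fun do rewrite big_cons.
exact: is_deriveD (H i) IHr.
Qed.

Lemma is_derive_entry p q (A : 'rV[R]_n -> 'M[R]_(p, q)) x v i j :
  derivable A x v -> is_derive x v (fun y => A y i j) (('D_v A x) i j).
Proof.
move=> dA; apply: DeriveDef; first exact: (derivable_mxP A x v).1.
by rewrite derive_entry.
Qed.

Lemma is_derive_mx p q (A : 'rV[R]_n -> 'M[R]_(p, q)) (dA : 'M[R]_(p, q)) x v :
  (forall i j, is_derive x v (fun y => A y i j) (dA i j)) -> is_derive x v A dA.
Proof.
move=> H; have dA' : derivable A x v by apply/derivable_mxP => i j; exact: ex_derive.
apply: DeriveDef => //; rewrite derive_mx//; apply/matrixP => i j; rewrite mxE.
exact: derive_val.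
Qed.

Lemma is_derive_mulmx p q r (A : 'rV[R]_n -> 'M[R]_(p, q))
  (B : 'rV[R]_n -> 'M[R]_(q, r)) x v : derivable A x v -> derivable B x v ->
  is_derive x v (fun y => A y *m B y) ('D_v A x *m B x + A x *m 'D_v B x).
Proof.
move=> dA dB; apply: is_derive_mx => i j; rewrite !mxE -big_split/=.
under eq_fun do rewrite mxE; apply: is_derive_sum_fun => k.
apply: is_derive_eq; first exact: is_deriveM (is_derive_entry i k dA) (is_derive_entry k j dB).
by rewrite [RHS]addrC; congr (_ + _); exact: mulrC.
Qed.

Lemma is_derive_ip k (H : 'rV[R]_n -> 'M[R]_k)
  (V W : 'rV[R]_n -> 'rV[R]_k) x v :
  derivable H x v -> derivable V x v -> derivable W x v ->
  is_derive x v (fun y => ip (H y) (V y) (W y))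
    (ip ('D_v H x) (V x) (W x) + ip (H x) ('D_v V x) (W x)
     + ip (H x) (V x) ('D_v W x)).
Proof.
move=> dH dV dW; have [dVH eVH] := is_derive_mulmx dV dH.
have dWT : is_derive x v (fun y => (W y)^T) ('D_v W x)^T.
  apply: is_derive_mx => i j; rewrite mxE; under eq_fun do rewrite mxE.
  exact: is_derive_entry.
have [dVHW eVHW] := is_derive_mulmx dVH (@ex_derive _ _ _ _ _ _ _ dWT).
have := is_derive_entry 0 0 dVHW; rewrite eVHW eVH derive_val => h.
have -> : ip ('D_v H x) (V x) (W x) + ip (H x) ('D_v V x) (W x)
     + ip (H x) (V x) ('D_v W x) =
  (('D_v V x *m H x + V x *m 'D_v H x) *m (W x)^T
   + V x *m H x *m ('D_v W x)^T) 0 0; last exact: h.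
by rewrite mulmxDl mxE [X in _ = X + _]mxE /ip; congr (_ + _); exact: addrC.
Qed.

Lemma derive_mxD (U : set 'rV[R]_n) p q (A : 'rV[R]_n -> 'M[R]_(p, q)) x u v :
  smooth_mx U A -> U x -> 'D_(u + v) A x = 'D_u A x + 'D_v A x.
Proof.
move=> sA Ux; apply/matrixP => i j; rewrite [RHS]mxE.
rewrite !derive_entry; try exact: smooth_mx_derivable sA Ux.
by rewrite !deriveE ?linearD//; exact: smooth_differentiable (sA i j) Ux.
Qed.

Lemma derive_mxZ (U : set 'rV[R]_n) p q (A : 'rV[R]_n -> 'M[R]_(p, q)) x a v :
  smooth_mx U A -> U x -> 'D_(a *: v) A x = a *: 'D_v A x.
Proof.
move=> sA Ux; apply/matrixP => i j; rewrite [RHS]mxE.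
rewrite !derive_entry; try exact: smooth_mx_derivable sA Ux.
by rewrite !deriveE ?linearZ//; exact: smooth_differentiable (sA i j) Ux.
Qed.

Lemma derive_mx_commute (U : set 'rV[R]_n) p q (A : 'rV[R]_n -> 'M[R]_(p, q)) x u v :
  open U -> smooth_mx U A -> U x ->
  'D_u (fun y => 'D_v A y) x = 'D_v (fun y => 'D_u A y) x.
Proof.
move=> oU sA Ux; apply/matrixP => i j.
have H w z : 'D_w (fun y => 'D_z A y) x i j =
    'D_w (fun y => 'D_z (fun y => A y i j) y) x.
  rewrite derive_entry; last first.
    exact: smooth_mx_derivable (smooth_mx_derive z oU sA) Ux.
  apply: near_eq_derive; apply: (open_near_eq oU Ux) => y Uy.
  by rewrite derive_entry//; exact: smooth_mx_derivable sA Uy.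
exact: etrans (H u v) (etrans (derive_commute u v oU Ux (sA i j)) (esym (H v u))).
Qed.

Lemma smooth_mx_id (U : set 'rV[R]_n) : smooth_mx U id.
Proof.
move=> i j [//|l]; split=> [y _|v]; first exact: differentiable_coord.
have -> : (fun x => 'D_v (fun z : 'rV[R]_n => z i j) x) = fun=> v i j.
  apply/funext => x; rewrite -[LHS](derive_entry i j (@derivable_id _ _ x v)).
  by rewrite derive_id.
exact: smooth_cst.
Qed.

Lemma is_derive_comp_mx k (F : 'rV[R]_n -> 'rV[R]_k) (V : set 'rV[R]_k) p q
  (A : 'rV[R]_k -> 'M[R]_(p, q)) x v :
  differentiable F x -> smooth_mx V A -> V (F x) ->
  is_derive x v (fun y => A (F y)) ('D_('D_v F x) A (F x)).
Proof.
move=> dF sA VF; apply: is_derive_mx => i j.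
have dA := smooth_differentiable (sA i j) VF.
have dAF : differentiable ((fun z => A z i j) \o F) x by exact: differentiable_comp.
apply: DeriveDef; first exact: diff_derivable.
rewrite derive_entry; last exact: smooth_mx_derivable sA VF.
rewrite (deriveE ('D_v F x) dA) (deriveE v dF).
have -> : (fun y => A (F y) i j) = (fun z => A z i j) \o F by [].
by rewrite deriveE// diff_comp.
Qed.

(** Each derivative of f o F is a sum of products of derivatives of F with
    derivatives of f composed with F, of lower order. *)
Lemma smooth_comp k (F : 'rV[R]_n -> 'rV[R]_k) (U : set 'rV[R]_n)
   (V : set 'rV[R]_k) (f : 'rV[R]_k -> R) :
  open U -> smooth_mx U F -> (forall x, U x -> differentiable F x) ->
  (forall x, U x -> V (F x)) -> smooth V f -> smooth U (fun x => f (F x)).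
Proof.
move=> oU sF dF FV + l; elim: l f => //= l IHl f sf.
have dfF x : U x -> differentiable (f \o F) x.
  by move=> Ux; apply: differentiable_comp (dF x Ux) _; exact: smooth_differentiable sf (FV x Ux).
split=> // v.
have h : iter_diff l U (fun x => \sum_a 'D_v F x 0 a * 'D_(delta_mx 0 a) f (F x)).
  apply: iter_diff_sum => // a; apply: iter_diff_mul => //; first exact: smooth_mx_derive.
  exact: (IHl (fun z => 'D_(delta_mx 0 a) f z) (smooth_derive _ sf)).
apply: iter_diff_ext h => // x Ux; have df := smooth_differentiable sf (FV x Ux).
have -> : (fun y => f (F y)) = f \o F by [].
rewrite [RHS](deriveE v (dfF x Ux)) diff_comp//=; last exact: dF.
rewrite -(deriveE v (dF x Ux)) [in RHS](row_sum_delta ('D_v F x)) linear_sum.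
by apply: eq_bigr => a _; rewrite linearZ /= (deriveE _ df).
Qed.

Lemma smooth_mx_comp k (F : 'rV[R]_n -> 'rV[R]_k) (U : set 'rV[R]_n)
   (V : set 'rV[R]_k) p q (A : 'rV[R]_k -> 'M[R]_(p, q)) :
  open U -> smooth_mx U F -> (forall x, U x -> differentiable F x) ->
  (forall x, U x -> V (F x)) -> smooth_mx V A -> smooth_mx U (fun x => A (F x)).
Proof. by move=> oU sF dF FV sA i j; apply: smooth_comp (sA i j). Qed.

End MatrixDerivative.

(** * The Levi-Civita connection along a map *)
Definition metric_on (R : realType) k (V : set 'rV[R]_k)
  (G : 'rV[R]_k -> 'M[R]_k) : Prop :=
  [/\ open V, smooth_mx V G, forall y, V y -> (G y)^T = G y &
      forall y, V y -> G y \in unitmx].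

Definition local_map (R : realType) n k (U : set 'rV[R]_n) (V : set 'rV[R]_k)
  (F : 'rV[R]_n -> 'rV[R]_k) : Prop :=
  [/\ open U, smooth_mx U F, forall x, U x -> differentiable F x &
      forall x, U x -> V (F x)].

(** The algebra of Koszul's formula at one point: g is the metric there and D u
    its derivative in the direction u. *)
Section Koszul.
Variables (R : realType) (k : nat) (g : 'M[R]_k) (D : 'rV[R]_k -> 'M[R]_k).
Hypotheses (gU : g \in unitmx) (gT : g^T = g).
Hypothesis DT : forall u v w, ip (D u) v w = ip (D u) w v.
Hypothesis DD : forall u v, D (u + v) = D u + D v.
Hypothesis DZ : forall a u, D (a *: u) = a *: D u.
Implicit Types (u v w : 'rV[R]_k).

Definition koszul u v : 'rV[R]_k :=
  (\row_a (2^-1 * (ip (D u) v (delta_mx 0 a) + ip (D v) u (delta_mx 0 a)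
                   - ip (D (delta_mx 0 a)) u v))) *m invmx g.

Lemma koszulE u v w :
  ip g (koszul u v) w = 2^-1 * (ip (D u) v w + ip (D v) u w - ip (D w) u v).
Proof.
have sumE (B : 'rV[R]_k -> R) : (forall x y, B (x + y) = B x + B y) ->
    (forall a x, B (a *: x) = a * B x) -> B w = \sum_a w 0 a * B (delta_mx 0 a).
  move=> BD BZ; rewrite [in LHS](row_sum_delta w).
  elim/big_rec2 : _ => [|a x y _ <-]; first by rewrite -(scale0r 0) BZ mul0r.
  by rewrite BD BZ.
rewrite (sumE (ip g (koszul u v))); last 2 first.
- by move=> x y; rewrite ipDr.
- by move=> a x; rewrite ipZr.
rewrite (sumE (fun w => 2^-1 * (ip (D u) v w + ip (D v) u w - ip (D w) u v))).
- by apply: eq_bigr => a _; rewrite ip_delta mulmxKV// mxE.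
- move=> x y; rewrite DD ipDm !ipDr.
  set a := ip (D u) v x; set b := ip (D u) v y; set c := ip (D v) u x.
  set d := ip (D v) u y; set e := ip (D x) u v; set f := ip (D y) u v.
  by clearbody a b c d e f; ring.
- move=> r x; rewrite DZ ipZm !ipZr.
  set a := ip (D u) v x; set c := ip (D v) u x; set e := ip (D x) u v.
  by clearbody a c e; ring.
Qed.

Lemma koszulC u v : koszul u v = koszul v u.
Proof.
apply: (ip_inj gU) => w; rewrite !koszulE (DT w u v); congr (_ * (_ - _)).
exact: addrC.
Qed.

Lemma koszulDr u v w : koszul u (v + w) = koszul u v + koszul u w.
Proof.
apply: (ip_inj gU) => z; rewrite ipDl !koszulE DD ipDm ipDl ipDr.
have key (a b c a' b' c' : R) : 2^-1 * (a + a' + (b + b') - (c + c')) =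
  2^-1 * (a + b - c) + 2^-1 * (a' + b' - c') by ring.
exact: key.
Qed.

Lemma koszulZr u a v : koszul u (a *: v) = a *: koszul u v.
Proof.
apply: (ip_inj gU) => z; rewrite ipZl !koszulE DZ ipZm ipZl ipZr.
have key (b c d : R) : 2^-1 * (a * b + a * c - a * d) = a * (2^-1 * (b + c - d)).
  by ring.
exact: key.
Qed.

Lemma koszulDl u v w : koszul (v + w) u = koszul v u + koszul w u.
Proof. by rewrite koszulC koszulDr; congr (_ + _); exact: koszulC. Qed.

Lemma koszulZl u a v : koszul (a *: v) u = a *: koszul v u.
Proof. by rewrite koszulC koszulZr; congr (_ *: _); exact: koszulC. Qed.

Lemma koszul_compat u v w :
  ip g (koszul u v) w + ip g v (koszul u w) = ip (D u) v w.
Proof.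
rewrite (ipC v _ gT) !koszulE (DT u w v).
have key (a b c : R) : 2^-1 * (a + b - c) + 2^-1 * (a + c - b) = a by field.
exact: key.
Qed.

End Koszul.

Section Connection.
Variables (R : realType) (k : nat) (V : set 'rV[R]_k) (G : 'rV[R]_k -> 'M[R]_k).
Hypothesis mG : metric_on V G.
Implicit Types (y u v w : 'rV[R]_k).

Let oV : open V. Proof. by case: mG. Qed.
Let sG : smooth_mx V G. Proof. by case: mG. Qed.
Let symG y : V y -> (G y)^T = G y. Proof. by case: mG => _ _ h _; exact: h. Qed.
Let unitG y : V y -> G y \in unitmx. Proof. by case: mG => _ _ _; apply. Qed.

Lemma derive_ip_cst y u v w : V y ->
  'D_u (fun z => ip (G z) v w) y = ip ('D_u G y) v w.
Proof.
move=> Vy; have dG := smooth_mx_derivable (v := u) sG Vy.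
have h := is_derive_ip dG (derivable_cst v y u) (derivable_cst w y u).
by rewrite (@derive_val _ _ _ _ _ _ _ h) !derive_cst ip0l ip0r !addr0.
Qed.

Lemma smooth_ip_cst v w : smooth V (fun z => ip (G z) v w).
Proof.
have s1 : smooth_mx V (fun z => v *m G z *m w^T).
  apply: smooth_mx_mul => //; last exact: smooth_mx_cst.
  by apply: smooth_mx_mul => //; exact: smooth_mx_cst.
exact: s1 0 0.
Qed.

Lemma derive_metric_sym y u v w : V y -> ip ('D_u G y) v w = ip ('D_u G y) w v.
Proof.
move=> Vy; rewrite -!derive_ip_cst//; apply: near_eq_derive.
by apply: (open_near_eq oV Vy) => z Vz; rewrite ipC// symG.
Qed.

Lemma christoffel_koszul y u v : V y ->
  christoffel G y u v = koszul (G y) (fun w => 'D_w G y) u v.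
Proof.
move=> Vy; rewrite /christoffel /koszul; congr (_ *m _).
by apply/rowP => a; rewrite !mxE !derive_ip_cst.
Qed.

Lemma christoffelE y u v w : V y ->
  ip (G y) (christoffel G y u v) w =
  2^-1 * (ip ('D_u G y) v w + ip ('D_v G y) u w - ip ('D_w G y) u v).
Proof.
move=> Vy; rewrite christoffel_koszul//; apply: koszulE; first exact: unitG.
- by move=> x z; exact: derive_mxD sG Vy.
- by move=> a x; exact: derive_mxZ sG Vy.
Qed.

Lemma christoffelC y u v : V y -> christoffel G y u v = christoffel G y v u.
Proof.
move=> Vy; rewrite !christoffel_koszul//; apply: koszulC; first exact: unitG.
- by move=> x z w; exact: derive_metric_sym.
- by move=> x z; exact: derive_mxD sG Vy.
- by move=> a x; exact: derive_mxZ sG Vy.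
Qed.

Lemma christoffel_compat y u v w : V y ->
  ip (G y) (christoffel G y u v) w + ip (G y) v (christoffel G y u w) =
  ip ('D_u G y) v w.
Proof.
move=> Vy; rewrite !christoffel_koszul//.
apply: (koszul_compat (D := fun w => 'D_w G y)); [exact: unitG|exact: symG|..].
- by move=> x z t; exact: derive_metric_sym.
- by move=> x z; exact: derive_mxD sG Vy.
- by move=> a x; exact: derive_mxZ sG Vy.
Qed.

Lemma christoffelDr y u v w : V y ->
  christoffel G y u (v + w) = christoffel G y u v + christoffel G y u w.
Proof.
move=> Vy; rewrite !christoffel_koszul//; apply: koszulDr; first exact: unitG.
- by move=> x z; exact: derive_mxD sG Vy.
- by move=> a x; exact: derive_mxZ sG Vy.
Qed.

Lemma christoffelZr y u a v : V y ->
  christoffel G y u (a *: v) = a *: christoffel G y u v.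
Proof.
move=> Vy; rewrite !christoffel_koszul//; apply: koszulZr; first exact: unitG.
- by move=> x z; exact: derive_mxD sG Vy.
- by move=> b x; exact: derive_mxZ sG Vy.
Qed.

Lemma christoffelDl y u v w : V y ->
  christoffel G y (v + w) u = christoffel G y v u + christoffel G y w u.
Proof.
move=> Vy; rewrite !christoffel_koszul//; apply: koszulDl; first exact: unitG.
- by move=> x z t; exact: derive_metric_sym.
- by move=> x z; exact: derive_mxD sG Vy.
- by move=> a x; exact: derive_mxZ sG Vy.
Qed.

Lemma christoffelZl y u a v : V y ->
  christoffel G y (a *: v) u = a *: christoffel G y v u.
Proof.
move=> Vy; rewrite !christoffel_koszul//; apply: koszulZl; first exact: unitG.
- by move=> x z t; exact: derive_metric_sym.
- by move=> x z; exact: derive_mxD sG Vy.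
- by move=> b x; exact: derive_mxZ sG Vy.
Qed.

(** The Christoffel symbols contracted with u, as a matrix acting on the right:
    covariant differentiation becomes matrix calculus. *)
Definition conn y u : 'M[R]_k := \matrix_b christoffel G y u (delta_mx 0 b).

Lemma christoffel_conn y u v : V y -> christoffel G y u v = v *m conn y u.
Proof.
move=> Vy; rewrite mulmx_sum_row [in LHS](row_sum_delta v).
elim/big_rec2 : _ => [|b w ? _ <-].
  by rewrite -[X in christoffel _ _ _ X](scale0r 0) christoffelZr// scale0r.
by rewrite christoffelDr// christoffelZr// rowK.
Qed.

Lemma conn_sum y u : V y -> conn y u = \sum_a u 0 a *: conn y (delta_mx 0 a).
Proof.
move=> Vy; apply/row_matrixP => b; rewrite rowK linear_sum/=.
rewrite [in LHS](row_sum_delta u); elim/big_rec2 : _ => [|a w ? _ <-].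
  by rewrite -[X in christoffel _ _ X](scale0r 0) christoffelZl// scale0r.
by rewrite christoffelDl// christoffelZl// linearZ/= rowK.
Qed.

Lemma smooth_conn u : smooth_mx V (fun y => conn y u).
Proof.
move=> b j; under eq_fun do rewrite mxE /christoffel.
have s1 : smooth_mx V (fun y => (\row_a (2^-1 *
   ('D_u (fun y => ip (G y) (delta_mx 0 b) (delta_mx 0 a)) y
    + 'D_(delta_mx 0 b) (fun y => ip (G y) u (delta_mx 0 a)) y
    - 'D_(delta_mx 0 a) (fun y => ip (G y) u (delta_mx 0 b)) y)) : 'rV[R]_k)).
  move=> i a; under eq_fun do rewrite mxE.
  apply: smooth_mul => //; first exact: smooth_cst.
  apply: smooth_sub => //; last exact/smooth_derive/smooth_ip_cst.
  by apply: smooth_add => //; exact/smooth_derive/smooth_ip_cst.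
exact: (smooth_mx_mul oV s1 (smooth_mx_inv oV unitG sG)).
Qed.

End Connection.

Section Along.
Variables (R : realType) (n k : nat).
Variables (U : set 'rV[R]_n) (V : set 'rV[R]_k).
Variables (G : 'rV[R]_k -> 'M[R]_k) (F : 'rV[R]_n -> 'rV[R]_k).
Hypotheses (mG : metric_on V G) (lF : local_map U V F).
Implicit Types (x X Y : 'rV[R]_n) (W : 'rV[R]_n -> 'rV[R]_k).

Let oU : open U. Proof. by case: lF. Qed.
Let sF : smooth_mx U F. Proof. by case: lF. Qed.
Let dF x : U x -> differentiable F x. Proof. by case: lF => _ _ h _; exact: h. Qed.
Let FV x : U x -> V (F x). Proof. by case: lF => _ _ _; apply. Qed.
Let sG : smooth_mx V G. Proof. by case: mG. Qed.

(** The matrix of the connection pulled back by F. *)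
Definition pconn Y x : 'M[R]_k := conn G (F x) ('D_Y F x).

Lemma nabla_alongE Y W x : U x ->
  nabla_along G F Y W x = 'D_Y W x + W x *m pconn Y x.
Proof. by move=> Ux; rewrite /nabla_along (christoffel_conn mG)//; exact: FV. Qed.

Lemma pconn_sum Y x : U x ->
  pconn Y x = \sum_a 'D_Y F x 0 a *: conn G (F x) (delta_mx 0 a).
Proof. by move=> Ux; rewrite /pconn (conn_sum mG)//; exact: FV. Qed.

Lemma smooth_pconn Y : smooth_mx U (pconn Y).
Proof.
apply: (@smooth_mx_ext _ _ _ _ _ (fun x => \sum_a 'D_Y F x 0 a *:
   conn G (F x) (delta_mx 0 a))) => // [x Ux|i j]; first by rewrite pconn_sum.
under eq_fun do rewrite summxE; apply: smooth_sum => // a.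
under eq_fun do rewrite mxE; apply: smooth_mul => //.
  exact: smooth_mx_derive.
exact: (smooth_mx_comp oU sF dF FV (smooth_conn mG (delta_mx 0 a))).
Qed.

Lemma smooth_nabla_along Y W : smooth_mx U W -> smooth_mx U (nabla_along G F Y W).
Proof.
move=> sW; apply: (@smooth_mx_ext _ _ _ _ _ (fun x => 'D_Y W x + W x *m pconn Y x)) => //.
  by move=> x Ux; rewrite nabla_alongE.
apply: smooth_mx_add => //; first exact: smooth_mx_derive.
by apply: smooth_mx_mul => //; exact: smooth_pconn.
Qed.

Lemma nabla_along_near X W W' x : U x -> (forall y, U y -> W y = W' y) ->
  nabla_along G F X W x = nabla_along G F X W' x.
Proof.
move=> Ux WW; rewrite /nabla_along (WW x Ux); congr (_ + _).
by apply: near_eq_derive; exact: (open_near_eq oU Ux).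
Qed.

Lemma nabla_alongB X W W' x : U x -> derivable W x X -> derivable W' x X ->
  nabla_along G F X (fun y => W y - W' y) x =
  nabla_along G F X W x - nabla_along G F X W' x.
Proof.
move=> Ux dW dW'; rewrite !nabla_alongE// mulmxBl.
rewrite [X in X + _ = _](deriveB dW dW').
by rewrite opprD addrACA.
Qed.

(** The derivative of the metric along F is that of G in the direction
    'D_X F x; Koszul's formula distributes it between W and W'. *)
Theorem metric_compatibility X W W' x : U x ->
  derivable W x X -> derivable W' x X ->
  'D_X (fun y => ip (G (F y)) (W y) (W' y)) x =
  ip (G (F x)) (nabla_along G F X W x) (W' x)
  + ip (G (F x)) (W x) (nabla_along G F X W' x).
Proof.
move=> Ux dW dW'; have VF := FV Ux; have symG : (G (F x))^T = G (F x).
  by case: mG => _ _ + _; apply.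
have [dGF eGF] := is_derive_comp_mx X (dF Ux) sG VF.
have h := is_derive_ip dGF dW dW'.
rewrite (@derive_val _ _ _ _ _ _ _ h) eGF -(christoffel_compat mG)//.
rewrite /nabla_along ipDl ipDr.
have key (a b c d : R) : a + b + c + d = c + a + (d + b) by ring.
exact: key.
Qed.

Lemma torsion_free X Y x : U x ->
  nabla_along G F X (fun y => 'D_Y F y) x = nabla_along G F Y (fun y => 'D_X F y) x.
Proof.
move=> Ux; rewrite /nabla_along.
have -> := @christoffelC _ _ _ _ mG _ ('D_X F x) ('D_Y F x) (FV Ux).
by have -> := derive_mx_commute X Y oU sF Ux.
Qed.

Definition pcurv X Y x : 'M[R]_k :=
  'D_X (pconn Y) x - 'D_Y (pconn X) x
  + pconn Y x *m pconn X x - pconn X x *m pconn Y x.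

(** The second derivatives of W cancel by Schwarz's theorem, and its first
    derivatives appear symmetrically in X and Y. *)
Lemma nabla_alongK X Y W x : U x -> smooth_mx U W ->
  nabla_along G F X (nabla_along G F Y W) x
  - nabla_along G F Y (nabla_along G F X W) x = W x *m pcurv X Y x.
Proof.
move=> Ux sW.
have H A B : nabla_along G F A (nabla_along G F B W) x =
   'D_A (fun y => 'D_B W y) x + 'D_A W x *m pconn B x + W x *m 'D_A (pconn B) x
   + 'D_B W x *m pconn A x + W x *m (pconn B x *m pconn A x).
  rewrite nabla_alongE// nabla_alongE//.
  have e : 'D_A (nabla_along G F B W) x =
      'D_A (fun y => 'D_B W y + W y *m pconn B y) x.
    apply: near_eq_derive; apply: (open_near_eq oU Ux) => y Uy.
    exact: nabla_alongE.
  have dW : derivable W x A by exact: smooth_mx_derivable sW Ux.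
  have dP : derivable (pconn B) x A by exact: (smooth_mx_derivable (v := A) (smooth_pconn B) Ux).
  have dDW : derivable (fun y => 'D_B W y) x A.
    exact: (smooth_mx_derivable (v := A) (smooth_mx_derive B oU sW) Ux).
  have [dWP eWP] := is_derive_mulmx dW dP.
  rewrite e [X in X + _ = _](deriveD dDW dWP) eWP mulmxDl !mulmxA !addrA.
  by [].
rewrite !H (derive_mx_commute X Y oU sW Ux) /pcurv.
rewrite mulmxBr mulmxDr mulmxBr.
have key (a b c d e p q : 'rV[R]_k) :
    a + b + c + d + p - (a + d + e + b + q) = c - e + p - q.
  by apply/rowP => i; rewrite !mxE; ring.
exact: key.
Qed.

End Along.

(** * Curvature tensors *)
Section CurvatureLike.
Variables (R : realFieldType) (E : zmodType) (T : E -> E -> E -> E -> R).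
Hypothesis skew12 : forall x y z w, T x y z w = - T y x z w.
Hypothesis skew34 : forall x y z w, T x y z w = - T x y w z.
Hypothesis bianchi : forall x y z w, T x y z w + T y z x w + T z x y w = 0.

(** The alternating sum of four instances of the Bianchi identity. *)
Lemma pair_symmetry x y z w : T x y z w = T z w x y.
Proof.
have := bianchi x y z w; have := bianchi y z w x.
have := bianchi z w x y; have := bianchi w x y z.
have := skew34 y z w x; have := skew34 z w y x.
have := skew34 x z w y; have := skew12 x z y w.
have := skew34 w x z y; have := skew34 x y w z.
have := skew12 y w x z; have := skew34 w y x z; lra.
Qed.

Hypothesis add3 : forall x y z z' w, T x y (z + z') w = T x y z w + T x y z' w.
Hypothesis add4 : forall x y z w w', T x y z (w + w') = T x y z w + T x y z w'.
Hypothesis sec0 : forall x y, T x y y x = 0.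

(** Polarising the hypothesis in the second variable, then in the first, makes
    T alternating in all its arguments; the Bianchi identity then reads
    3 T = 0. *)
Lemma curvature_like_eq0 x y z w : T x y z w = 0.
Proof.
have add1 a a' b c d : T (a + a') b c d = T a b c d + T a' b c d.
  by rewrite pair_symmetry add3 -!(pair_symmetry c d).
have add2 a b b' c d : T a (b + b') c d = T a b c d + T a b' c d.
  by rewrite pair_symmetry add4 -!(pair_symmetry c d).
have h1 a b c : T a b c a = 0.
  have := sec0 a (b + c); rewrite add2 !add3 !sec0.
  have := pair_symmetry a c b a; have := skew12 b a a c.
  have := skew34 a b a c; lra.
have skew14 a b c d : T a b c d = - T d b c a.
  by have := h1 (a + d) b c; rewrite add1 !add4 !h1; lra.
have skew23 a b c d : T a b c d = - T a c b d.
  have := skew12 a b c d; have := skew14 b a c d; have := skew12 d a c b.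
  have := skew34 a d c b; have := skew14 a d b c; have := skew12 c d b a.
  have := skew14 d c b a; lra.
have := bianchi x y z w; have := skew23 y z x w; have := skew12 x y z w.
have := skew12 z x y w; have := skew23 x z y w; lra.
Qed.

End CurvatureLike.

Section ConstantCurvatureLike.
Variables (R : realFieldType) (E : zmodType) (T : E -> E -> E -> E -> R).
Variables (q : E -> E -> R) (c : R).
Hypothesis skew12 : forall x y z w, T x y z w = - T y x z w.
Hypothesis skew34 : forall x y z w, T x y z w = - T x y w z.
Hypothesis bianchi : forall x y z w, T x y z w + T y z x w + T z x y w = 0.
Hypothesis add3 : forall x y z z' w, T x y (z + z') w = T x y z w + T x y z' w.
Hypothesis add4 : forall x y z w w', T x y z (w + w') = T x y z w + T x y z w'.
Hypothesis qC : forall x y, q x y = q y x.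
Hypothesis qD : forall x y z, q x (y + z) = q x y + q x z.
Hypothesis sec : forall x y, T x y y x = c * (q x x * q y y - q x y ^+ 2).

Lemma constant_curvature_like x y z w :
  T x y z w = c * (q y z * q x w - q x z * q y w).
Proof.
pose S x y z w := T x y z w - c * (q y z * q x w - q x z * q y w).
suff : S x y z w = 0 by move/eqP; rewrite subr_eq0 => /eqP.
apply: (curvature_like_eq0 (T := S)) => [a b d e|a b d e|a b d e|a b d d' e|a b d e e'|a b].
- by rewrite /S skew12; ring.
- by rewrite /S skew34; ring.
- by rewrite -[RHS](bianchi a b d e) /S (qC b a) (qC d a) (qC d b); ring.
- by rewrite /S add3 !qD; ring.
- by rewrite /S add4 !qD; ring.
- by rewrite /S sec (qC b a); ring.
Qed.

End ConstantCurvatureLike.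

(** * The curvature of a pulled-back connection *)
Section CurvatureAlong.
Variables (R : realType) (n k : nat).
Variables (U : set 'rV[R]_n) (V : set 'rV[R]_k).
Variables (G : 'rV[R]_k -> 'M[R]_k) (F : 'rV[R]_n -> 'rV[R]_k).
Hypotheses (mG : metric_on V G) (lF : local_map U V F).

Lemma local_map_id : local_map V V id.
Proof.
have [oV _ _ _] := mG; split=> //; exact: smooth_mx_id.
Qed.

(** The curvature of the metric itself is the case of the identity map. *)
Definition ccurv u v z : 'M[R]_k := pcurv G id u v z.

Lemma pconn_id v z : pconn G id v z = conn G z v.
Proof. by rewrite /pconn derive_id. Qed.

Lemma curvE u v w z : V z -> curv G z u v w = w *m ccurv u v z.
Proof.
move=> Vz; have lid := local_map_id.
have nE X W : nabla G X W = nabla_along G id X W.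
  by apply/funext => y; rewrite /nabla /nabla_along derive_id.
by rewrite /curv !nE (nabla_alongK mG lid)//; exact: smooth_mx_cst.
Qed.

(** Differentiating the coefficients 'D_Y F of the pulled-back connection
    produces second derivatives of F, which cancel by Schwarz's theorem. *)
Lemma pcurv_ccurv X Y x : U x -> pcurv G F X Y x = ccurv ('D_X F x) ('D_Y F x) (F x).
Proof.
move=> Ux; have [oU sF dF FV] := lF; have [oV sG _ _] := mG.
have dconn A B : 'D_A (pconn G F B) x =
   (\sum_a ('D_A (fun y => 'D_B F y) x) 0 a *: conn G (F x) (delta_mx 0 a))
   + 'D_('D_A F x) (pconn G id ('D_B F x)) (F x).
  apply/matrixP => i j.
  rewrite (derive_entry _ _ (smooth_mx_derivable (v := A) (smooth_pconn mG lF B) Ux)).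
  have -> : 'D_A (fun y => pconn G F B y i j) x =
     'D_A (fun y => \sum_a 'D_B F y 0 a * conn G (F y) (delta_mx 0 a) i j) x.
    apply: near_eq_derive; apply: (open_near_eq oU Ux) => y Uy.
    rewrite (pconn_sum mG lF _ Uy) summxE; apply: eq_bigr => a _; rewrite mxE.
    by [].
  have VF := FV x Ux.
  have h1 a := is_derive_entry 0 a (smooth_mx_derivable (v := A) (smooth_mx_derive B oU sF) Ux).
  have h2 a : is_derive x A (fun y => conn G (F y) (delta_mx 0 a) i j)
      (('D_('D_A F x) (fun z => conn G z (delta_mx 0 a)) (F x)) i j).
    have [d e] := is_derive_comp_mx A (dF x Ux) (smooth_conn mG (delta_mx 0 a)) VF.
    by have := is_derive_entry i j d; rewrite e.
  have h3 a := is_deriveM (h1 a) (h2 a).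
  have h := is_derive_sum_fun (index_enum _) h3.
  rewrite [LHS](@derive_val _ _ _ _ _ _ _ h) big_split/= addrC [RHS]mxE.
  rewrite [X in _ = X + _]summxE; congr (_ + _).
    by apply: eq_bigr => a _; rewrite [RHS]mxE; exact: mulrC.
  have h4 a := is_deriveM (is_derive_cst ('D_B F x 0 a) (F x) ('D_A F x))
    (is_derive_entry i j (smooth_mx_derivable (v := 'D_A F x) (smooth_conn mG (delta_mx 0 a)) VF)).
  have [_ h'] := is_derive_sum_fun (index_enum _) h4.
  have dP : derivable (pconn G id ('D_B F x)) (F x) ('D_A F x).
    exact: smooth_mx_derivable (smooth_pconn mG local_map_id _) VF.
  apply: etrans (esym (derive_entry i j dP)).
  apply: etrans (etrans (esym h') _).
    by apply: eq_bigr => a _; rewrite scaler0 addr0.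
  apply: near_eq_derive; apply: (open_near_eq oV VF) => z Vz.
  rewrite pconn_id (conn_sum mG _ Vz) summxE; apply: eq_bigr => a _; rewrite mxE.
  by [].
have key (S1 S2 a b a' b' P P' Q Q' : 'M[R]_k) : a = S1 + a' -> b = S2 + b' ->
    S1 = S2 -> P' = P -> Q' = Q ->
    a - b + P *m Q - Q *m P = a' - b' + P' *m Q' - Q' *m P'.
  by move=> -> -> -> -> ->; rewrite opprD addrACA subrr add0r.
have e := derive_mx_commute X Y oU sF Ux.
have eS := congr1 (fun W : 'rV[R]_k =>
  \sum_a W 0 a *: conn G (F x) (delta_mx 0 a)) e.
exact: key (dconn X Y) (dconn Y X) eS (pconn_id _ _) (pconn_id _ _).
Qed.

Theorem curvature_along X Y W x : U x -> smooth_mx U W ->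
  nabla_along G F X (nabla_along G F Y W) x
  - nabla_along G F Y (nabla_along G F X W) x =
  curv G (F x) ('D_X F x) ('D_Y F x) (W x).
Proof.
move=> Ux sW; have [_ _ _ FV] := lF.
rewrite (nabla_alongK mG lF)// pcurv_ccurv// curvE//; exact: FV.
Qed.

End CurvatureAlong.

(** * The curvature tensor of a space form *)
Section RiemannTensor.
Variables (R : realType) (k : nat) (V : set 'rV[R]_k) (G : 'rV[R]_k -> 'M[R]_k).
Hypothesis mG : metric_on V G.
Variable z : 'rV[R]_k.
Hypothesis Vz : V z.
Implicit Types (u v w t : 'rV[R]_k).

Let lid := local_map_id mG.
Let symG : (G z)^T = G z. Proof. by case: mG => _ _ h _; exact: h. Qed.

Lemma nabla_id X (W : 'rV[R]_k -> 'rV[R]_k) : nabla G X W = nabla_along G id X W.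
Proof. by apply/funext => y; rewrite /nabla /nabla_along derive_id. Qed.

Lemma curv_id u v w : curv G z u v w =
  nabla_along G id u (nabla_along G id v (cst w)) z
  - nabla_along G id v (nabla_along G id u (cst w)) z.
Proof. by rewrite /curv !nabla_id. Qed.

Lemma Riem_skew12 u v w t : Riem G z u v w t = - Riem G z v u w t.
Proof. by rewrite /Riem /curv -ipNl opprB. Qed.

(** Apply metric compatibility twice to the function y |-> <w, t>: its second
    derivatives in the directions u and v commute. *)
Lemma Riem_skew34 u v w t : Riem G z u v w t = - Riem G z u v t w.
Proof.
have key (a b c d a' d' d1 d1' r1 r2 : R) : r1 = a - a' -> r2 = d1 - d1' ->
    d = d1 -> d' = d1' -> a + b + (c + d) = a' + c + (b + d') -> r1 = - r2.
  by move=> -> -> <- <-; lra.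
have [oV sG _ _] := mG.
pose N a (W : 'rV[R]_k -> 'rV[R]_k) := nabla_along G id a W.
have sN a W : smooth_mx V W -> smooth_mx V (N a W).
  exact: (smooth_nabla_along mG lid a).
have sc w' : smooth_mx V (cst w') by exact: smooth_mx_cst.
have dd (W : 'rV[R]_k -> 'rV[R]_k) y a : smooth_mx V W -> V y -> derivable W y a.
  by move=> sW Vy; exact: smooth_mx_derivable sW Vy.
have sip W W' : smooth_mx V W -> smooth_mx V W' ->
    smooth V (fun y => ip (G y) (W y) (W' y)).
  move=> sW sW'; exact: (smooth_mx_mul oV (smooth_mx_mul oV sW sG) (smooth_mx_tr sW') 0 0).
pose phi y := ip (G y) w t.
have H a b : 'D_a (fun y => 'D_b phi y) z =
    ip (G z) (N a (N b (cst w)) z) t + ip (G z) (N b (cst w) z) (N a (cst t) z)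
    + (ip (G z) (N a (cst w) z) (N b (cst t) z) + ip (G z) w (N a (N b (cst t)) z)).
  have e : 'D_a (fun y => 'D_b phi y) z =
     'D_a ((fun y => ip (G y) (N b (cst w) y) t)
           + (fun y => ip (G y) w (N b (cst t) y))) z.
    apply: near_eq_derive; apply: (open_near_eq oV Vz) => y Vy.
    change ('D_b phi y = ip (G y) (N b (cst w) y) t + ip (G y) w (N b (cst t) y)).
    exact: (metric_compatibility mG lid Vy (dd _ _ b (sc w) Vy) (dd _ _ b (sc t) Vy)).
  apply: etrans e _.
  have d1 := smooth_derivable (v := a) (sip _ _ (sN b _ (sc w)) (sc t)) Vz.
  have d2 := smooth_derivable (v := a) (sip _ _ (sc w) (sN b _ (sc t))) Vz.
  apply: etrans (deriveD d1 d2) _; congr (_ + _).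
    exact: (metric_compatibility mG lid Vz (dd _ _ a (sN b _ (sc w)) Vz) (dd _ _ a (sc t) Vz)).
  exact: (metric_compatibility mG lid Vz (dd _ _ a (sc w) Vz) (dd _ _ a (sN b _ (sc t)) Vz)).
have e := derive_commute u v oV Vz (sip _ _ (sc w) (sc t)).
(* The mixed terms of the two expansions agree; the others give curvatures. *)
have hE := etrans (esym (H u v)) (etrans e (H v u)).
have R_E p q : Riem G z u v p q =
    ip (G z) (N u (N v (cst p)) z) q - ip (G z) (N v (N u (cst p)) z) q.
  exact: etrans (f_equal (fun c => ip (G z) c q) (curv_id u v p)) (ipBl _ _ _ _).
exact: key (R_E w t) (R_E t w) (ipC _ _ symG) (ipC _ _ symG) hE.
Qed.

Lemma Riem_bianchi u v w t :
  Riem G z u v w t + Riem G z v w u t + Riem G z w u v t = 0.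
Proof.
pose N a (W : 'rV[R]_k -> 'rV[R]_k) := nabla_along G id a W.
have tf a b c : N a (N b (cst c)) z = N a (N c (cst b)) z.
  apply: (nabla_along_near G lid a Vz) => y Vy.
  rewrite /N -!nabla_id /nabla !derive_cst !add0r.
  exact: (christoffelC mG _ _ Vy).
have key (a b c a' b' c' x y s : 'rV[R]_k) : a = a' -> b = b' -> c = c' ->
    x = a - b' -> y = b - c' -> s = c - a' -> x + y + s = 0.
  by move=> -> -> -> -> -> ->; rewrite !subrKA subrr.
have e : curv G z u v w + curv G z v w u + curv G z w u v = 0.
  exact: key (tf u v w) (tf v w u) (tf w u v) (curv_id _ _ _) (curv_id _ _ _) (curv_id _ _ _).
by rewrite /Riem -!ipDl e ip0l.
Qed.

Lemma Riem_add3 u v w w' t : Riem G z u v (w + w') t = Riem G z u v w t + Riem G z u v w' t.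
Proof. by rewrite /Riem !(curvE mG)// mulmxDl ipDl. Qed.

Lemma Riem_scale3 u v a w t : Riem G z u v (a *: w) t = a * Riem G z u v w t.
Proof. by rewrite /Riem !(curvE mG)// -scalemxAl ipZl. Qed.

Lemma Riem_add4 u v w t t' : Riem G z u v w (t + t') = Riem G z u v w t + Riem G z u v w t'.
Proof. by rewrite /Riem ipDr. Qed.

Lemma Riem_scale1 u v a w t : Riem G z (a *: u) v w t = a * Riem G z u v w t.
Proof.
have ps := pair_symmetry Riem_skew12 Riem_skew34 Riem_bianchi.
by rewrite ps Riem_scale3 -ps.
Qed.

Hypothesis posG : pos_def (G z).

(** Sectional curvature is only defined for independent vectors; for dependent
    ones both sides vanish.  That D is nonzero for independent vectors is the
    equality case of Cauchy-Schwarz. *)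
Lemma Riem_plane c : (forall u v, row_free (col_mx u v) ->
    sectional_curvature G z u v = c) ->
  forall u v, Riem G z u v v u = c * (ip (G z) u u * ip (G z) v v - ip (G z) u v ^+ 2).
Proof.
move=> hc u v.
have dep a : Riem G z (a *: v) v v (a *: v) =
    c * (ip (G z) (a *: v) (a *: v) * ip (G z) v v - ip (G z) (a *: v) v ^+ 2).
  rewrite Riem_scale1 (_ : Riem G z v v v _ = 0); last first.
    by have := Riem_skew12 v v v (a *: v); lra.
  by rewrite !ipZl ipZr; ring.
have [v0|v0] := eqVneq v 0.
  by rewrite v0 ip0l ip0r /Riem (curvE mG)// mul0mx ip0l expr0n mulr0 subrr mulr0.
have vv := posG v0.
set D := ip (G z) u u * ip (G z) v v - ip (G z) u v ^+ 2.
pose b := ip (G z) u v / ip (G z) v v.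
have [ub|ub] := eqVneq (u - b *: v) 0.
  by move/eqP: ub; rewrite subr_eq0 => /eqP ub; rewrite /D ub; exact: dep.
have D0 : D != 0.
  have := posG ub; rewrite ipBl !ipBr !ipZl !ipZr (ipC v u symG) => h.
  have : 0 < D.
    suff -> : D = ip (G z) v v * (ip (G z) u u - b * ip (G z) u v -
        b * (ip (G z) u v - b * ip (G z) v v)) by rewrite mulr_gt0//; lra.
    by rewrite /D /b; field; rewrite gt_eqF.
  by move/gt_eqF ->.
have free : row_free (col_mx u v).
  rewrite -kermx_eq0; apply/rowV0P => x /sub_kermxP.
  rewrite -(hsubmxK x) mul_row_col; set x1 := lsubmx x; set x2 := rsubmx x.
  rewrite [x1]mx11_scalar [x2]mx11_scalar !mul_scalar_mx => e.
  have a0 : x1 0 0 = 0.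
    apply/eqP; apply: contraT => a0; case/negP: D0.
    have -> : D = 0; last by [].
    have uE : u = (- (x1 0 0)^-1 * x2 0 0) *: v.
      apply: (scalerI a0); rewrite scalerA mulrA mulrN divff// mulN1r scaleNr.
      by apply/eqP; rewrite -addr_eq0 e.
    by rewrite /D uE !ipZl !ipZr; ring.
  have b0 : x2 0 0 = 0.
    move: e; rewrite a0 scale0r add0r => /eqP.
    by rewrite scaler_eq0 (negbTE v0) orbF => /eqP.
  by rewrite a0 b0 !raddf0 row_mx0.
have := hc u v free; rewrite /sectional_curvature -/D => <-.
by rewrite divfK.
Qed.

Theorem Riem_constant_curvature c : (forall u v, row_free (col_mx u v) ->
    sectional_curvature G z u v = c) ->
  forall u v w t, Riem G z u v w t =
    c * (ip (G z) v w * ip (G z) u t - ip (G z) u w * ip (G z) v t).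
Proof.
move=> hc u v w t; apply: (constant_curvature_like (T := Riem G z)).
- exact: Riem_skew12.
- exact: Riem_skew34.
- exact: Riem_bianchi.
- exact: Riem_add3.
- exact: Riem_add4.
- by move=> x y; exact: ipC.
- by move=> x y p; exact: ipDr.
- exact: Riem_plane.
Qed.

End RiemannTensor.

(** * The equations of Gauss and Ricci *)
Section Submanifold.
Variables (R : realType) (n k : nat).
Variables (U : set 'rV[R]_n) (V : set 'rV[R]_k).
Variables (g : 'rV[R]_n -> 'M[R]_n) (G : 'rV[R]_k -> 'M[R]_k).
Variable F : 'rV[R]_n -> 'rV[R]_k.
Hypotheses (mg : metric_on U g) (mG : metric_on V G) (lF : local_map U V F).
Hypothesis gE : forall x, U x -> g x = 'J F x *m G (F x) *m ('J F x)^T.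
Implicit Types (x X Y Z W : 'rV[R]_n) (w xi : 'rV[R]_k).

Let oU : open U. Proof. by case: lF. Qed.
Let sF : smooth_mx U F. Proof. by case: lF. Qed.
Let dF x : U x -> differentiable F x. Proof. by case: lF => _ _ h _; exact: h. Qed.
Let FV x : U x -> V (F x). Proof. by case: lF => _ _ _; apply. Qed.
Let sG : smooth_mx V G. Proof. by case: mG. Qed.
Let sg : smooth_mx U g. Proof. by case: mg. Qed.
Let symG x : U x -> (G (F x))^T = G (F x).
Proof. by move=> Ux; case: mG => _ _ h _; apply: h; exact: FV. Qed.
Let symg x : U x -> (g x)^T = g x.
Proof. by move=> Ux; case: mg => _ _ h _; exact: h. Qed.
Let unitg x : U x -> g x \in unitmx.
Proof. by move=> Ux; case: mg => _ _ _; apply. Qed.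
Let lid := local_map_id mg.

Lemma derive_jacobian X x : U x -> 'D_X F x = X *m 'J F x.
Proof. by move=> Ux; apply: deriveEjacobian; exact: dF. Qed.

Lemma smooth_jacobian : smooth_mx U (fun x => 'J F x).
Proof.
move=> i j; apply: smooth_ext (smooth_mx_derive (delta_mx 0 i) oU sF 0 j) => //.
by move=> x Ux; rewrite derive_jacobian// -rowE mxE.
Qed.

Lemma ip_push x b c : U x ->
  ip (G (F x)) (b *m 'J F x) (c *m 'J F x) = ip (g x) b c.
Proof. by move=> Ux; rewrite /ip (gE Ux) trmx_mul !mulmxA. Qed.

(** The vector of the tangent space of M whose image under the differential of
    F is the tangential part of w. *)
Definition tcoord x w : 'rV[R]_n := w *m G (F x) *m ('J F x)^T *m invmx (g x).

Lemma normal_partE x w : normal_part g G F x w = w - tcoord x w *m 'J F x.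
Proof. by []. Qed.

Lemma tcoordE x w Z : U x -> ip (g x) (tcoord x w) Z = ip (G (F x)) w (Z *m 'J F x).
Proof.
by move=> Ux; rewrite /ip /tcoord mulmxKV ?unitg// trmx_mul !mulmxA.
Qed.

Lemma normal_part_ortho x w Z : U x ->
  ip (G (F x)) (normal_part g G F x w) (Z *m 'J F x) = 0.
Proof. by move=> Ux; rewrite normal_partE ipBl ip_push// tcoordE// subrr. Qed.

Lemma normal_part_id x xi : U x -> normal_vector G F x xi ->
  normal_part g G F x xi = xi.
Proof.
move=> Ux nxi; rewrite normal_partE (_ : tcoord x xi = 0) ?mul0mx ?subr0//.
apply: (ip_inj (unitg Ux)) => Z; rewrite tcoordE// ip0l -derive_jacobian//.
by rewrite ipC// ?symG.
Qed.

Lemma ip_normal_part x w xi : U x -> normal_vector G F x xi ->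
  ip (G (F x)) (normal_part g G F x w) xi = ip (G (F x)) w xi.
Proof.
by move=> Ux nxi; rewrite normal_partE ipBl -derive_jacobian// nxi subr0.
Qed.

Lemma smooth_tcoord (W : 'rV[R]_n -> 'rV[R]_k) : smooth_mx U W -> smooth_mx U (fun y => tcoord y (W y)).
Proof.
move=> sW; apply: smooth_mx_mul => //; last exact: smooth_mx_inv.
apply: smooth_mx_mul => //; last exact/smooth_mx_tr/smooth_jacobian.
by apply: smooth_mx_mul => //; exact: (smooth_mx_comp oU sF dF FV sG).
Qed.

Lemma smooth_push (B : 'rV[R]_n -> 'rV[R]_n) : smooth_mx U B ->
  smooth_mx U (fun y => B y *m 'J F y).
Proof. by move=> sB; apply: smooth_mx_mul => //; exact: smooth_jacobian. Qed.

Lemma smooth_normal_part (W : 'rV[R]_n -> 'rV[R]_k) : smooth_mx U W ->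
  smooth_mx U (fun y => normal_part g G F y (W y)).
Proof.
move=> sW; apply: smooth_mx_sub => //; exact/smooth_push/smooth_tcoord.
Qed.

(** The second covariant derivative of F; its normal part is the second
    fundamental form. *)
Definition hess X Y : 'rV[R]_n -> 'rV[R]_k := nabla_along G F X (fun y => 'D_Y F y).

Lemma smooth_dF Y : smooth_mx U (fun y => 'D_Y F y).
Proof. exact: smooth_mx_derive. Qed.

Lemma smooth_hess X Y : smooth_mx U (hess X Y).
Proof. exact: (smooth_nabla_along mG lF X (smooth_dF Y)). Qed.

Lemma hessC X Y x : U x -> hess X Y x = hess Y X x.
Proof. exact: (torsion_free mG lF X Y). Qed.

(** Both sides are symmetric in X and Y and satisfy the same product rule for
    the induced metric; Koszul's argument shows that these two properties
    determine them. *)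
Lemma hess_christoffel X Y Z x : U x ->
  ip (G (F x)) (hess X Y x) (Z *m 'J F x) = ip (g x) (christoffel g x X Y) Z.
Proof.
move=> Ux.
have key (p q r a b c a' b' c' : R) : p = a + b -> q = a' + c -> r = b' + c' ->
    a = a' -> b = b' -> c = c' -> a = 2^-1 * (p + q - r).
  by move=> -> -> -> <- <- <-; field.
pose a X Y Z := ip (G (F x)) (hess X Y x) (Z *m 'J F x).
have aC A B C : a A B C = a B A C by rewrite /a hessC.
have compat A B C : ip ('D_A g x) B C = a A B C + a A C B.
  rewrite -(derive_ip_cst mg A B C Ux).
  have e : 'D_A (fun y => ip (g y) B C) x =
      'D_A (fun y => ip (G (F y)) ('D_B F y) ('D_C F y)) x.
    apply: near_eq_derive; apply: (open_near_eq oU Ux) => y Uy.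
    by rewrite !derive_jacobian// ip_push.
  apply: etrans e _.
  have h := metric_compatibility mG lF Ux
    (smooth_mx_derivable (v := A) (smooth_dF B) Ux)
    (smooth_mx_derivable (v := A) (smooth_dF C) Ux).
  apply: etrans h _; congr (_ + _); first by rewrite /a derive_jacobian.
  rewrite ipC; last exact: symG.
  by rewrite /a -derive_jacobian.
rewrite (christoffelE mg X Y Z Ux).
exact: key (compat X Y Z) (compat Y X Z) (compat Z X Y) (aC _ _ _) (aC _ _ _) (aC _ _ _).
Qed.

Lemma tcoord_hess X Y x : U x -> tcoord x (hess X Y x) = christoffel g x X Y.
Proof.
move=> Ux; apply: (ip_inj (unitg Ux)) => Z.
by rewrite tcoordE// hess_christoffel.
Qed.

Lemma sffE X Y x : U x ->
  sff g G F x X Y = hess X Y x - christoffel g x X Y *m 'J F x.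
Proof.
move=> Ux; rewrite -(tcoord_hess X Y Ux); exact: normal_partE.
Qed.

Lemma sffC X Y x : U x -> sff g G F x X Y = sff g G F x Y X.
Proof. move=> Ux; exact: (f_equal (normal_part g G F x) (hessC X Y Ux)). Qed.

Lemma sff_ortho X Y Z x : U x -> ip (G (F x)) (sff g G F x X Y) (Z *m 'J F x) = 0.
Proof. by move=> Ux; exact: normal_part_ortho. Qed.

Lemma smooth_sff X Y : smooth_mx U (fun y => sff g G F y X Y).
Proof. exact: (smooth_normal_part (smooth_hess X Y)). Qed.

(** Differentiate <E, 'D_Z F> = 0. *)
Lemma weingarten (E : 'rV[R]_n -> 'rV[R]_k) X Z x : U x -> smooth_mx U E ->
  (forall y Z, U y -> ip (G (F y)) (E y) (Z *m 'J F y) = 0) ->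
  ip (G (F x)) (nabla_along G F X E x) (Z *m 'J F x) =
  - ip (G (F x)) (E x) (sff g G F x X Z).
Proof.
move=> Ux sE oE.
have key (a b c : R) : 0 = a + b -> b = c -> a = - c by move=> ? <-; lra.
have h := metric_compatibility mG lF Ux
    (smooth_mx_derivable (v := X) sE Ux)
    (smooth_mx_derivable (v := X) (smooth_dF Z) Ux).
have e : 'D_X (fun y => ip (G (F y)) (E y) ('D_Z F y)) x = 0.
  have e0 : 'D_X (fun y => ip (G (F y)) (E y) ('D_Z F y)) x = 'D_X (fun=> 0 : R) x.
    apply: near_eq_derive; apply: (open_near_eq oU Ux) => y Uy.
    by rewrite derive_jacobian// oE.
  by apply: etrans e0 _; exact: derive_cst.
have := etrans (esym e) h; rewrite [X in ip _ _ X + _]derive_jacobian// => h0.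
apply: key h0 _; rewrite sffE// ipBr oE// subr0.
by [].
Qed.

(** The tangential part of the ambient connection is the intrinsic one: the
    two compatibilities with the metric, applied to <B, Z>, differ by
    hess_christoffel. *)
Lemma nabla_along_push (B : 'rV[R]_n -> 'rV[R]_n) X Z x : U x -> smooth_mx U B ->
  ip (G (F x)) (nabla_along G F X (fun y => B y *m 'J F y) x) (Z *m 'J F x) =
  ip (g x) (nabla g X B x) Z.
Proof.
move=> Ux sB.
have key (a b p q : R) : p + q = a + b -> q = b -> p = a by move=> h1 h2; lra.
have h := metric_compatibility mG lF Ux
    (smooth_mx_derivable (v := X) (smooth_push sB) Ux)
    (smooth_mx_derivable (v := X) (smooth_dF Z) Ux).
have h' := metric_compatibility mg lid Ux
    (smooth_mx_derivable (v := X) sB Ux)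
    (smooth_mx_derivable (v := X) (smooth_mx_cst U Z) Ux).
have e : 'D_X (fun y => ip (G (F y)) (B y *m 'J F y) ('D_Z F y)) x =
    'D_X (fun y => ip (g y) (B y) Z) x.
  apply: near_eq_derive; apply: (open_near_eq oU Ux) => y Uy.
  by rewrite derive_jacobian// ip_push.
have := etrans (esym h) (etrans e h'); rewrite -!nabla_id.
rewrite [X in ip _ _ X + _ = _ -> _]derive_jacobian// => h0.
apply: key h0 _; rewrite ipC; last exact: symG.
rewrite -/(hess X Z) hess_christoffel// ipC; last exact: symg.
by rewrite /nabla derive_cst add0r.
Qed.

Lemma smooth_christoffel X Y : smooth_mx U (fun y => christoffel g y X Y).
Proof.
apply: (@smooth_mx_ext _ _ _ _ _ (fun y => Y *m conn g y X)) => //.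
  by move=> y Uy; rewrite (christoffel_conn mg).
by apply: smooth_mx_mul => //; [exact: smooth_mx_cst|exact: smooth_conn].
Qed.

(** Split hess Y Z into the image of the intrinsic derivative of Z and the
    second fundamental form, and differentiate each part. *)
Lemma nabla_along_hess X Y Z W x : U x ->
  ip (G (F x)) (nabla_along G F X (hess Y Z) x) (W *m 'J F x) =
  ip (g x) (nabla g X (nabla g Y (cst Z)) x) W
  - ip (G (F x)) (sff g G F x Y Z) (sff g G F x X W).
Proof.
move=> Ux.
have key (a b p : R) : a - b = - p -> a = b - p by lra.
have eB : nabla g Y (cst Z) = fun y => christoffel g y Y Z.
  by apply/funext => y; rewrite /nabla derive_cst add0r.
have sB := smooth_christoffel Y Z.
apply: key; rewrite eB -(nabla_along_push X W Ux sB) -ipBl.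
rewrite -(nabla_alongB mG lF Ux); last 2 first.
- exact: (smooth_mx_derivable (smooth_hess Y Z) Ux).
- exact: (smooth_mx_derivable (smooth_push sB) Ux).
rewrite -(weingarten X W Ux (smooth_sff Y Z)); last by move=> *; exact: sff_ortho.
exact: (f_equal (fun w => ip (G (F x)) w (W *m 'J F x))
  (nabla_along_near G lF X Ux (fun y Uy => esym (sffE Y Z Uy)))).
Qed.

Lemma Riem_push (E : 'rV[R]_n -> 'rV[R]_k) X Y (W w : 'rV[R]_k) x : U x ->
  smooth_mx U E -> E x = w ->
  Riem G (F x) (X *m 'J F x) (Y *m 'J F x) w W =
  ip (G (F x)) (nabla_along G F X (nabla_along G F Y E) x) W
  - ip (G (F x)) (nabla_along G F Y (nabla_along G F X E) x) W.
Proof.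
move=> Ux sE Ew; have h := curvature_along mG lF X Y Ux sE.
have c := etrans (f_equal3 (curv G (F x)) (esym (derive_jacobian X Ux))
  (esym (derive_jacobian Y Ux)) (esym Ew)) (esym h).
exact: etrans (f_equal (fun u => ip (G (F x)) u W) c) (ipBl _ _ _ _).
Qed.

Theorem gauss_equation X Y Z W x : U x ->
  Riem g x X Y Z W =
  Riem G (F x) (X *m 'J F x) (Y *m 'J F x) (Z *m 'J F x) (W *m 'J F x)
  + ip (G (F x)) (sff g G F x Y Z) (sff g G F x X W)
  - ip (G (F x)) (sff g G F x X Z) (sff g G F x Y W).
Proof.
move=> Ux.
have key (r s p q a b c d : R) : p = a - c -> q = b - d -> r = a - b -> s = p - q ->
   r = s + c - d by move=> -> -> -> ->; ring.
apply: key (nabla_along_hess X Y Z W Ux) (nabla_along_hess Y X Z W Ux) _ _.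
  by rewrite /Riem /curv ipBl.
exact: (Riem_push X Y (W *m 'J F x) Ux (smooth_dF Z) (derive_jacobian Z Ux)).
Qed.

Lemma shape_tcoord X xi x : U x -> normal_vector G F x xi ->
  shape_operator g G F x xi X =
  - tcoord x (nabla_along G F X (fun y => normal_part g G F y xi) x).
Proof.
move=> Ux nxi; apply: (ip_inj_delta (unitg Ux)) => j.
rewrite ipNl tcoordE// (weingarten X _ Ux (smooth_normal_part (smooth_mx_cst U xi))).
  rewrite opprK normal_part_id// ip_delta /shape_operator mulmxKV ?unitg// mxE.
  by rewrite ipC// symG.
by move=> y Z Uy; exact: normal_part_ortho.
Qed.

Lemma shapeE X Z xi x : U x -> normal_vector G F x xi ->
  ip (g x) (shape_operator g G F x xi X) Z = ip (G (F x)) (sff g G F x X Z) xi.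
Proof.
move=> Ux nxi; rewrite shape_tcoord// ipNl tcoordE//.
rewrite (weingarten X _ Ux (smooth_normal_part (smooth_mx_cst U xi))).
  by rewrite opprK normal_part_id// ipC// symG.
by move=> y W Uy; exact: normal_part_ortho.
Qed.

(** The normal derivative drops the tangential part of the derivative of S;
    the derivative of that part pairs with eta through the shape operators, by
    differentiating its orthogonality to a normal extension of eta. *)
Lemma nabla_perp_perp X Y xi eta x : U x ->
  normal_vector G F x xi -> normal_vector G F x eta ->
  let S y := normal_part g G F y xi in
  ip (G (F x)) (nabla_perp g G F X (nabla_perp g G F Y S) x) eta =
  ip (G (F x)) (nabla_along G F X (nabla_along G F Y S) x) eta
  + ip (g x) (shape_operator g G F x xi Y) (shape_operator g G F x eta X).
Proof.
move=> Ux nxi neta S.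
have key (a t p q : R) : 0 = t + p -> p = q -> a - t = a + q by move=> h1 h2; lra.
(* A normal extension of eta, as S is one of xi. *)
pose E y := normal_part g G F y eta.
have sS : smooth_mx U S by exact: smooth_normal_part (smooth_mx_cst U xi).
have sE : smooth_mx U E by exact: smooth_normal_part (smooth_mx_cst U eta).
have sN : smooth_mx U (nabla_along G F Y S) by exact: (smooth_nabla_along mG lF Y sS).
pose T y := tcoord y (nabla_along G F Y S y) *m 'J F y.
have sT : smooth_mx U T by exact/smooth_push/smooth_tcoord.
rewrite {1}/nabla_perp ip_normal_part//.
have -> : nabla_perp g G F Y S = fun y => nabla_along G F Y S y - T y by [].
rewrite (nabla_alongB mG lF Ux); last 2 first.
- exact: smooth_mx_derivable sN Ux.
- exact: smooth_mx_derivable sT Ux.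
rewrite ipBl.
have h := metric_compatibility mG lF Ux
    (smooth_mx_derivable (v := X) sT Ux) (smooth_mx_derivable (v := X) sE Ux).
have e : 'D_X (fun y => ip (G (F y)) (T y) (E y)) x = 0.
  have e0 : 'D_X (fun y => ip (G (F y)) (T y) (E y)) x = 'D_X (fun=> 0 : R) x.
    apply: near_eq_derive; apply: (open_near_eq oU Ux) => y Uy.
    by rewrite ipC ?symG// /T normal_part_ortho.
  by apply: etrans e0 _; exact: derive_cst.
have Ex : E x = eta by exact: normal_part_id.
have := etrans (esym e) h; rewrite Ex; move/key; apply.
rewrite ipC ?symG// /T -tcoordE// ipC ?symg// !shape_tcoord// ipNl ipNr opprK.
by [].
Qed.

Theorem ricci_equation X Y xi eta x : U x ->
  normal_vector G F x xi -> normal_vector G F x eta ->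
  ip (G (F x)) (normal_curv g G F x X Y xi) eta =
  Riem G (F x) (X *m 'J F x) (Y *m 'J F x) xi eta
  + ip (g x) (shape_operator g G F x xi Y) (shape_operator g G F x eta X)
  - ip (g x) (shape_operator g G F x xi X) (shape_operator g G F x eta Y).
Proof.
move=> Ux nxi neta.
have key (r s a b c d p q : R) : r = a - b -> a = p + c -> b = q + d -> s = p - q ->
   r = s + c - d by move=> -> -> -> ->; ring.
apply: key (ipBl _ _ _ _) (nabla_perp_perp X Y Ux nxi neta)
  (nabla_perp_perp Y X Ux nxi neta) _.
apply: Riem_push => //; last exact: normal_part_id.
exact: smooth_normal_part (smooth_mx_cst U xi).
Qed.

End Submanifold.

(** * Orthonormal frames and the second fundamental form *)
Section Frames.
Variables (R : realType) (k : nat) (g : 'M[R]_k).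
Hypothesis gT : g^T = g.
Implicit Types (e : 'I_k -> 'rV[R]_k) (u v : 'rV[R]_k).

Lemma frame_expand e u : orthonormal_frame g e -> u = \sum_i ip g u (e i) *: e i.
Proof.
move=> oe; pose Q := \matrix_i e i.
have ipE w j : (w *m g *m Q^T) 0 j = ip g w (e j).
  rewrite /ip !mxE; apply: eq_bigr => a _; rewrite !mxE.
  by congr (_ * _).
have QQ : Q *m (g *m Q^T) = 1%:M.
  apply/matrixP => i j; rewrite mulmxA [RHS]mxE -oe -ipE.
  have -> : e i = row i Q by rewrite rowK.
  by rewrite -!row_mul [RHS]mxE.
rewrite -[LHS]mulmx1 -(mulmx1C QQ) !mulmxA mulmx_sum_row.
by apply: eq_bigr => i _; rewrite ipE rowK.
Qed.

Lemma parseval e u v : orthonormal_frame g e ->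
  ip g u v = \sum_i ip g u (e i) * ip g v (e i).
Proof.
move=> oe; rewrite [in LHS](frame_expand u oe) ip_suml; apply: eq_bigr => i _.
by rewrite ipZl (ipC (e i) v gT).
Qed.

Lemma frame_change e (e' : 'I_k -> 'rV[R]_k) :
  orthonormal_frame g e -> orthonormal_frame g e' ->
  exists2 P : 'M[R]_k, P *m P^T = 1%:M &
    forall i, e' i = \sum_j P i j *: e j.
Proof.
move=> oe oe'; exists (\matrix_(i, j) ip g (e' i) (e j)).
  apply/matrixP => i j; rewrite !mxE -[RHS]oe' (parseval _ _ oe).
  by apply: eq_bigr => a _; rewrite !mxE.
move=> i; rewrite [LHS](frame_expand _ oe); apply: eq_bigr => j _.
by rewrite mxE.
Qed.

Lemma rotated_frame p (e : 'I_p -> 'rV[R]_k) (P : 'M[R]_p) :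
  orthonormal_frame g e -> P *m P^T = 1%:M ->
  orthonormal_frame g (fun i => \sum_j P i j *: e j).
Proof.
move=> oe PP i j; have := congr1 (fun M : 'M[R]_p => M i j) PP.
rewrite [in RHS]mxE => <-; rewrite ip_suml [RHS]mxE; apply: eq_bigr => a _.
rewrite ipZl ip_sumr (bigD1 a)//= big1 ?addr0 => [|b ba].
  by rewrite ipZr oe eqxx mulr1 mxE.
by rewrite ipZr oe eq_sym (negbTE ba) mulr0.
Qed.

End Frames.

Section Pointwise.
Variables (R : realType) (n m : nat).
Variables (U : set 'rV[R]_n) (V : set 'rV[R]_(n + m)).
Variables (g : 'rV[R]_n -> 'M[R]_n) (G : 'rV[R]_(n + m) -> 'M[R]_(n + m)).
Variable F : 'rV[R]_n -> 'rV[R]_(n + m).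
Hypotheses (mg : metric_on U g) (mG : metric_on V G) (lF : local_map U V F).
Hypothesis gE : forall x, U x -> g x = 'J F x *m G (F x) *m ('J F x)^T.
Variable x : 'rV[R]_n.
Hypothesis Ux : U x.

Let Vx : V (F x). Proof. by case: lF => _ _ _; apply. Qed.
Let symG : (G (F x))^T = G (F x).
Proof. by case: mG => _ _ h _; exact: h. Qed.
Let symg : (g x)^T = g x.
Proof. by case: mg => _ _ h _; exact: h. Qed.

Notation h := (sff g G F x).
Notation shape := (shape_operator g G F x).

Definition sffmx (e : 'I_n -> 'rV[R]_n) (xi : 'I_m -> 'rV[R]_(n + m)) r : 'M[R]_n :=
  \matrix_(i, j) ip (G (F x)) (h (e i) (e j)) (xi r).

Lemma sff_ipC X Y w : ip (G (F x)) (h X Y) w = ip (G (F x)) (h Y X) w.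
Proof. by rewrite (sffC g mG lF X Y Ux). Qed.

Lemma sffmx_sym e xi r : (sffmx e xi r)^T = sffmx e xi r.
Proof.
by apply/matrixP => i j; rewrite !mxE; exact: sff_ipC.
Qed.

Lemma normal_push xi b : normal_vector G F x xi ->
  ip (G (F x)) (b *m 'J F x) xi = 0.
Proof. by move=> nxi; rewrite -(derive_jacobian lF)// nxi. Qed.

Section AmbientFrame.
Variables (e : 'I_n -> 'rV[R]_n) (xi : 'I_m -> 'rV[R]_(n + m)).
Hypotheses (oe : orthonormal_frame (g x) e).
Hypothesis oxi : normal_orthonormal_frame G F x xi.

(** Completes the normal frame by the image of the tangent frame, which makes
    n + m vectors in a space of that dimension. *)
Definition ambient_frame (a : 'I_(n + m)) : 'rV[R]_(n + m) :=
  match fintype.split a with inl i => e i *m 'J F x | inr r => xi r end.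

Lemma ambient_frame_orthonormal : orthonormal_frame (G (F x)) ambient_frame.
Proof.
have [oxi1 nxi] := oxi; move=> a b; rewrite /ambient_frame.
rewrite -(inj_eq (can_inj (@fintype.splitK _ _))).
case: (fintype.split a) => i; case: (fintype.split b) => j.
- by rewrite (ip_push gE)// oe.
- by rewrite normal_push.
- by rewrite ipC// normal_push.
- by rewrite oxi1.
Qed.

Lemma ambient_sum (T : nmodType) (f : 'rV[R]_(n + m) -> T) :
  \sum_a f (ambient_frame a) =
  \sum_i f (e i *m 'J F x) + \sum_r f (xi r).
Proof.
rewrite big_split_ord/=; congr (_ + _); apply: eq_bigr => i _; congr f;
  rewrite /ambient_frame.
  by rewrite (fintype.unsplitK (inl i)).
by rewrite (fintype.unsplitK (inr i)).
Qed.

Definition tangent_free w := forall b, ip (G (F x)) w (b *m 'J F x) = 0.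

Lemma sff_tangent_free X Y : tangent_free (h X Y).
Proof. by move=> b; exact: (sff_ortho mg gE X Y b Ux). Qed.

Lemma normal_tangent_free eta : normal_vector G F x eta -> tangent_free eta.
Proof. by move=> neta b; rewrite ipC// normal_push. Qed.

Lemma normal_parseval w w' : tangent_free w ->
  ip (G (F x)) w w' = \sum_r ip (G (F x)) w (xi r) * ip (G (F x)) w' (xi r).
Proof.
move=> tw; rewrite (parseval symG w w' ambient_frame_orthonormal).
rewrite (ambient_sum (fun u => ip (G (F x)) w u * ip (G (F x)) w' u)).
by rewrite big1 ?add0r// => i _; rewrite tw mul0r.
Qed.

Lemma normal_expand w : tangent_free w ->
  w = \sum_r ip (G (F x)) w (xi r) *: xi r.
Proof.
move=> tw; rewrite [LHS](frame_expand w ambient_frame_orthonormal).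
rewrite (ambient_sum (fun u => ip (G (F x)) w u *: u)).
by rewrite big1 ?add0r// => i _; rewrite tw scale0r.
Qed.

Variable c : R.
Hypothesis posG : pos_def (G (F x)).
Hypothesis hc : forall u v, row_free (col_mx u v) ->
  sectional_curvature G (F x) u v = c.

Let B := sffmx e xi.

Lemma gauss_frame i j : i != j ->
  Riem (g) x (e i) (e j) (e j) (e i) =
  c + \sum_r (B r j j * B r i i - B r i j * B r j i).
Proof.
move=> ij; have key (a r s p q : R) : r = s + p - q -> s = a ->
    r = a + (p - q) by move=> -> ->; rewrite addrA.
have hh a b a' b' : ip (G (F x)) (h (e a) (e b)) (h (e a') (e b')) =
    \sum_r B r a b * B r a' b'.
  apply: etrans (normal_parseval _ (sff_tangent_free (e a) (e b))) _.
  by apply: eq_bigr => r _; rewrite !mxE.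
rewrite sumrB -!hh.
apply: key (gauss_equation mg mG lF gE (e i) (e j) (e j) (e i) Ux) _.
rewrite (Riem_constant_curvature mG Vx posG hc).
rewrite !(ip_push gE _ _ Ux) !oe !eqxx (negbTE ij).
by rewrite mul0r subr0 !mulr1.
Qed.

Lemma ricci_frame i j r s :
  ip (G (F x)) (normal_curv g G F x (e i) (e j) (xi r)) (xi s) =
  bracket (B s) (B r) i j.
Proof.
have [oxi1 nxi] := oxi.
have key (t u p q b1 b2 : R) : t = u + p - q -> u = 0 -> p = b1 -> q = b2 ->
    t = b1 - b2 by move=> -> -> -> ->; rewrite add0r.
have BT r' a b : B r' a b = B r' b a.
  by have /matrixP/(_ b a) := sffmx_sym e xi r'; rewrite [LHS]mxE.
have shapeB r' a b : ip (g x) (shape (xi r') (e a)) (e b) = B r' a b.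
  by apply: etrans (shapeE mg mG lF gE (e a) (e b) Ux (nxi r')) _; rewrite mxE.
have SS a b r' s' : ip (g x) (shape (xi r') (e a)) (shape (xi s') (e b)) =
    (B r' *m B s') a b.
  apply: etrans (parseval symg _ _ oe) _; rewrite mxE; apply: eq_bigr => d _.
  by rewrite !shapeB (BT s' b).
have -> : bracket (B s) (B r) i j = (B s *m B r) i j - (B r *m B s) i j.
  by rewrite /bracket [LHS]mxE [X in _ + X]mxE.
apply: key (ricci_equation mg mG lF gE (e i) (e j) Ux (nxi r) (nxi s)) _ _ (SS _ _ _ _).
  by rewrite (Riem_constant_curvature mG Vx posG hc) !normal_push// !mul0r subrr mulr0.
apply: etrans (ipC _ _ symg) _; exact: SS.
Qed.

Lemma mean_curvature_frame : vnorm (G (F x)) (mean_curvature g G F x e) ^+ 2 =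
  \sum_r (\tr (B r) / n%:R) ^+ 2.
Proof.
set H := mean_curvature _ _ _ _ _.
have HE w : ip (G (F x)) H w = n%:R^-1 * \sum_i ip (G (F x)) (h (e i) (e i)) w.
  by rewrite /H /mean_curvature ipZl ip_suml.
have tH : tangent_free H.
  by move=> b; rewrite HE big1 ?mulr0// => i _; exact: sff_tangent_free.
have HH : ip (G (F x)) H H = \sum_r (\tr (B r) / n%:R) ^+ 2.
  rewrite normal_parseval//; apply: eq_bigr => r _; rewrite HE mulrC -expr2.
  congr (_ ^+ 2); rewrite mulrC; congr (_ * _); apply: eq_bigr => i _.
  by rewrite mxE.
by rewrite /vnorm sqr_sqrtr HH// sumr_ge0// => r _; exact: sqr_ge0.
Qed.

Hypothesis n_ge2 : (2 <= n)%N.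

(** The inequality and its equality case for the immersion are read off this
    formula. *)
Lemma rho_defect :
  (vnorm (G (F x)) (mean_curvature g G F x e) ^+ 2 + c)
  - (rho g x e + rho_perp g G F x e xi) =
  (n%:R * (n%:R - 1))^-1 *
    (energy (fun r => tracefree (B r))
     - Num.sqrt (brackets (fun r => tracefree (B r)))).
Proof.
rewrite -(curvature_defect n_ge2 c (sffmx_sym e xi)) mean_curvature_frame.
congr (_ - (_ + _)).
  rewrite /rho; congr (_ * _); apply: eq_bigr => i _; apply: eq_bigr => j ij.
  by rewrite gauss_frame// neq_ltn ij.
rewrite /rho_perp; congr (_ * Num.sqrt _); apply: eq_bigr => i _.
apply: eq_bigr => j ij; apply: eq_bigr => r _; apply: eq_bigr => s rs.
by rewrite ricci_frame.
Qed.

End AmbientFrame.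

Lemma ip_sff_suml p (a : 'I_p -> R) (v : 'I_p -> 'rV[R]_n) Y eta :
  normal_vector G F x eta ->
  ip (G (F x)) (h (\sum_i a i *: v i) Y) eta =
  \sum_i a i * ip (G (F x)) (h (v i) Y) eta.
Proof.
move=> neta; have sffC' X : ip (G (F x)) (h X Y) eta = ip (G (F x)) (h Y X) eta.
  exact: sff_ipC.
have hX X : ip (G (F x)) (h X Y) eta = ip (g x) (shape eta Y) X.
  exact: etrans (sffC' X) (esym (shapeE mg mG lF gE Y X Ux neta)).
apply: etrans (hX _) _; apply: etrans (ip_sumr _ _ _ _) _.
by apply: eq_bigr => i _; apply: etrans (ipZr _ _ _ _) _; rewrite hX.
Qed.

Lemma normal_sum p (a : 'I_p -> R) (xi : 'I_p -> 'rV[R]_(n + m)) :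
  (forall r, normal_vector G F x (xi r)) ->
  normal_vector G F x (\sum_r a r *: xi r).
Proof.
move=> nxi X; rewrite ip_sumr big1// => r _; by rewrite ipZr nxi mulr0.
Qed.

(** Changing the tangent frame conjugates the matrices of the second fundamental
    form; changing the normal frame mixes them. *)
Lemma sffmx_rotate e xi (P : 'M[R]_n) (Q : 'M[R]_m) r :
  (forall r, normal_vector G F x (xi r)) ->
  sffmx (fun i => \sum_j P i j *: e j) (fun r => \sum_s Q r s *: xi s) r =
  P *m mix Q (sffmx e xi) r *m P^T.
Proof.
move=> nxi; apply/matrixP => i j; rewrite mxE.
have nQ : normal_vector G F x (\sum_s Q r s *: xi s) by exact: normal_sum.
rewrite ip_sff_suml//.
transitivity (\sum_a P i a * \sum_b P j b * mix Q (sffmx e xi) r a b).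
  apply: eq_bigr => a _; congr (_ * _).
  apply: etrans (sff_ipC (e a) _ _) _.
  apply: etrans (ip_sff_suml _ _ _ nQ) _; apply: eq_bigr => b _; congr (_ * _).
  apply: etrans (sff_ipC (e b) _ _) _.
  rewrite mixE; apply: etrans (ip_sumr _ _ _ _) _; apply: eq_bigr => s _.
  by apply: etrans (ipZr _ _ _ _) _; rewrite mxE.
rewrite mxE; under [RHS]eq_bigr => b _ do rewrite mxE mulr_suml.
rewrite [RHS]exchange_big/=; apply: eq_bigr => a _; rewrite mulr_sumr.
by apply: eq_bigr => b _; rewrite mxE; ring.
Qed.

Lemma matrix_in_frameP e xi r (A : 'M[R]_n) :
  orthonormal_frame (g x) e -> normal_vector G F x (xi r) ->
  matrix_in_frame e (shape (xi r)) A <-> A = sffmx e xi r.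
Proof.
move=> oe nxi.
have BE i j : ip (g x) (shape (xi r) (e j)) (e i) = sffmx e xi r i j.
  apply: etrans (shapeE mg mG lF gE (e j) (e i) Ux nxi) _; rewrite mxE.
  exact: sff_ipC.
split=> [hA|-> j].
  apply/matrixP => i j; rewrite -BE hA ip_suml (bigD1 i)//= big1 ?addr0.
    by rewrite ipZl oe eqxx mulr1.
  by move=> a ai; rewrite ipZl oe (negbTE ai) mulr0.
by rewrite [LHS](frame_expand _ oe); apply: eq_bigr => i _; rewrite BE.
Qed.

Lemma normal_frame_change (xi xi' : 'I_m -> 'rV[R]_(n + m))
  (e : 'I_n -> 'rV[R]_n) :
  orthonormal_frame (g x) e -> normal_orthonormal_frame G F x xi ->
  normal_orthonormal_frame G F x xi' ->
  exists2 Q : 'M[R]_m, Q *m Q^T = 1%:M &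
    forall r, xi' r = \sum_s Q r s *: xi s.
Proof.
move=> oe oxi [oxi' nxi']; exists (\matrix_(r, s) ip (G (F x)) (xi' r) (xi s)).
  apply/matrixP => r s; rewrite !mxE -[RHS]oxi'.
  rewrite (normal_parseval oe oxi _ (normal_tangent_free (nxi' r))).
  by apply: eq_bigr => a _; rewrite !mxE.
move=> r; rewrite [LHS](normal_expand oe oxi (normal_tangent_free (nxi' r))).
by apply: eq_bigr => s _; rewrite mxE.
Qed.

End Pointwise.

(** * The equality case and the main theorem *)
Lemma extremal_mx_model (R : realType) n (i j : 'I_n) mu (l : R) :
  nat_of_ord i = 0%N -> nat_of_ord j = 1%N ->
  [/\ extremal_mx n 0 mu l = mu *: (delta_mx i j + delta_mx j i) + l%:M,
      extremal_mx n 1 mu l = mu *: (delta_mx i i - delta_mx j j) + l%:M &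
      forall r, (2 <= r)%N -> extremal_mx n r mu l = l%:M].
Proof.
move=> i0 j1.
have eqi (x : 'I_n) : (x == i) = (nat_of_ord x == 0%N) by rewrite -val_eqE/= i0.
have eqj (x : 'I_n) : (x == j) = (nat_of_ord x == 1%N) by rewrite -val_eqE/= j1.
have diag (x y : 'I_n) : l *+ (x == y) = l * (x == y)%:R by rewrite mulr_natr.
split=> [||r r2]; apply/matrixP => x y; rewrite !mxE ?eqi ?eqj ?diag.
- rewrite addrC; congr (_ + _).
  by case: (nat_of_ord x) => [|[|?]]; case: (nat_of_ord y) => [|[|?]] /=;
    rewrite ?addr0 ?add0r ?mulr1 ?mulr0.
- rewrite addrC; congr (_ + _).
  by case: (nat_of_ord x) => [|[|?]]; case: (nat_of_ord y) => [|[|?]] /=;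
    rewrite ?subrr ?subr0 ?sub0r ?mulr1 ?mulrN1 ?mulr0.
- by case: r r2 => [|[|r]]//= _; rewrite addr0.
Qed.

Section Equality.
Variables (R : realType) (n m : nat).
Hypotheses (n2 : (2 <= n)%N) (m2 : (2 <= m)%N).
Implicit Types (B : 'I_m -> 'M[R]_n).

Let i0 : 'I_n := Ordinal (ltnW n2).
Let i1 : 'I_n := Ordinal n2.
Let r0 : 'I_m := Ordinal (ltnW m2).
Let r1 : 'I_m := Ordinal m2.

Let ge2 (r : 'I_m) : r != r0 -> r != r1 -> (2 <= r)%N.
Proof. by rewrite -!val_eqE /=; case: (nat_of_ord r) => [|[|]]. Qed.

Lemma tracefree_split (A : 'M[R]_n) : A = tracefree A + (\tr A / n%:R)%:M.
Proof. by rewrite /tracefree subrK. Qed.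

(** From left to right, lambda r restores the trace of the r-th matrix; from
    right to left, taking traceless parts removes it. *)
Lemma equality_extremal B : (forall r, (B r)^T = B r) ->
  (brackets (fun r => tracefree (B r)) = energy (fun r => tracefree (B r)) ^+ 2 <->
   exists (P : 'M[R]_n) (Q : 'M[R]_m) (mu : R) (lambda : 'I_m -> R),
     [/\ P *m P^T = 1%:M, Q *m Q^T = 1%:M &
         forall r, P *m mix Q B r *m P^T = extremal_mx n r mu (lambda r)]).
Proof.
move=> sB; have r10 : r1 != r0 by []. have i01 : i0 != i1 by [].
have ext mu l := @extremal_mx_model R n i0 i1 mu l erefl erefl.
split=> [e|[P [Q [mu [lambda [PP QQ hB]]]]]].
  have [P [Q [mu [PP QQ h1 h0 h2]]]] :=
    ddvv_equality r10 i01 (tracefree_sym sB) e.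
  exists P, Q, mu, (fun r => \tr (mix Q B r) / n%:R); split=> // r.
  set l := \tr _ / _; have [e0 e1 e2] := ext mu l.
  have -> : P *m mix Q B r *m P^T =
      P *m mix Q (fun r => tracefree (B r)) r *m P^T + l%:M.
    rewrite mix_tracefree {1}(tracefree_split (mix Q B r)) mulmxDr mulmxDl.
    by rewrite mul_mx_scalar -scalemxAl PP scalemx1.
  have [->|rr0] := eqVneq r r0; first by rewrite h0 -e0.
  have [->|rr1] := eqVneq r r1; first by rewrite h1 -e1.
  by rewrite h2// add0r e2// ge2.
rewrite -(brackets_mix _ QQ) -(energy_mix _ QQ) -(brackets_conj _ PP) -(energy_conj _ PP).
have C r : P *m mix Q (fun r => tracefree (B r)) r *m P^T =
    tracefree (extremal_mx n r mu (lambda r)).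
  by rewrite mix_tracefree -tracefree_conj// hB.
have tf (A : 'M[R]_n) l : \tr A = 0 -> tracefree (A + l%:M) = A.
  move=> A0; rewrite /tracefree raddfD/= A0 add0r mxtrace_scalar.
  rewrite -[l *+ n]mulr_natr mulfK ?addrK// pnatr_eq0 -lt0n; exact: ltnW.
have tr_delta (i j : 'I_n) : \tr (delta_mx i j : 'M[R]_n) = (i == j)%:R.
  rewrite /mxtrace (bigD1 i)//= mxE eqxx /= big1 ?addr0// => x xi.
  by rewrite mxE (negbTE xi).
apply: (model_equality (a := r1) (b := r0) (i := i0) (j := i1) (mu := mu)) => //.
- rewrite C; have [_ -> _] := ext mu (lambda r1); apply: tf.
  by rewrite linearZ/= raddfB/= !tr_delta !eqxx subrr mulr0.
- rewrite C; have [-> _ _] := ext mu (lambda r0); apply: tf.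
  by rewrite linearZ/= raddfD/= !tr_delta /= addr0 mulr0.
- move=> r rr1 rr0; rewrite C; have [_ _ ->] := ext mu (lambda r); last exact: ge2.
  by rewrite -[X in tracefree X]add0r; apply: tf; exact: mxtrace0.
Qed.

End Equality.

Section Charts.
Variables (R : realType).

Lemma iter_diff_subset n (U U' : set 'rV[R]_n) k f : U `<=` U' -> iter_diff k U' f -> iter_diff k U f.
Proof.
move=> UU'; elim: k f => //= k IHk f [df Df]; split=> [x /UU'|v]; first exact: df.
exact: IHk.
Qed.

Lemma smooth_mx_subset n (U U' : set 'rV[R]_n) p q (A : 'rV[R]_n -> 'M[R]_(p, q)) :
  U `<=` U' -> smooth_mx U' A -> smooth_mx U A.
Proof. by move=> UU' sA i j k; apply: iter_diff_subset (sA i j k). Qed.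

(** Locally the set is the preimage, under the inverse of the chart, of an open
    subset of M. *)
Lemma open_in_charts_dom n k (M : riemannian R n) (N : riemannian R k)
  (f : M -> N) (phi : chart R n M) (psi : chart R k N) :
  continuous f -> open (in_charts_dom f phi psi).
Proof.
move=> cf; rewrite openE => y [q [qphi qpsi] <-]; rewrite /interior.
have oW : open (chart_dom phi `&` f @^-1` chart_dom psi).
  apply: openI; first exact: chart_dom_open.
  by apply: open_comp => [z _|]; [exact: cf|exact: chart_dom_open].
have Cy : (chart_map phi @` chart_dom phi) (chart_map phi q) by exists q.
have invq : chart_inv phi (chart_map phi q) = q.
  by rewrite chart_mapK// inE.
have c := @chart_inv_continuous _ _ _ phi (chart_map phi q) (mem_set Cy).
have n1 : nbhs (chart_inv phi (chart_map phi q))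
    (chart_dom phi `&` f @^-1` chart_dom psi).
  by apply: open_nbhs_nbhs; split=> //; rewrite invq.
have n2 : nbhs (chart_map phi q) (chart_map phi @` chart_dom phi).
  by apply: open_nbhs_nbhs; split=> //; exact: chart_codom_open.
have n3 := c _ n1.
apply: filterS (filterI n2 n3) => z [[q' q'phi <-]] /=.
rewrite chart_mapK ?inE// => -[_ q'psi].
by exists q'.
Qed.

Lemma riemannian_metric_on n (N : riemannian R n) (psi : chart R n N)
  (U : set 'rV[R]_n) : atlas psi -> open U ->
  U `<=` chart_map psi @` chart_dom psi -> metric_on U (metric psi).
Proof.
move=> apsi oU UC; split=> //.
- apply: smooth_mx_subset UC _; apply: smooth_on_mx.
    exact: chart_codom_open.
  exact: metric_smooth.
- by move=> y /UC Cy; exact: Defs.metric_sym Cy.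
- by move=> y /UC Cy; apply: pos_def_unit; exact: metric_pos_def Cy.
Qed.

End Charts.

Theorem corollary1p2 (R : realType) (n m : nat)
    (M : riemannian R n) (N : riemannian R (n + m)) (c : R) (f : M -> N)
    (hn : (2 <= n)%N) (hN : constant_curvature N c)
    (hf : isometric_immersion f)
    (p : M) (phi : chart R n M) (psi : chart R (n + m) N)
    (hphi : atlas phi) (hp : chart_dom phi p)
    (hpsi : atlas psi) (hfp : chart_dom psi (f p)) :
  let g := metric phi in
  let G := metric psi in
  let F := in_charts f phi psi in
  let x := chart_map phi p in
  forall (e : 'I_n -> 'rV[R]_n) (xi : 'I_m -> 'rV[R]_(n + m)),
  orthonormal_frame (g x) e -> normal_orthonormal_frame G F x xi ->
  let H := mean_curvature g G F x e in
  rho g x e + rho_perp g G F x e xi <= vnorm (G (F x)) H ^+ 2 + c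
  /\
  ((2 <= m)%N ->
   (rho g x e + rho_perp g G F x e xi = vnorm (G (F x)) H ^+ 2 + c
    <->
    exists (e' : 'I_n -> 'rV[R]_n) (xi' : 'I_m -> 'rV[R]_(n + m))
           (mu : R) (lambda : 'I_m -> R),
      [/\ orthonormal_frame (g x) e',
          normal_orthonormal_frame G F x xi' &
          forall r : 'I_m,
            matrix_in_frame e' (shape_operator g G F x (xi' r))
              (extremal_mx n r mu (lambda r))])).
Proof.
move=> g G F x e xi oe oxi H.
have [[cf sf] iso] := hf.
pose U := in_charts_dom f phi psi.
pose V := chart_map psi @` chart_dom psi.
have oU : open U by exact: open_in_charts_dom.
have UC : U `<=` chart_map phi @` chart_dom phi.
  by move=> y [q [qphi _] <-]; exists q.
have Ux : U x by exists p.
have FV y : U y -> V (F y).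
  move=> [q [qphi qpsi] <-]; exists (f q) => //.
  by rewrite /F /in_charts /= chart_mapK// inE.
have mg : metric_on U g by exact: riemannian_metric_on.
have mG : metric_on V G.
  by apply: riemannian_metric_on => //; exact: chart_codom_open.
have lF : local_map U V F.
  have sF := sf phi psi hphi hpsi; split=> //; first exact: smooth_on_mx.
  by move=> y Uy; exact: smooth_on_differentiable sF Uy.
have gE y : U y -> g y = 'J F y *m G (F y) *m ('J F y)^T.
  by move=> Uy; have [_] := iso phi psi y hphi hpsi Uy.
have VFx := FV x Ux.
have posG : pos_def (G (F x)) by exact: metric_pos_def hpsi VFx.
have hc u v : row_free (col_mx u v) -> sectional_curvature G (F x) u v = c.
  exact: hN hpsi VFx u v.
have defect := rho_defect mg mG lF gE Ux oe oxi posG hc hn.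
pose B := sffmx g G F x e xi.
have sB r : (B r)^T = B r by exact: (sffmx_sym g mG lF Ux).
have nn_gt0 : 0 < n%:R * (n%:R - 1) :> R.
  have n1 : 1 < n%:R :> R by rewrite ltr1n.
  by rewrite mulr_gt0 ?subr_gt0// (lt_trans ltr01).
split.
  rewrite -subr_ge0 defect mulr_ge0 ?invr_ge0 ?(ltW nn_gt0)//.
  exact/defect_ge0/tracefree_sym.
move=> m2; apply: (@iff_trans _ (brackets (fun r => tracefree (B r)) =
   energy (fun r => tracefree (B r)) ^+ 2)).
  rewrite -defect_eq0; split=> [eq|eq].
    move: defect; rewrite eq subrr => /esym/eqP.
    by rewrite mulf_eq0 invr_eq0 gt_eqF//= => /eqP.
  by apply/esym/eqP; rewrite -subr_eq0 defect eq mulr0.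
rewrite (equality_extremal hn m2 sB).
have [oxi1 nxi] := oxi.
split=> [[P [Q [mu [lambda [PP QQ hB]]]]]|[e' [xi' [mu [lambda [oe' oxi' hA]]]]]].
  have nQ r : normal_vector G F x (\sum_s Q r s *: xi s) by exact: normal_sum.
  have oe' := rotated_frame oe PP.
  exists (fun i => \sum_j P i j *: e j), (fun r => \sum_s Q r s *: xi s), mu, lambda.
  split=> //; first by split=> //; exact: rotated_frame.
  move=> r; apply/(matrix_in_frameP (xi := fun r => \sum_s Q r s *: xi s) (r := r)
    mg mG lF gE Ux _ oe' (nQ r)).
  by rewrite (sffmx_rotate mg mG lF gE Ux)// hB.
have symg : (g x)^T = g x by case: mg => _ _ h _; exact: h.
have [P PP eE] := frame_change symg oe oe'.
have [Q QQ xiE] := normal_frame_change mG lF gE Ux oe oxi oxi'.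
exists P, Q, mu, lambda; split=> // r.
have /(matrix_in_frameP (xi := xi') (r := r) mg mG lF gE Ux _ oe' (oxi'.2 r)) -> := hA r.
have rot := sffmx_rotate mg mG lF gE Ux e P Q r nxi.
apply: etrans (esym rot) _.
exact: (f_equal2 (fun a b => sffmx g G F x a b r) (esym (funext eE)) (esym (funext xiE))).
Qed.
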